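(* Let the dimension $d\ge 2$ and a norm $\|\cdot\|$ on $\mathbb R^d$, which is the $p$-norm for some $1\le p\le\infty$, be fixed. For each $n$ let $S_n^d$ be the $d$-dimensional hypercube of volume $n$, let $\mathcal P$ be a Poisson process of density $1$ in $S_n^d$, and for $r\ge 0$ let $G=G_{n,r}$ be the graph with vertex set $\mathcal P$ in which two distinct points $x,y$ are joined if and only if $\|x-y\|\le r$. Then $$\mathcal H(G\text{ is 2-connected})=\mathcal H(G\text{ has a Hamilton cycle})$$ with high probability, i.e. the probability that this equality holds tends to $1$ as $n\to\infty$.
   Context: For a fixed point set $\mathcal P$ and a monotone (increasing) graph property $P$, $\mathcal H(P)$ denotes the smallest $r$ for which the graph $G_{n,r}$ on this point set has property $P$. Thus $\mathcal H(P)$ is a random variable depending on $\mathcal P$; both sides of the equality are evaluated on the same realisation of $\mathcal P$. ''With high probability'' (whp) means with probability tending to $1$ as $n\to\infty$. *)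

(* Defs.v *)
From HB Require Import structures.
From mathcomp Require Import all_boot all_order all_algebra finmap.
From mathcomp Require Import all_classical all_reals all_analysis.

Set Implicit Arguments.
Unset Strict Implicit.
Unset Printing Implicit Defensive.

Import Order.TTheory GRing.Theory Num.Theory.

Local Open Scope classical_set_scope.
Local Open Scope ring_scope.

(* A simple graph is a symmetric irreflexive [e : rel T] on a [T : finType]. *)
Definition graph_property := forall T : finType, rel T -> Prop.

Definition k_connected (k : nat) : graph_property := fun T e =>
  (k < #|T|)%N /\
  forall S : {set T}, (#|S| < k)%N -> forall x y, x \notin S -> y \notin S ->
    connect [rel u v | [&& u \notin S, v \notin S & e u v]] x y.

Definition has_hamilton_cycle : graph_property := fun T e =>
  exists c : seq T, [/\ ucycle e c, (2 < size c)%N & forall x, x \in c].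

(* [d.-tuple (measurableTypeR R)] carries the product of the Borel
   sigma-algebras of R, that is, the Borel sigma-algebra of R^d. *)
Definition real_space (R : realType) (d : nat) := d.-tuple (measurableTypeR R).

(* The p-norm, for [1 <= p <= +oo]; the value at [-oo] is irrelevant. *)
Definition pnorm (R : realType) (p : \bar R) (d : nat) (v : 'I_d -> R) : R :=
  match p with
  | EFin q => (\sum_(i < d) `|v i| `^ q) `^ q^-1
  | +oo%E => \big[Num.max/0]_(i < d) `|v i|
  | -oo%E => 0
  end.

Definition pdist (R : realType) (p : \bar R) (d : nat) (x y : real_space R d) : R :=
  pnorm p (fun i => tnth x i - tnth y i).

Definition geometric_graph (R : realType) (p : \bar R) (d : nat)
    (X : {fset real_space R d}) (r : R) : rel X :=
  fun x y => (x != y) && (pdist p (val x) (val y) <= r).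

(* The smallest radius [r >= 0] at which the geometric graph on [X] has
   property [Q], and [+oo] if there is none (e.g. if [X] has too few points). *)
Definition hitting_radius (R : realType) (p : \bar R) (d : nat)
    (Q : graph_property) (X : {fset real_space R d}) : \bar R :=
  xget +oo%E [set r%:E | r in [set r : R |
    [/\ 0 <= r, Q X (geometric_graph p r)
      & forall s, 0 <= s -> Q X (geometric_graph p s) -> r <= s]]].

(* Lebesgue measure on the Borel sets of R^d, as the d-fold iterated product
   of [lebesgue_measure]; not meaningful on non-measurable sets. *)
Fixpoint volume (R : realType) (d : nat) : set (real_space R d) -> \bar R :=
  match d with
  | 0 => fun A => (\1_A [tuple])%:E
  | d'.+1 => fun A =>
      (\int[@lebesgue_measure R]_x volume [set t | A (cons_tuple x t)])%E
  end.

Definition cube (R : realType) (d n : nat) : set (real_space R d) :=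
  [set x | forall i : 'I_d, 0 <= (tnth x i : R) <= n%:R `^ d%:R^-1].

Definition count_in (R : realType) (d : nat) (X : {fset real_space R d})
    (B : set (real_space R d)) : nat :=
  #|` [fset x in X | x \in B]%fset|.

Definition mutually_independent (R : realType) (dT : measure_display)
    (T : measurableType dT) (P : probability T R) (k : nat)
    (N : 'I_k -> T -> nat) : Prop :=
  forall U : 'I_k -> set nat,
    P (\bigcap_(i in [set: 'I_k]) (N i @^-1` U i)) =
    (\prod_(i < k) P (N i @^-1` U i))%E.

(* [X] is a Poisson process of density 1 in the bounded region [S].  As such a
   process is almost surely finite, its realisations are taken to be finite
   sets.  The second argument of [poisson_prob] is a dummy. *)
Record poisson_process (R : realType) (dT : measure_display)
    (T : measurableType dT) (P : probability T R) (d : nat)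
    (S : set (real_space R d)) (X : T -> {fset real_space R d}) : Prop := {
  poisson_process_sub : forall w, [set` X w] `<=` S ;
  poisson_process_measurable : forall B, measurable B -> B `<=` S ->
    measurable_fun [set: T] (fun w => count_in (X w) B) ;
  poisson_process_law : forall B, measurable B -> B `<=` S ->
    forall U : set nat,
      P [set w | U (count_in (X w) B)] = poisson_prob (fine (volume B)) 0 U ;
  poisson_process_independent : forall (k : nat) (B : 'I_k -> set (real_space R d)),
    (forall i, measurable (B i)) -> (forall i, B i `<=` S) ->
    trivIset [set: 'I_k] B ->
    mutually_independent P (fun i w => count_in (X w) (B i))
}.

(* Main.v *)
(* Cut the cube into K^d congruent cells of volume lam. Call a cell sparse if it has
   fewer than a fixed number of points, and consider r of the order of the side of a
   cell; two cells are inner adjacent if all their points are joined, and outer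
   adjacent if some of their points could be joined. Near a k-dimensional face of the
   cube the outer neighbourhood of a cell has N_k cells, itself included, and there
   are about K^k places; the mesh is chosen with K about exp(mu lam), where mu is the
   minimum of (N_k + 1) / k.
   - A window of fixed size near a k-dimensional face has at most N_k + 1
     sparse cells whp: the expected number of windows with one more is of order
     K^k exp(- (N_k + 2) lam), up to powers of lam. At the minimising face, whp some
     nonempty cell has all its outer neighbours empty, such cells numbering about
     K^k exp(- N_k lam) on average, so below a threshold rho the graph is disconnected.
   - Above rho, the dense cells form a connected sea. A point cut off from the sea lies
     in a cluster of bounded extent, which is a clique: otherwise its inner
     neighbourhood would contain more than N_k + 1 sparse cells, the inner and outer
     neighbourhoods differing by a surface term only. If the graph is 2-connected,
     then two disjoint edges leave each cluster, so that a path through the whole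
     cluster can be closed up by a route through the sea. Splicing these loops and the
     dense cells along a spanning tree gives a Hamilton cycle.
   Hence whp the two properties are equivalent at every radius. The event is measurable
   since it is decided by rational radii, and at each radius by the set of occupied
   cells of all sufficiently fine meshes. *)

Require Import Defs.
From mathcomp Require Import all_boot zify.

Set Implicit Arguments.
Unset Strict Implicit.
Unset Printing Implicit Defensive.

(** * Threading a spanning tree *)

(** The count [N_k] is never computed: the same number of lattice cells, [outer_count], bounds the
    sparse cells of a window and the empty cells around an isolated one, so no volume of a norm ball
    enters. The two estimates need [k * mu < N_k + 2] at every face and [k * mu > N_k] at some face.
    The minimum of [(N_k + 1) / k] leaves a factor [exp lam] on either side, which beats all powers
    of [lam], rounding of the mesh included. A set of cells of extent more than [2 h] has [h ^ d]
    boundary cells beyond those of a single cell; all losses are of surface order in a range linear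
    in [h], so a large fixed [h] suffices. The equivalence is wanted at all radii above rho, where
    edges may be arbitrarily long and lead out of reach of a bounded route. Below a fixed multiple
    of the cell side, the exits given by 2-connectivity stay near; beyond it, a cluster is joined to
    all points of a nearby sea cell and exits come for free. Loops of several clusters may cross one
    sea cell. Vertices are therefore reserved, and a dense cell must hold enough points to serve all
    clusters nearby and still offer one edge to each child in the tree. *)

Section PairCount.
Variables (V : eqType).

Fixpoint pair_count (a : pred V) (x : V) (s : seq V) : nat :=
  if s is y :: s' then (a x && a y) + pair_count a y s' else 0.

Lemma pair_count_cat a x s1 s2 :
  pair_count a x (s1 ++ s2) = pair_count a x s1 + pair_count a (last x s1) s2.
Proof. by elim: s1 x => //= y s1 IH x; rewrite IH addnA. Qed.

Lemma pair_count_gt0 a x s : 0 < pair_count a x s ->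
  exists s1 y s2, [/\ s = s1 ++ y :: s2, a (last x s1) & a y].
Proof.
elim: s x => //= y s IH x; case: (boolP (a x && a y)) => [/andP[ax ay] _|_ /=].
  by exists [::], y, s.
rewrite add0n => /IH[s1 [z [s2 [-> az1 az2]]]].
by exists (y :: s1), z, s2.
Qed.

Lemma pair_count_all a x s : all a (x :: s) -> pair_count a x s = size s.
Proof. elim: s x => //= y s IH x /and3P[-> ay als].
by rewrite IH ?ay //= ay als. Qed.

End PairCount.

(* A spanning cycle is grown by replacing, for each item [j] in turn, an edge of
   the cycle joining two vertices of [P (par j)] by a detour along [P j]. *)
Section PathTree.
Variables (V : finType) (e : rel V) (J : finType) (root : J) (par : J -> J).
Variables (rk : J -> nat) (P : J -> seq V).
Hypothesis rk_par : forall j, j != root -> rk (par j) < rk j.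
Hypothesis P_sorted : forall j, sorted e (P j).
Hypothesis P_uniq : forall j, uniq (P j).
Hypothesis P_disj : forall i j x, x \in P i -> x \in P j -> i = j.
Hypothesis P_cover : forall x, exists j, x \in P j.
Hypothesis P_ends : forall j x y s, j != root -> x \in P (par j) ->
  P j = y :: s -> e x y && e (last y s) x.
Hypothesis P_children : forall j, j != root ->
  #|[pred i | (i != root) && (par i == par j)]| < size (P (par j)).

(** The last clause is a budget: an item enters with one pair fewer than its size, and each child
    inserted later opens at most one of its pairs. Both ends stay those of [P root], so that the
    path can be closed up afterwards. *)
Let inv (s : seq J) y c := [/\ perm_eq (y :: c) (flatten (map P (root :: s))),
   path e y c,
   y = head y (P root) /\ last y c = last y (P root) &
   forall i, i \in root :: s ->
     size (P i) <= (pair_count (mem (P i)) y c) + 1 + count (fun j => par j == i) s].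

(** By the budget and [P_children], some two vertices of [P (par j)] are still consecutive on the
    path. The detour along [P j] goes between them, since [P_ends] joins its ends to any vertex of
    the parent. *)
Lemma path_tree_insert s j y c : uniq (rcons s j) -> root \notin rcons s j ->
  par j \in root :: s -> inv s y c -> exists c', inv (rcons s j) y c'.
Proof.
move=> us rs pj [pe pa [hd la] cnt].
have jr : j != root by apply: contraNneq rs => <-; rewrite mem_rcons inE eqxx.
have js : j \notin root :: s.
  by move: us; rewrite rcons_uniq inE => /andP[js _]; rewrite negb_or jr.
case Pj: (P j) => [|u t].
  exists c; split => //.
    by rewrite map_cons map_rcons -rcons_cons flatten_rcons Pj cats0.
  move=> i; rewrite -rcons_cons mem_rcons inE => /orP[/eqP->|/cnt]; first by rewrite Pj.
  by rewrite -cats1 count_cat; lia.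
(* The children of [par j] already in [s], and [j] itself, are among all its children, so the budget
   leaves a pair. *)
have chld : count (fun i => par i == par j) s + 1 < size (P (par j)).
  apply: leq_ltn_trans (P_children jr).
  rewrite -(_ : count (fun i => par i == par j) (rcons s j) = _ + 1); last first.
    by rewrite -cats1 count_cat /= eqxx addn0.
  rewrite -size_filter cardE; apply: uniq_leq_size; first by rewrite filter_uniq.
  move=> i; rewrite mem_filter mem_enum inE => /andP[-> is_].
  by rewrite andbT; apply: contraNneq rs => <-.
have := cnt _ pj => cntp.
have /pair_count_gt0[c1 [z [c2 [cE ax az]]]] :
  0 < pair_count (mem (P (par j))) y c by lia.
have {}ax : last y c1 \in P (par j) := ax.
have {}az : z \in P (par j) := az.
have /andP[exu _] := P_ends jr ax Pj.
have /andP[_ elz] := P_ends jr az Pj.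
have pt : path e u t by have := P_sorted j; rewrite Pj.
exists (c1 ++ (u :: t) ++ z :: c2); split.
- rewrite map_cons map_rcons -rcons_cons flatten_rcons Pj.
  rewrite -cat_cons.
  have : perm_eq ((y :: c1) ++ (u :: t) ++ (z :: c2))
      (((y :: c1) ++ (z :: c2)) ++ (u :: t)).
    by rewrite -!catA perm_cat2l perm_catC.
  move/perm_trans; apply; rewrite perm_cat2r.
  by move: pe; rewrite cE.
- move: pa; rewrite cE !cat_path /= => /and3P[-> _ ->].
  by rewrite exu pt /= elz.
- by split => //; rewrite -la cE !last_cat.
- move=> i; rewrite -rcons_cons mem_rcons inE => /orP[/eqP->|iS].
    have ge A b n b' C : n.+1 <= A + (b + n + b') + 1 + C by clear; lia.
    rewrite !pair_count_cat /= Pj (@pair_count_all _ _ u t).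
      exact: ge.
    by apply/allP => v vin; exact: vin.
  have := cnt _ iS; rewrite cE !pair_count_cat -cats1 count_cat /= addn0.
  (* The opened pair is lost to item [i] only if [i] is [par j], and then the number of inserted
     children grows by one. *)
  have grow A b B C b1 T b2 D n : b <= D -> n <= A + (b + B) + 1 + C ->
    n <= A + (b1 + T + (b2 + B)) + 1 + (C + D) by clear; lia.
  apply: grow; case: eqVneq => [_|ne]; first exact: leq_b1.
  have -> : (last y c1 \in P i) = false; last by [].
  by apply/negP => h; move: ne; rewrite (P_disj ax h) eqxx.
Qed.

Lemma path_tree_spanning y0 t0 : P root = y0 :: t0 ->
  exists c, [/\ uniq (y0 :: c), path e y0 c, forall x, x \in y0 :: c
    & last y0 c = last y0 t0].
Proof.
move=> Pr.
pose le := fun i j => rk i <= rk j.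
(* Insertion by increasing rank puts a parent before its children. *)
pose w := sort le [seq j <- enum J | j != root].
have w_sorted : sorted le w by apply: sort_sorted => i j; exact: leq_total.
have w_uniq : uniq w by rewrite sort_uniq filter_uniq ?enum_uniq.
have memw j : (j \in w) = (j != root) by rewrite mem_sort mem_filter mem_enum andbT.
have main s1 s2 : w = s1 ++ s2 -> exists c, inv s1 y0 c.
  elim/last_ind: s1 s2 => [|s1 j IH] s2 ws.
    exists t0; split => //=.
    - by rewrite Pr cats0.
    - by have := P_sorted root; rewrite Pr.
    - by rewrite Pr.
    - move=> i; rewrite inE => /eqP ->; rewrite Pr (@pair_count_all _ _ y0 t0).
        by rewrite /= addn1 leq_addr.
      by apply/allP => v vin; exact: vin.
  have [|c ic] := IH (j :: s2); first by rewrite ws cat_rcons.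
  have us : uniq (rcons s1 j) by move: w_uniq; rewrite ws cat_uniq => /and3P[].
  have rs : root \notin rcons s1 j.
    by apply/negP => h; have := memw root; rewrite ws mem_cat h eqxx.
  have jr : j != root by apply: contraNneq rs => <-; rewrite mem_rcons inE eqxx.
  have [|c' ?] := path_tree_insert us rs _ ic; last by exists c'.
  rewrite inE; case: (eqVneq (par j) root) => //= pr.
  have := memw (par j); rewrite ws pr cat_rcons mem_cat => /orP[//|].
  rewrite inE => /orP[/eqP pj|h]; first by have := rk_par jr; rewrite pj ltnn.
  exfalso; move: w_sorted; rewrite ws cat_rcons sorted_pairwise; last by move=> ? ? ?; exact: leq_trans.
  rewrite pairwise_cat => /and3P[_ _ /=/andP[/allP/(_ _ h)]].
  by rewrite /le leqNgt rk_par.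
have [|c [pe pa [hd la] _]] := main w [::]; first by rewrite cats0.
have memf x : x \in flatten (map P (root :: w)).
  have [j xj] := P_cover x.
  apply/flattenP; exists (P j) => //; apply: map_f.
  by rewrite inE memw; case: eqVneq.
exists c; split => //.
- rewrite (perm_uniq pe).
  have : uniq (root :: w) by rewrite /= memw eqxx w_uniq.
  elim: (root :: w) => //= i s IH /andP[ins us].
  rewrite cat_uniq P_uniq IH // andbT /=.
  apply/hasPn => x /flattenP[l /mapP[k ks ->]] xk; apply/negP => xi.
  by move: ins; rewrite (P_disj xi xk) ks.
- by move=> x; rewrite (perm_mem pe).
- by rewrite la Pr.
Qed.

End PathTree.

(** * Two disjoint edges leaving a vertex set of a 2-connected graph *)

Section TwoExits.
Variables (V : finType) (e : rel V).
Hypothesis e_conn : forall S : {set V}, #|S| < 2 ->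
  forall x y, x \notin S -> y \notin S ->
  connect [rel u v | [&& u \notin S, v \notin S & e u v]] x y.

Lemma connect_crossing (f : rel V) (U : {pred V}) x y :
  connect f x y -> x \in U -> y \notin U -> exists u w, [/\ u \in U, w \notin U & f u w].
Proof.
case/connectP => p; elim: p x => [|z p IH] x /=; first by move=> _ -> ->.
case/andP=> fxz pz ly xU yU; case: (boolP (z \in U)) => zU; last by exists x, z.
exact: IH pz ly zU yU.
Qed.

Lemma crossing_avoiding (U : {pred V}) z x y : x \in U -> y \notin U ->
  x != z -> y != z -> exists u w, [/\ u \in U, w \notin U, e u w, u != z & w != z].
Proof.
move=> xU yU xz yz.
have := @e_conn [set z]; rewrite cards1 => /(_ isT x y).
rewrite !inE => /(_ xz yz) /connect_crossing/(_ xU yU)[u [w [uU wU]]].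
by rewrite /= !inE => /and3P[uz wz euw]; exists u, w.
Qed.

(** A case of Menger's theorem. If two crossings with distinct inner ends share their outer end, a
    third crossing that avoids this end is combined with whichever of the two has another inner end.
    Equal inner ends are left only when [U] is a single vertex. *)
Lemma two_disjoint_exits (U : {pred V}) x y y' :
  x \in U -> y \notin U -> y' \notin U -> y != y' ->
  exists u1 u2 w1 w2, [/\ [&& u1 \in U, u2 \in U, w1 \notin U & w2 \notin U],
    e u1 w1, e u2 w2, w1 != w2
    & (u1 == u2) ==> [forall u in U, u == u1]].
Proof.
move=> xU yU yU' yy'.
have avoid u w : u \in U -> w \notin U -> u != w by move=> uU; apply: contraNneq => <-.
have ex z : z \in U -> z \notin U = false by move=> ->.
have cr z : z \notin U -> exists u w, [/\ u \in U, w \notin U, e u w & w != z].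
  move=> zU.
  have [t [tU tz]] : exists t, t \notin U /\ t != z.
    by case: (eqVneq y z) => [yz|]; [exists y'; rewrite -yz eq_sym | exists y].
  have [|u [w [uU wU euw _ wz]]] := @crossing_avoiding U z x t xU tU _ tz.
    exact: avoid.
  by exists u, w.
have [u1 [w1 [u1U w1U e1 _]]] := cr _ yU.
case: (boolP [exists u in U, u != u1]) => [/exists_inP[u' uU' u'1]|none]; last first.
  have only : [forall u in U, u == u1].
    by apply/forall_inP => u uU; apply: contraNT none => h; apply/exists_inP; exists u.
  have [u2 [w2 [u2U w2U e2 w21]]] := cr _ w1U.
  exists u1, u2, w1, w2; split => //; first by rewrite u1U u2U w1U w2U.
    by rewrite eq_sym.
  by rewrite only implybT.
have [//||u2 [w2 [u2U w2U e2 u21 _]]] := @crossing_avoiding U u1 u' y uU' yU.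
  by rewrite eq_sym; apply: avoid.
case: (eqVneq w1 w2) => [w12|ne]; last first.
  exists u1, u2, w1, w2; split => //; first by rewrite u1U u2U w1U w2U.
  by rewrite eq_sym (negbTE u21).
have [u3 [w3 [u3U w3U e3 w31]]] := cr _ w1U.
case: (eqVneq u3 u1) => [u31|ne].
  exists u2, u3, w2, w3; split => //; first by rewrite u3U u2U w2U w3U.
    by rewrite -w12 eq_sym.
  by rewrite u31 (negbTE u21).
exists u1, u3, w1, w3; split => //; first by rewrite u1U u3U w1U w3U.
  by rewrite eq_sym.
by rewrite eq_sym (negbTE ne).
Qed.

End TwoExits.

(** * Lattice cells *)

Lemma leq_card_inj (T1 T2 : finType) (f : T1 -> T2) (S : {pred T1}) (U : {pred T2}) :
  {in S &, injective f} -> {in S, forall x, f x \in U} -> #|S| <= #|U|.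
Proof.
move=> fi fU; rewrite -(card_in_image fi); apply: subset_leq_card.
by apply/subsetP => y /imageP[x xS ->]; exact: fU.
Qed.

Lemma card_ffun_slice d m (i : 'I_d) (B : {pred 'I_m}) :
  #|[pred x : {ffun 'I_d -> 'I_m} | x i \in B]| = #|B| * m ^ d.-1.
Proof.
transitivity #|(family (fun j => if j == i then [pred k in B] else predT)
  : {pred {ffun 'I_d -> 'I_m}})|.
  apply: eq_card => x; rewrite inE; apply/idP/familyP => [xi j|/(_ i)].
    by case: eqP => // ->.
  by rewrite eqxx.
rewrite card_family foldrE big_image /= (bigD1 i) //= eqxx.
congr (_ * _).
rewrite (eq_bigr (fun=> m)); last by move=> j /negbTE ->; rewrite card_ord.
by rewrite prod_nat_const; have := cardC1 i; rewrite card_ord => <-.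
Qed.

Lemma card_ordinal_le m (B : {pred 'I_m}) (u v : nat) :
  (forall k : 'I_m, k \in B -> u <= k < v) -> #|B| <= v - u.
Proof.
move=> hB; rewrite cardE -(size_map val) -(size_iota u (v - u)).
apply: uniq_leq_size; first by rewrite map_inj_uniq ?enum_uniq //; exact: val_inj.
move=> x /mapP[k]; rewrite mem_enum => /hB h ->.
by move: h; rewrite mem_iota /=; lia.
Qed.

Definition coordinate d m (x : {ffun 'I_d -> 'I_m}) (i : 'I_d) : nat := x i.

Lemma coordinate_lt d m (x : {ffun 'I_d -> 'I_m}) i : coordinate x i < m.
Proof. exact: ltn_ord. Qed.

Lemma coordinate_inj d m (x y : {ffun 'I_d -> 'I_m}) : coordinate x =1 coordinate y -> x = y.
Proof. by move=> xy; apply/ffunP => i; apply/val_inj; exact: xy. Qed.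

(** [inord] sends a value above [m] to 0, so each use has to bound its coordinates. *)
Definition lattice_point d m (f : 'I_d -> nat) : {ffun 'I_d -> 'I_m.+1} :=
  [ffun i => inord (f i)].

Lemma coordinate_lattice_point d m f i : f i <= m -> coordinate (@lattice_point d m f) i = f i.
Proof. by move=> fi; rewrite /coordinate ffunE inordK. Qed.

Section Shapes.
Variables (d R : nat).

Definition absdiff (x y : nat) := (x - y) + (y - x).

Lemma absdiffC x y : absdiff x y = absdiff y x.
Proof. by rewrite /absdiff addnC. Qed.

(* A position type records, for each axis, whether a region lies away from both
   facets of the cube ([None]), at the lower one ([Some false]) or at the upper
   one ([Some true]). *)
Definition position_type := {ffun 'I_d -> option bool}.

Definition free_axes (tau : position_type) := #|[pred i | tau i == None]|.

(** The place of the reference cell in a model box of side [2 R + 1]: central along a free axis,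
    against a facet otherwise, so that the box truncates the neighbourhood as the cube does. *)
Definition cell_shape_center (tau : position_type) (i : 'I_d) : nat :=
  match tau i with None => R | Some false => 0 | Some true => R.*2 end.

Definition cell_shape (J : ('I_d -> nat) -> bool) (tau : position_type) :=
  [pred x : {ffun 'I_d -> 'I_(R.*2.+1)} | J (fun i => absdiff (coordinate x i) (cell_shape_center tau i))].

End Shapes.

Arguments cell_shape_center {d}.
Arguments cell_shape {d}.

(** * Isoperimetry for sets of cells *)

Section Isoperimetry.
Variables (d R : nat) (I O : ('I_d -> nat) -> bool).
Hypothesis I_anti : forall a b, (forall i, a i <= b i) -> I b -> I a.
Hypothesis O_I : forall a, O a -> (forall i, 2 <= a i) -> I (fun i => a i - 2).

(** Shrinking all offsets by 2 turns outer into inner adjacency. The excess is therefore at most the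
    number of cells having some offset at most 2, which lie in five slices per axis. *)
Lemma outer_le_inner (tau : position_type d) :
  #|cell_shape R O tau| <= #|cell_shape R I tau| + d * (5 * (R.*2.+1) ^ d.-1).
Proof.
pose c := cell_shape_center R tau.
have cR i : c i <= R.*2 by rewrite /c /cell_shape_center; case: (tau i) => [[]|]; lia.
pose T := {ffun 'I_d -> 'I_(R.*2.+1)}.
(* Offsets at least 3 rather than 2: after the move a cell is still strictly on its side of the
   centre, which makes the move injective. *)
pose far := [pred x : T | [forall i, 3 <= absdiff (coordinate x i) (c i)]].
have farP (x : T) i : x \in far -> 3 <= absdiff (coordinate x i) (c i) by move=> /forallP.
have -> : #|cell_shape R O tau| = #|[predI cell_shape R O tau & far]| + #|[predD cell_shape R O tau & far]|.
  by rewrite -(cardID far).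
apply: leq_add.
  pose f (x : T) : T := lattice_point _
    (fun i => if c i < coordinate x i then coordinate x i - 2 else coordinate x i + 2).
  have fE (x : T) i : x \in far ->
      coordinate (f x) i = if c i < coordinate x i then coordinate x i - 2 else coordinate x i + 2.
    move=> /(farP _ i); have := coordinate_lt x i; have := cR i; rewrite /absdiff => h1 h2 h3.
    by apply: coordinate_lattice_point; case: (ltnP (c i) (coordinate x i)); lia.
  have f_inj x y : x \in far -> y \in far -> f x = f y -> x = y.
    move=> fx fy fxy; apply: coordinate_inj => i.
    have := congr1 (fun g => coordinate g i) fxy; rewrite !fE //.
    have := farP _ i fx; have := farP _ i fy; rewrite /absdiff.
    by case: (ltnP (c i) (coordinate x i)); case: (ltnP (c i) (coordinate y i)); lia.
  have f_in x : x \in cell_shape R O tau -> x \in far -> f x \in cell_shape R I tau.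
    move=> xO fx; rewrite inE; apply: I_anti (O_I (xO : O _) _) => i; last first.
      by apply: leq_trans (farP _ i fx).
    rewrite -/c fE //; have := farP _ i fx; rewrite /absdiff.
    by case: (ltnP (c i) (coordinate x i)); lia.
  apply: (@leq_card_inj T T f) => [x y /andP[/= _ ?] /andP[/= _ ?]|x /andP[/= ? ?]].
    exact: f_inj.
  exact: f_in.
pose near i := [pred x : T | x i \in [pred k : 'I_(R.*2.+1) | absdiff k (c i) <= 2]].
have nb i : #|near i| <= 5 * (R.*2.+1) ^ d.-1.
  rewrite card_ffun_slice leq_mul2r; apply/orP; right.
  apply: leq_trans (@card_ordinal_le _ _ (c i - 2) (c i + 3) _) _; last by lia.
  by move=> k; rewrite inE /absdiff; lia.
apply: (@leq_trans (\sum_(i < d) #|near i|)); last first.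
  rewrite -[X in X * _](card_ord d) -sum_nat_const; exact: leq_sum.
apply: (@leq_trans #|[pred x : T | [exists i, x \in near i]]|).
  apply: subset_leq_card; apply/subsetP => x; rewrite !inE => /andP[/forallPn[i hi] _].
  by apply/existsP; exists i; rewrite !inE; move: hi; rewrite -ltnNge.
rewrite -sum1_card.
under [X in _ <= X]eq_bigr do rewrite -sum1_card.
rewrite (exchange_big_dep xpredT) //= [X in X <= _]big_mkcond /=.
apply: leq_sum => x _; case: ifP => // /existsP[i xi].
by rewrite (bigD1 i).
Qed.

Variables (H h K : nat).
Hypothesis d_ge2 : 2 <= d.
Hypothesis I_bound : forall a i, I a -> a i <= R.
Hypothesis I_cube : forall a, (forall i, a i <= H) -> I a.
Hypothesis hH : h.*2 <= H.
Hypothesis HR : H <= R.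

Local Notation cell := {ffun 'I_d -> 'I_K.+1}.

Definition cell_dist (x y : cell) (i : 'I_d) : nat := absdiff (coordinate x i) (coordinate y i).

Definition inner_boundary (A : {pred cell}) :=
  [pred y | (y \notin A) && [exists a in A, I (cell_dist a y)]].

(** Copies of the shape are placed at the two extreme cells of [A] along [j]. The half beyond each
    extreme misses [A], and only the central slice is lost. At heights between the extremes, a cube
    of [h ^ d] further boundary cells lies beyond a cell that is extreme along a second axis. *)
Lemma isoperimetry (tau : position_type d) (A : {pred cell}) a0 a1 j :
  (forall a i, a \in A -> tau i != Some false -> R <= coordinate a i) ->
  (forall a i, a \in A -> tau i != Some true -> coordinate a i + R <= K) ->
  a0 \in A -> a1 \in A -> coordinate a0 j + H < coordinate a1 j ->
  #|cell_shape R I tau| + h ^ d <= #|inner_boundary A| + R.*2.+1 ^ d.-1.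
Proof.
move=> roomD roomU a0A a1A ext.
have max_of i : exists2 a, a \in A & forall b, b \in A -> coordinate b i <= coordinate a i.
  by have [a aA aP] := @arg_maxnP _ a0 [in A] (fun b : cell => coordinate b i) a0A; exists a.
have min_of i : exists2 a, a \in A & forall b, b \in A -> coordinate a i <= coordinate b i.
  by have [a aA aP] := @arg_minnP _ a0 [in A] (fun b : cell => coordinate b i) a0A; exists a.
have [amin aminA minP] := min_of j.
have [amax amaxA maxP] := max_of j.
have [i ij] : exists i, i != j.
  have : 0 < #|predC1 j| by rewrite cardC1 card_ord; lia.
  by case/card_gt0P => i; rewrite inE => ?; exists i.
pose up l := tau l != Some true.
(* The side is chosen so that [tau] puts no facet there, and hence there is room beyond [b]. *)
have [b bA bP] : exists2 a, a \in A & forall x, x \in A ->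
    if up i then coordinate x i <= coordinate a i else coordinate a i <= coordinate x i.
  by case: (up i).
pose T := {ffun 'I_d -> 'I_(R.*2.+1)}.
pose c := cell_shape_center R tau.
pose sh : simpl_pred T := cell_shape R I tau.
pose S1 := [predI sh & [pred x : T | c j < coordinate x j]].
pose S2 := [predI sh & [pred x : T | coordinate x j < c j]].
pose S0 := [pred x : T | x j \in [pred k : 'I_(R.*2.+1) | nat_of_ord k == c j]].
have sh_bound (x : T) l : x \in sh -> absdiff (coordinate x l) (c l) <= R by move=> xs; apply: I_bound (xs : I _).
pose tr (a : cell) (x : T) : cell := lattice_point _ (fun l => coordinate a l + coordinate x l - c l).
have trE a x l : a \in A -> x \in sh ->
    (c l <= coordinate a l + coordinate x l) /\ coordinate (tr a x) l = coordinate a l + coordinate x l - c l.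
  move=> aA xsh; have b0 := sh_bound x l xsh.
  have b1 : c l <= coordinate a l + coordinate x l.
    have := roomD a l aA; move: b0; rewrite /c /cell_shape_center /absdiff.
    by clear; case: (tau l) => [[]|] //= + /(_ isT); lia.
  split=> //; apply: coordinate_lattice_point.
  have := roomU a l aA; move: b0; have := coordinate_lt a l; have := coordinate_lt x l; rewrite /c /cell_shape_center /absdiff.
  clear -b1; move: b1; rewrite /c /cell_shape_center.
  by case: (tau l) => [[]|] /= b1 h0 h1 h2 h3; [|have := h3 isT|have := h3 isT]; lia.
have tr_inj a x y : a \in A -> x \in sh -> y \in sh -> tr a x = tr a y -> x = y.
  move=> aA xs ys xy; apply: coordinate_inj => l.
  have := congr1 (fun g => coordinate g l) xy.
  have [h1 ->] := trE a x l aA xs; have [h2 ->] := trE a y l aA ys.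
  by clear -h1 h2; lia.
have trI a x : a \in A -> x \in sh -> I (cell_dist a (tr a x)).
  move=> aA xs; apply: I_anti (xs : I _) => l; rewrite /cell_dist /absdiff.
  by have [h1 ->] := trE a x l aA xs; rewrite -/(c l); clear -h1; lia.
pose N := inner_boundary A.
have inN a y : a \in A -> y \notin A -> I (cell_dist a y) -> y \in N.
  by move=> aA yA Iay; rewrite inE yA; apply/exists_inP; exists a.
pose above := [pred y : cell | coordinate amax j < coordinate y j].
pose below := [pred y : cell | coordinate y j < coordinate amin j].
have c1 : #|S1| <= #|[predI N & above]|.
  have tr_in x : x \in sh -> c j < coordinate x j -> tr amax x \in [predI N & above].
    move=> xs xj; have yj : coordinate amax j < coordinate (tr amax x) j.
      by have [? ->] := trE amax x j amaxA xs; lia.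
    apply/andP; split=> //=; apply: (inN amax) => //; last exact: trI.
    by apply/negP => /maxP; rewrite leqNgt yj.
  apply: (@leq_card_inj T cell (tr amax)) => [x y /andP[/= xs _] /andP[/= ys _]|x /andP[/= xs xj]].
    exact: tr_inj.
  exact: tr_in.
have c2 : #|S2| <= #|[predI N & below]|.
  have tr_in x : x \in sh -> coordinate x j < c j -> tr amin x \in [predI N & below].
    move=> xs xj; have yj : coordinate (tr amin x) j < coordinate amin j.
      by have [? ->] := trE amin x j aminA xs; lia.
    apply/andP; split=> //=; apply: (inN amin) => //; last exact: trI.
    by apply/negP => /minP; rewrite leqNgt yj.
  apply: (@leq_card_inj T cell (tr amin)) => [x y /andP[/= xs _] /andP[/= ys _]|x /andP[/= xs xj]].
    exact: tr_inj.
  exact: tr_in.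
have bj : coordinate amin j <= coordinate b j <= coordinate amax j by rewrite minP // maxP.
have ext' : coordinate amin j + h.*2 < coordinate amax j.
  by have := minP _ a0A; have := maxP _ a1A; lia.
(* Along [j] the cube grows towards the side that keeps it between the extremes; one side has room
   [h], the extent being more than [2 h]. Along the other axes it grows away from a facet. *)
pose dir l := if l == j then coordinate b j + h <= coordinate amax j else up l.
have room t l : t < h ->
    (dir l -> coordinate b l + (l == i) + t <= K) /\ (~~ dir l -> (l == i) + t <= coordinate b l).
  move=> th; rewrite /dir; case: (eqVneq l j) => [->|lj].
    by rewrite eq_sym (negbTE ij) /=; have := coordinate_lt amax j; case: (leqP (coordinate b j + h) (coordinate amax j)) => ? ?; split=> // _; lia.
  have i1 := leq_b1 (l == i).
  split=> [ul|]; first by have := roomU b l bA ul; clear -i1 th hH HR; lia.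
  by rewrite negbK => /eqP tl; have := roomD b l bA; rewrite tl => /(_ isT); clear -i1 th hH HR; lia.
pose ex (t : {ffun 'I_d -> 'I_h}) : cell := lattice_point _
  (fun l => if dir l then coordinate b l + (l == i) + coordinate t l else coordinate b l - (l == i) - coordinate t l).
have exE t l : coordinate (ex t) l =
    if dir l then coordinate b l + (l == i) + coordinate t l else coordinate b l - (l == i) - coordinate t l.
  apply: coordinate_lattice_point; have [r1 r2] := room _ l (coordinate_lt t l).
  by case: ifP => [/r1//|_]; have := coordinate_lt b l; clear; lia.
have exj t : coordinate amin j <= coordinate (ex t) j <= coordinate amax j.
  rewrite exE /dir eqxx eq_sym (negbTE ij) /=; have := coordinate_lt t j.
  by case: (leqP (coordinate b j + h) (coordinate amax j)); lia.
have ex_inj t t' : ex t = ex t' -> t = t'.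
  move=> tt'; apply: coordinate_inj => l.
  have := congr1 (fun g => coordinate g l) tt'; rewrite !exE.
  have [_ r] := room _ l (coordinate_lt t l); have [_ r'] := room _ l (coordinate_lt t' l).
  move: r r'; have := leq_b1 (l == i).
  by clear; case: (dir l) => /= [_ _ _|? /(_ isT) + /(_ isT)]; lia.
have ex_in t : ex t \in [predD N & [predU above & below]].
  rewrite !inE; have := exj t => /andP[e1 e2].
  rewrite negb_or -!leqNgt e1 e2 /=.
  apply/andP; split.
    apply/negP => /bP; rewrite exE; have [_ r] := room _ i (coordinate_lt t i).
    move: r; rewrite /dir (negbTE ij) eqxx.
    by clear; case: (up i) => /= [_|/(_ isT)]; lia.
  apply/exists_inP; exists b => //; apply: I_cube => l.
  rewrite /cell_dist /absdiff exE; have := coordinate_lt t l; have := leq_b1 (l == i).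
  by move: hH HR; clear; case: (dir l); lia.
have c3 : h ^ d <= #|[predD N & [predU above & below]]|.
  have -> : h ^ d = #|{: {ffun 'I_d -> 'I_h}}| by rewrite card_ffun !card_ord.
  by apply: (@leq_card_inj {ffun 'I_d -> 'I_h} cell ex) => [t t' _ _|t _]; [exact: ex_inj|exact: ex_in].
have cardS : #|sh| <= #|S1| + #|S2| + R.*2.+1 ^ d.-1.
  rewrite -(cardID [pred x : T | c j < coordinate x j] sh) -addnA leq_add2l.
  rewrite -(cardID [pred x : T | coordinate x j < c j]); apply: leq_add.
    by apply: subset_leq_card; apply/subsetP => x; rewrite !inE => /andP[/andP[_ ->] ->].
  apply: (@leq_trans #|S0|); first apply: subset_leq_card.
    apply/subsetP => x; rewrite !inE -!leqNgt => /and3P[h1 h2 _].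
    by rewrite -[nat_of_ord _]/(coordinate x j) eqn_leq h1 h2.
  rewrite card_ffun_slice -[X in _ <= X]mul1n leq_mul2r; apply/orP; right.
  apply: leq_trans (@card_ordinal_le _ _ (c j) (c j).+1 _) _; last by lia.
  by move=> k; rewrite inE => /eqP ->; lia.
have cN : #|N| = #|[predI N & [predU above & below]]| + #|[predD N & [predU above & below]]|.
  by rewrite -(cardID [predU above & below]).
have cN' : #|[predI N & [predU above & below]]| = #|[predI N & above]| + #|[predI N & below]|.
  rewrite -(cardID above); congr (_ + _); apply: eq_card => y; rewrite !inE -/N.
    by case: (coordinate amax j < coordinate y j); rewrite /= ?andbT ?andbF.
  case: (ltnP (coordinate amax j) (coordinate y j)) => //= yj; rewrite ?andbF ?andbT //.
  by rewrite (_ : coordinate y j < coordinate amin j = false) ?andbF //; apply/negbTE; rewrite -leqNgt; lia.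
rewrite -/N cN cN'; apply: leq_trans (leq_add cardS c3) _.
by rewrite addnAC 2!leq_add2r leq_add.
Qed.

End Isoperimetry.

(** * Windows and the sea of full cells *)

Lemma first_exit (V : finType) (f : rel V) (U : {pred V}) x z :
  connect f x z -> x \in U -> z \notin U ->
  exists u w, [/\ connect [rel a b | [&& a \in U, b \in U & f a b]] x u,
    u \in U, w \notin U & f u w].
Proof.
case/connectP => p; elim: p x => [|y p IH] x /=; first by move=> _ -> ->.
case/andP=> fxy py zl xU zU; case: (boolP (y \in U)) => yU; last by exists x, y.
have [u [w [c uU wU fuw]]] := IH y py zl yU zU.
exists u, w; split=> //; apply: connect_trans c; apply: connect1.
by rewrite /= xU yU.
Qed.

Lemma connect_mono (V : finType) (f g : rel V) x y :
  (forall a b, f a b -> g a b) -> connect f x y -> connect g x y.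
Proof. by move=> fg; apply: connect_sub => a b /fg; exact: connect1. Qed.

Section Sea.
Variables (d R : nat) (I O : ('I_d -> nat) -> bool) (H h T0 D0 K : nat).
Hypothesis d_ge2 : 2 <= d.
Hypothesis I_anti : forall a b, (forall i, a i <= b i) -> I b -> I a.
Hypothesis I_bound : forall a i, I a -> a i <= R.
Hypothesis O_I : forall a, O a -> (forall i, 2 <= a i) -> I (fun i => a i - 2).
Hypothesis I_cube : forall a, (forall i, a i <= H) -> I a.
Hypothesis hH : h.*2 <= H.
Hypothesis HR : H <= R.
Hypothesis H_gt0 : 0 < H.
Hypothesis h_large : (5 * d + 1) * R.*2.+1 ^ d.-1 + 1 < h ^ d.
Hypothesis D0_large : H + T0 + 1 <= D0.

Local Notation cell := {ffun 'I_d -> 'I_K.+1}.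

(** Room for [T0 + 1] disjoint slabs, more than a window has nonfull cells; their thickness [R]
    bounds the length of an inner step. *)
Definition slab_room := T0.+1 * R.
Definition window_side := (D0 + slab_room + 1).*2.
Local Notation D := window_side.

Hypothesis DK : D <= K.

Definition in_window (lo x : cell) :=
  [forall i, coordinate lo i <= coordinate x i < coordinate lo i + D].

Definition valid_window (lo : cell) := [forall i, coordinate lo i + D <= K.+1].

(** By [DK] a window cannot touch both facets of an axis, so the order of the two tests is
    immaterial. *)
Definition window_type (lo : cell) : position_type d :=
  [ffun i => if coordinate lo i == 0 then Some false
             else if coordinate lo i + D == K.+1 then Some true else None].

Variable full : {pred cell}.
Hypothesis outer_T0 : forall tau, #|cell_shape R O tau| + 1 <= T0.
Hypothesis few_nonfull : forall lo, valid_window lo ->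
  #|[pred x | in_window lo x && (x \notin full)]| <= #|cell_shape R O (window_type lo)| + 1.

Definition cells_adjacent (P : {pred cell}) : rel cell :=
  [rel x y | [&& x \in P, y \in P & I (cell_dist x y)]].

Lemma cell_distC x y : cell_dist x y =1 @cell_dist d K y x.
Proof. by move=> i; rewrite /cell_dist absdiffC. Qed.

Lemma inner_sym x y : I (@cell_dist d K x y) -> I (cell_dist y x).
Proof. by apply: I_anti => i; rewrite cell_distC. Qed.

Lemma cells_adjacent_sym P : symmetric (cells_adjacent P).
Proof.
move=> x y; rewrite /cells_adjacent /= andbCA; congr [&& _, _ & _].
by apply/idP/idP; exact: inner_sym.
Qed.

Lemma connect_cells_sym P : connect_sym (cells_adjacent P).
Proof. exact: sym_connect_sym (cells_adjacent_sym P). Qed.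

(** Unit steps towards [y] are inner steps, [H] being positive, and never leave the box spanned by
    the two cells. *)
Lemma box_connect (P : {pred cell}) x y :
  (forall z, (forall i, minn (coordinate x i) (coordinate y i) <= coordinate z i <=
                        maxn (coordinate x i) (coordinate y i)) -> z \in P) ->
  connect (cells_adjacent P) x y.
Proof.
move: {2}(\sum_i absdiff (coordinate x i) (coordinate y i)) (leqnn (\sum_i absdiff (coordinate x i) (coordinate y i))) => n.
elim: n x => [|n IH] x.
  rewrite leqn0 sum_nat_eq0 => /forallP xy _.
  suff -> : x = y by exact: connect0.
  by apply: coordinate_inj => i; have := xy i; rewrite /absdiff /=; lia.
move=> sn boxP.
case: (eqVneq x y) => [->|xy]; first exact: connect0.
have [j xyj] : exists j, coordinate x j != coordinate y j.
  apply/existsP; apply: contraNT xy => /existsPn xy.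
  by apply/eqP; apply: coordinate_inj => i; apply/eqP; rewrite -[_ == _]negbK.
pose x' : cell := lattice_point K (fun i => if i == j then
  (if coordinate x j < coordinate y j then coordinate x j + 1 else coordinate x j - 1) else coordinate x i).
have x'E i : coordinate x' i = if i == j then
  (if coordinate x j < coordinate y j then coordinate x j + 1 else coordinate x j - 1) else coordinate x i.
  apply: coordinate_lattice_point; have := coordinate_lt x i; have := coordinate_lt x j; have := coordinate_lt y j.
  by clear; case: (i == j); case: (ltnP (coordinate x j) (coordinate y j)); lia.
have btw i : minn (coordinate x i) (coordinate y i) <= coordinate x' i <= maxn (coordinate x i) (coordinate y i).
  rewrite x'E; case: eqP => [->|_]; move: xyj; clear; last by lia.
  by case: (ltnP (coordinate x j) (coordinate y j)); lia.
have xP : x \in P by apply: boxP => i; clear; lia.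
have x'P : x' \in P by apply: boxP.
apply: (@connect_trans _ _ x').
  apply: connect1; rewrite /cells_adjacent /= xP x'P; apply: I_cube => i.
  rewrite /cell_dist /absdiff x'E; move: xyj H_gt0; clear.
  by case: (eqVneq i j) => [->|_]; case: (ltnP (coordinate x j) (coordinate y j)); lia.
apply: IH => [|z zb].
  rewrite -ltnS; apply: leq_trans sn.
  rewrite (bigD1 j) //= [X in _ <= X](bigD1 j) //= -addSn; apply: leq_add.
    by rewrite x'E eqxx /absdiff; move: xyj; clear; case: (ltnP (coordinate x j) (coordinate y j)); lia.
  by apply: leq_sum => i ij; rewrite x'E (negbTE ij).
by apply: boxP => i; move: (zb i) (btw i); clear; lia.
Qed.

Lemma in_windowP lo x : reflect (forall i, coordinate lo i <= coordinate x i < coordinate lo i + D) (in_window lo x).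
Proof. exact: forallP. Qed.

Definition full_slice (lo : cell) (i : 'I_d) (t : nat) :=
  (coordinate lo i <= t < coordinate lo i + D) &&
  [forall x, in_window lo x && (coordinate x i == t) ==> (x \in full)].

Lemma full_slab lo i t : valid_window lo -> coordinate lo i <= t ->
  t + slab_room <= coordinate lo i + D ->
  exists u, [/\ t <= u, u + R <= t + slab_room &
    forall v, u <= v < u + R -> full_slice lo i v].
Proof.
move=> vlo lot tD; rewrite /slab_room in tD *.
case: (boolP [exists g : 'I_T0.+1, [forall x, in_window lo x &&
    (t + g * R <= coordinate x i < t + g * R + R) ==> (x \in full)]]).
  case/existsP => g /forallP gP; exists (t + g * R).
  have gT := ltn_ord g.
  have gR : g * R + R <= T0.+1 * R by rewrite -mulSnr leq_mul2r gT orbT.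
  split; [lia|lia|move=> v vb].
  apply/andP; split; first by lia.
  apply/forallP => x; apply/implyP => /andP[xw /eqP xv].
  by have /implyP := gP x; apply; rewrite xw xv.
move=> /existsPn none.
have pickx (g : 'I_T0.+1) : {x : cell | in_window lo x &&
    (t + g * R <= coordinate x i < t + g * R + R) && (x \notin full)}.
  apply: sigW; have := none g => /forallPn[x]; rewrite negb_imply => xP.
  by exists x.
exfalso.
have : T0.+1 <= #|[pred x | in_window lo x && (x \notin full)]|.
  rewrite -[X in X <= _](card_ord T0.+1).
  apply: (@leq_card_inj _ _ (fun g => sval (pickx g))) => [g g' _ _ /= gg'|g _].
    have /andP[/andP[_ b1] _] := svalP (pickx g).
    have /andP[/andP[_ b2] _] := svalP (pickx g').
    move: b1 b2; rewrite gg'; move: (coordinate _ i) => c b1 b2.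
    apply/val_inj => /=; move: (nat_of_ord g) (nat_of_ord g') b1 b2 => a b; clear => b1 b2.
    by nia.
  by have /andP[/andP[w _] nf] := svalP (pickx g); rewrite inE w nf.
rewrite ltnNge => /negP; apply; apply: leq_trans (few_nonfull vlo) _.
exact: outer_T0.
Qed.

Local Notation wadj lo := (cells_adjacent [predI full & in_window lo]).

Lemma slice_connect lo i t x y : full_slice lo i t -> in_window lo x -> in_window lo y ->
  coordinate x i = t -> coordinate y i = t -> connect (wadj lo) x y.
Proof.
move=> /andP[_ /forallP sl] /in_windowP xw /in_windowP yw xt yt.
apply: box_connect => z zb.
have zw : in_window lo z.
  by apply/in_windowP => j; move: (xw j) (yw j) (zb j); clear; lia.
apply/andP; split; last exact: zw.
have /implyP := sl z; apply; rewrite zw /=.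
by apply/eqP; have := zb i; rewrite xt yt; clear; lia.
Qed.

Lemma other_axis (i : 'I_d) : exists j, j != i.
Proof.
have : 0 < #|predC1 i| by rewrite cardC1 card_ord; lia.
by case/card_gt0P => j; rewrite inE => ?; exists j.
Qed.

Lemma exists_slice lo i t : valid_window lo -> coordinate lo i <= t ->
  t + slab_room <= coordinate lo i + D -> exists2 v, t <= v < t + slab_room & full_slice lo i v.
Proof.
move=> vlo lot tD; have [u [tu ur sl]] := full_slab vlo lot tD.
by exists u; [lia | apply: sl; lia].
Qed.

Lemma roomy_window (lo : cell) (i : 'I_d) : coordinate lo i + 1 + slab_room <= coordinate lo i + D.
Proof. by rewrite /window_side; lia. Qed.

Lemma in_window_D (lo : cell) i : coordinate lo i < coordinate lo i + D.
Proof. by rewrite /window_side; lia. Qed.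

Lemma window_bound (lo : cell) i : valid_window lo -> coordinate lo i + D <= K.+1.
Proof. by move/forallP. Qed.

Lemma crossing_point lo i j s t : valid_window lo -> i != j ->
  full_slice lo i s -> coordinate lo j <= t < coordinate lo j + D ->
  exists z, [/\ in_window lo z, coordinate z i = s, coordinate z j = t
    & forall k, k != i -> k != j -> coordinate z k = coordinate lo k].
Proof.
move=> vlo ij /andP[sb _] tb.
pose z : cell := lattice_point K (fun k => if k == i then s else if k == j then t else coordinate lo k).
have zE k : coordinate z k = if k == i then s else if k == j then t else coordinate lo k.
  apply: coordinate_lattice_point; have := window_bound k vlo; have := window_bound i vlo.
  have := window_bound j vlo; have := coordinate_lt lo k; move: sb tb; clear.
  by case: (k == i); case: (k == j); lia.
exists z; split.
- apply/in_windowP => k; rewrite zE; have := in_window_D lo k.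
  case: eqP => [->|_ ?]; first by lia.
  by case: eqP => [->|_]; lia.
- by rewrite zE eqxx.
- by rewrite zE eq_sym (negbTE ij) eqxx.
- by move=> k /negbTE ki /negbTE kj; rewrite zE ki kj.
Qed.

(** Perpendicular full slices meet. Parallel ones are joined through a full slice perpendicular to
    both, along a second axis. *)
Lemma slices_connect lo i j s t x y : valid_window lo ->
  full_slice lo i s -> full_slice lo j t -> in_window lo x -> in_window lo y ->
  coordinate x i = s -> coordinate y j = t -> connect (wadj lo) x y.
Proof.
move=> vlo.
have main i' j' s' t' x' y' : i' != j' -> full_slice lo i' s' -> full_slice lo j' t' ->
    in_window lo x' -> in_window lo y' ->
    coordinate x' i' = s' -> coordinate y' j' = t' -> connect (wadj lo) x' y'.
  move=> ij si sj xw yw xs yt.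
  have [z [zw zi zj _]] := crossing_point vlo ij si (proj1 (andP sj)).
  by apply: connect_trans (slice_connect si xw zw xs zi) (slice_connect sj zw yw zj yt).
case: (eqVneq i j) => [<-|ij]; last exact: main.
move=> si sj xw yw xs yt.
have [k ki] := other_axis i; have ik : i != k by rewrite eq_sym.
have [v _ sk] : exists2 v, coordinate lo k <= v < coordinate lo k + slab_room & full_slice lo k v.
  by apply: (exists_slice vlo (leqnn _)); rewrite /window_side; clear; lia.
have [z [zw zi zk _]] := crossing_point vlo ik si (proj1 (andP sk)).
exact: connect_trans (main _ _ _ _ _ _ ik si sk xw zw xs zk) (main _ _ _ _ _ _ ki sk sj zw yw zk yt).
Qed.

Definition skeleton (x : cell) := [exists lo, [&& valid_window lo, in_window lo x &
  [exists i, full_slice lo i (coordinate x i)]]].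

Local Notation hadj := (cells_adjacent full).

Lemma wadj_hadj lo x y : connect (wadj lo) x y -> connect hadj x y.
Proof.
apply: connect_mono => a b; rewrite /cells_adjacent /= !inE.
by case/and3P => /andP[-> _] /andP[-> _] ->.
Qed.

(** The window moves by one unit at a time, along an axis [k]. A full slice of the new window normal
    to [k] and a full slice of the old one normal to another axis meet in a cell common to both
    windows. *)
Lemma windows_connect lo lo' i j x y : valid_window lo -> valid_window lo' ->
  in_window lo x -> in_window lo' y -> full_slice lo i (coordinate x i) ->
  full_slice lo' j (coordinate y j) -> connect hadj x y.
Proof.
move: {2}(\sum_i absdiff (coordinate lo i) (coordinate lo' i))
  (leqnn (\sum_i absdiff (coordinate lo i) (coordinate lo' i))) => n.
elim: n lo i x => [|n IH] lo i x.
  rewrite leqn0 sum_nat_eq0 => /forallP ll vlo vlo' xw yw sx sy.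
  have ll' : lo = lo' by apply: coordinate_inj => k; have := ll k; rewrite /absdiff /=; lia.
  by rewrite ll' in sx xw; apply: wadj_hadj; apply: (slices_connect vlo' sx sy).
move=> sn vlo vlo' xw yw sx sy.
case: (eqVneq lo lo') => [ll'|ll'].
  by rewrite ll' in sx xw; apply: wadj_hadj; apply: (slices_connect vlo' sx sy).
have [k llk] : exists k, coordinate lo k != coordinate lo' k.
  apply/existsP; apply: contraNT ll' => /existsPn xy.
  by apply/eqP; apply: coordinate_inj => l; apply/eqP; rewrite -[_ == _]negbK.
pose lo2 : cell := lattice_point K (fun i => if i == k then
  (if coordinate lo k < coordinate lo' k then coordinate lo k + 1 else coordinate lo k - 1) else coordinate lo i).
have lo2E l : coordinate lo2 l = if l == k then
  (if coordinate lo k < coordinate lo' k then coordinate lo k + 1 else coordinate lo k - 1) else coordinate lo l.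
  apply: coordinate_lattice_point; have := coordinate_lt lo l; have := coordinate_lt lo k; have := coordinate_lt lo' k.
  by clear; case: (l == k); case: (ltnP (coordinate lo k) (coordinate lo' k)); lia.
have vlo2 : valid_window lo2.
  apply/forallP => l; rewrite lo2E; have := window_bound l vlo; have := window_bound k vlo'.
  have := window_bound k vlo.
  by case: eqP => [->|_]; case: (ltnP (coordinate lo k) (coordinate lo' k)); clear; lia.
have [t2 t2b s2] : exists2 t2, (coordinate lo k <= t2 < coordinate lo k + D) & full_slice lo2 k t2.
  (* The search starts one unit inside [lo2], so that after a downward move the slice still lies in
     the old window. *)
  have [||v vb sv] := @exists_slice lo2 k (coordinate lo2 k + 1) vlo2; [lia|exact: roomy_window|].
  exists v => //; move: vb; rewrite lo2E eqxx /window_side.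
  by case: (ltnP (coordinate lo k) (coordinate lo' k)); clear; lia.
have [l lk] := other_axis k.
have [v vb sl] : exists2 v, coordinate lo l <= v < coordinate lo l + slab_room & full_slice lo l v.
  by apply: (exists_slice vlo (leqnn _)); rewrite /window_side; clear; lia.
have [z [zw zl zk zo]] := crossing_point vlo lk sl t2b.
have zw2 : in_window lo2 z.
  apply/in_windowP => m; case: (eqVneq m k) => [->|mk].
    by rewrite zk; have /andP[] := s2.
  by rewrite lo2E (negbTE mk); exact: (in_windowP _ _ zw).
apply: (@connect_trans _ _ z).
  by apply: wadj_hadj; apply: (slices_connect vlo sx sl).
apply: (IH lo2 k) => //; last by rewrite zk.
rewrite -ltnS; apply: leq_trans sn.
rewrite (bigD1 k) //= [X in _ <= X](bigD1 k) //= -addSn; apply: leq_add.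
  by rewrite lo2E eqxx /absdiff; move: llk; clear; case: (ltnP (coordinate lo k) (coordinate lo' k)); lia.
by apply: leq_sum => m mk; rewrite lo2E (negbTE mk).
Qed.

Lemma skeleton_connect x y : skeleton x -> skeleton y -> connect hadj x y.
Proof.
case/existsP => lo /and3P[vlo xw /existsP[i sx]].
case/existsP => lo' /and3P[vlo' yw /existsP[j sy]].
exact: windows_connect vlo vlo' xw yw sx sy.
Qed.

(** The skeleton, whose connectivity is a local matter, selects one component of the full cells;
    full cells outside that component may exist. *)
Definition sea : pred cell := [pred x | (x \in full) && [exists y, skeleton y && connect hadj x y]].

(** Cut-off cells may be full, sparse or empty; a full cell that is not cut off belongs to the
    sea. *)
Definition cutoff : pred cell := [pred x | [forall y, (y \in sea) ==> ~~ I (cell_dist x y)]].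

Lemma skeleton_sea x : skeleton x -> x \in sea.
Proof.
move=> sx; rewrite inE; apply/andP; split; last by apply/existsP; exists x; rewrite sx connect0.
case/existsP: sx => lo /and3P[vlo xw /existsP[i /andP[_ /forallP/(_ x)]]].
by rewrite xw eqxx.
Qed.

Lemma sea_adjacent x y : x \in full -> y \in sea -> I (cell_dist x y) -> x \in sea.
Proof.
move=> xf; rewrite !inE => /andP[yf /existsP[z /andP[sz cz]]] Ixy; rewrite xf.
apply/existsP; exists z; rewrite sz; apply: connect_trans cz; apply: connect1.
by rewrite /cells_adjacent /= xf yf.
Qed.

Lemma sea_connect x y : x \in sea -> y \in sea -> connect hadj x y.
Proof.
rewrite !inE => /andP[xf /existsP[z /andP[sz cz]]] /andP[yf /existsP[w /andP[sw cw]]].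
apply: connect_trans cz _; apply: connect_trans (skeleton_connect sz sw) _.
by rewrite connect_cells_sym.
Qed.

Lemma cutoffPn x : x \notin cutoff -> exists2 y, y \in sea & I (cell_dist x y).
Proof. by case/forallPn => y; rewrite negb_imply negbK => /andP[? ?]; exists y. Qed.

Lemma full_not_cutoff x : x \in full -> x \notin cutoff -> x \in sea.
Proof. by move=> xf /cutoffPn[y ys Ixy]; exact: sea_adjacent ys Ixy. Qed.

Lemma cutoff_not_sea x : x \in cutoff -> x \notin sea.
Proof.
move=> /forallP/(_ x) xc; apply/negP => xs; move: xc; rewrite xs /= => /negP; apply.
by apply: I_cube => i; rewrite /cell_dist /absdiff subnn.
Qed.

(* A region [alpha, beta) around [q], separated from the rest of the window by
   full slabs of thickness [R] wherever the window does not touch the facet. *)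
Record enclosure (q lo : cell) (alpha beta : 'I_d -> nat) : Prop := Enclosure {
  enc_valid : valid_window lo;
  enc_window : forall i, coordinate lo i <= alpha i /\ beta i <= coordinate lo i + D;
  enc_near : forall (x : cell) i, absdiff (coordinate x i) (coordinate q i) <= D0 -> alpha i <= coordinate x i < beta i;
  enc_low : forall i, coordinate lo i != 0 -> coordinate lo i + R <= alpha i /\
    forall v, alpha i - R <= v < alpha i -> full_slice lo i v;
  enc_low0 : forall i, coordinate lo i = 0 -> alpha i = 0;
  enc_high : forall i, coordinate lo i + D != K.+1 -> beta i + R <= coordinate lo i + D /\
    forall v, beta i <= v < beta i + R -> full_slice lo i v;
  enc_high0 : forall i, coordinate lo i + D = K.+1 -> beta i = K.+1;
  enc_dist : forall x i, in_window lo x -> absdiff (coordinate x i) (coordinate q i) <= D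
}.

(** The window is centred at [q] and pushed back into the grid. On each side away from the facet,
    [full_slab] supplies the separating slab beyond distance [D0] from [q]. *)
Lemma exists_enclosure q : exists lo alpha beta, enclosure q lo alpha beta.
Proof.
pose lo : cell := lattice_point K (fun i => minn (coordinate q i - D./2) (K.+1 - D)).
have loE i : coordinate lo i = minn (coordinate q i - D./2) (K.+1 - D).
  by apply: coordinate_lattice_point; have := coordinate_lt q i; lia.
have D2 : D./2 = D0 + slab_room + 1 by rewrite /window_side doubleK.
have DD : D = (D0 + slab_room + 1) + (D0 + slab_room + 1) by rewrite /window_side addnn.
have vlo : valid_window lo by apply/forallP => i; rewrite loE; move: DK; clear; lia.
have low i : exists a, [/\ coordinate lo i != 0 -> coordinate lo i + R <= a /\
    (forall v, a - R <= v < a -> full_slice lo i v),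
    (coordinate lo i = 0 -> a = 0), coordinate lo i <= a & a + D0 <= coordinate q i \/ a = 0].
  case: (eqVneq (coordinate lo i) 0) => [->|n0]; first by exists 0; split => //; right.
  have b1 : coordinate lo i <= coordinate q i - D0 - slab_room.
    by rewrite loE D2; clear; lia.
  have b2 : D0 + slab_room <= coordinate q i by move: n0; rewrite loE D2; clear; lia.
  have b3 : coordinate q i < K.+1 := coordinate_lt q i.
  have b4 : coordinate q i - D0 - slab_room + slab_room <= coordinate lo i + D.
    by rewrite loE D2 DD; move: b3 b2 DK; rewrite DD; clear; lia.
  have [u [tu uR sl]] := full_slab vlo b1 b4.
  exists (u + R); split.
  - by move=> _; split=> [|v vb]; [move: tu b1; clear; lia|apply: sl; rewrite addnK in vb].
  - by move=> l0; rewrite l0 eqxx in n0.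
  - by move: tu b1; clear; lia.
  - by left; move: uR b2; clear; lia.
have high i : exists b, [/\ coordinate lo i + D != K.+1 -> b + R <= coordinate lo i + D /\
    (forall v, b <= v < b + R -> full_slice lo i v),
    (coordinate lo i + D = K.+1 -> b = K.+1), b <= coordinate lo i + D & coordinate q i + D0 < b \/ b = K.+1].
  case: (eqVneq (coordinate lo i + D) K.+1) => [->|n0]; first by exists K.+1; split => //; right.
  have b1 : coordinate lo i <= coordinate q i + D0 + 1.
    by rewrite loE D2; clear; lia.
  have b3 : coordinate q i < K.+1 := coordinate_lt q i.
  have b4 : coordinate q i + D0 + 1 + slab_room <= coordinate lo i + D.
    by move: n0; rewrite loE D2; move: b3 DK; rewrite DD; clear; lia.
  have [u [tu uR sl]] := full_slab vlo b1 b4.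
  exists u; split.
  - by move=> _; split=> [|v vb]; [move: uR b4; clear; lia|apply: sl].
  - by move=> l0; rewrite l0 eqxx in n0.
  - by move: uR b4; clear; lia.
  - by left; move: tu; clear; lia.
have [alpha aP] := fin_all_exists low.
have [beta bP] := fin_all_exists high.
exists lo, alpha, beta; split=> //.
- by move=> i; split; [have [_ _ ? _] := aP i|have [_ _ ? _] := bP i].
- move=> x i; rewrite /absdiff; have [_ _ _ ha] := aP i; have [_ _ _ hb] := bP i.
  by have := coordinate_lt x i; move: ha hb; clear; lia.
- by move=> i; have [? _ _ _] := aP i.
- by move=> i; have [_ ? _ _] := aP i.
- by move=> i; have [? _ _ _] := bP i.
- by move=> i; have [_ ? _ _] := bP i.
- move=> x i /in_windowP/(_ i); rewrite loE D2 /absdiff; have := coordinate_lt q i; have := coordinate_lt x i.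
  by rewrite DD; move: DK; rewrite DD; clear; lia.
Qed.

(** * Cut-off cells and routes inside an enclosure *)

Section Enclosure.
Variables (q lo : cell) (alpha beta : 'I_d -> nat).
Hypothesis E : enclosure q lo alpha beta.

Definition region : pred cell := [pred x | [forall i, alpha i <= coordinate x i < beta i]].

Lemma regionP x : reflect (forall i, alpha i <= coordinate x i < beta i) (x \in region).
Proof. exact: forallP. Qed.

Lemma region_window x : x \in region -> in_window lo x.
Proof.
move=> /regionP xr; apply/in_windowP => i.
by have := xr i; have := enc_window E i; clear; lia.
Qed.

(** An inner step has length at most [R] along each axis, so it cannot jump over a separating
    slab. *)
Lemma region_exit u w : u \in region -> w \notin region -> I (cell_dist u w) ->
  in_window lo w /\ exists i, full_slice lo i (coordinate w i).
Proof.
move=> /regionP ur wr Iuw.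
have dist i : absdiff (coordinate u i) (coordinate w i) <= R := I_bound i Iuw.
split.
  apply/in_windowP => i; have := dist i; have := ur i; have := enc_window E i.
  have := coordinate_lt w i; rewrite /absdiff.
  have lowb : coordinate lo i = 0 \/ coordinate lo i + R <= alpha i.
    by case: (eqVneq (coordinate lo i) 0) => [|/(enc_low E)[]]; [left|right].
  have highb : coordinate lo i + D = K.+1 \/ beta i + R <= coordinate lo i + D.
    by case: (eqVneq (coordinate lo i + D) K.+1) => [|/(enc_high E)[]]; [left|right].
  by move: lowb highb; clear; lia.
have /forallPn[i] : ~~ [forall i, alpha i <= coordinate w i < beta i] := wr.
rewrite negb_and => /orP[wi|wi]; exists i.
  have l0 : coordinate lo i != 0.
    by apply/eqP => /(enc_low0 E) a0; rewrite a0 in wi.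
  have [_ sl] := enc_low E l0; apply: sl.
  by have := dist i; have := ur i; move: wi; rewrite /absdiff; clear; lia.
have l0 : coordinate lo i + D != K.+1.
  by apply/eqP => /(enc_high0 E) a0; rewrite a0 coordinate_lt in wi.
have [_ sl] := enc_high E l0; apply: sl.
by have := dist i; have := ur i; move: wi; rewrite /absdiff; clear; lia.
Qed.

(** Along any axis the window misses one of the facets, and there a separating slab lies outside the
    region. *)
Lemma exists_outer_slice : exists p i, [/\ in_window lo p, p \notin region &
  full_slice lo i (coordinate p i)].
Proof.
pose i0 : 'I_d := Ordinal (ltnW d_ge2).
have vlo := enc_valid E.
have [t [/andP[tb /forallP sl] tr]] : exists t, full_slice lo i0 t /\ ~~ (alpha i0 <= t < beta i0).
  case: (eqVneq (coordinate lo i0) 0) => [l0|l0].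
    have l1 : coordinate lo i0 + D != K.+1 by rewrite l0 add0n ltn_eqF.
    have [_ sl] := enc_high E l1; exists (beta i0); split; last by rewrite ltnn andbF.
    by apply: sl; move: H_gt0 HR; clear; lia.
  have [ar sl] := enc_low E l0; exists (alpha i0 - 1).
  by split; [apply: sl|]; move: H_gt0 HR ar; clear; lia.
pose p : cell := lattice_point K (fun k => if k == i0 then t else coordinate lo k).
have pE k : coordinate p k = if k == i0 then t else coordinate lo k.
  apply: coordinate_lattice_point; have := window_bound i0 vlo; have := coordinate_lt lo k.
  by move: tb; clear; case: (k == i0); lia.
have pw : in_window lo p.
  apply/in_windowP => k; rewrite pE; have := in_window_D lo k.
  by case: (eqVneq k i0) => [->|_]; move: tb; clear; lia.
have pt : coordinate p i0 = t by rewrite pE eqxx.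
exists p, i0; split=> //.
  by apply/regionP => /(_ i0); rewrite pt (negbTE tr).
by rewrite pt; apply/andP; split=> //; apply/forallP.
Qed.

(** Each of the two cells follows a path of full cells towards a slice outside the region. At its
    first exit the path stands in a full slice of the window, and the full slices of a window are
    connected inside it. *)
Lemma region_route S1 S2 : S1 \in sea -> S2 \in sea -> S1 \in region -> S2 \in region ->
  connect (wadj lo) S1 S2.
Proof.
have [p [i [pw pr sp]]] := exists_outer_slice.
have vlo := enc_valid E.
have ps : p \in sea.
  apply: skeleton_sea; apply/existsP; exists lo; rewrite vlo pw.
  by apply/existsP; exists i.
have toward S : S \in sea -> S \in region -> exists w j,
    [/\ connect (wadj lo) S w, in_window lo w & full_slice lo j (coordinate w j)].
  move=> Ss Sr; have [u [w [c ur wr uw]]] := first_exit (sea_connect Ss ps) Sr pr.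
  have /and3P[uf wf Iuw] := uw.
  have [ww [j sj]] := region_exit ur wr Iuw.
  exists w, j; split=> //.
  apply: (@connect_trans _ _ u).
    apply: connect_mono c => a b /and3P[ar br /and3P[af bf Iab]].
    apply/and3P; split=> //; apply/andP; split=> //; exact: region_window.
  apply: connect1; apply/and3P; split=> //; apply/andP; split=> //.
  exact: region_window.
move=> s1 s2 r1 r2.
have [w1 [j1 [c1 ww1 sl1]]] := toward S1 s1 r1.
have [w2 [j2 [c2 ww2 sl2]]] := toward S2 s2 r2.
apply: connect_trans c1 _; rewrite connect_cells_sym in c2.
exact: connect_trans (slices_connect vlo sl1 sl2 ww1 ww2 erefl erefl) c2.
Qed.

Definition enclosed_cutoff : pred cell := [predI cutoff & region].

(** A full cell next to a cut-off cell is not in the sea, hence is cut off too. Inside the region it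
    would belong to the set itself; outside, it would lie in a full slice and so in the sea. *)
Lemma enclosed_boundary : {subset inner_boundary I enclosed_cutoff <=
  [pred x | in_window lo x && (x \notin full)]}.
Proof.
move=> y; rewrite !inE => /andP[yA /exists_inP[a /andP[ac ar] Iay]].
have acut : a \in cutoff := ac.
have areg : a \in region := ar.
have ys : y \notin sea.
  by move/forallP: ac => /(_ y); apply: contraL => ys; rewrite negb_imply negbK ys.
have ycut : y \in full -> y \in cutoff.
  by move=> yf; apply: contraNT ys => yc; exact: full_not_cutoff.
have yreg : y \in full -> y \notin region.
  by move=> /ycut yc; apply: contraNN yA => yr; apply/andP.
case: (boolP (y \in region)) => [yr|yr].
  rewrite region_window //=; apply/negP => yf; have := yreg yf.
  by rewrite yr.
have [yw [i sl]] := region_exit areg yr Iay.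
rewrite yw /=; apply/negP => yf; move/negP: ys; apply.
apply: skeleton_sea; apply/existsP; exists lo; rewrite (enc_valid E) yw.
by apply/existsP; exists i.
Qed.

(** Otherwise [isoperimetry] and [outer_le_inner] yield more nonfull cells than the window may have;
    [h_large] weighs their surface terms against [h ^ d]. The type of the window fits, as the region
    keeps away by [R] from each facet that the window does not touch. *)
Lemma enclosed_extent a b j : a \in enclosed_cutoff -> b \in enclosed_cutoff ->
  coordinate b j <= coordinate a j + H.
Proof.
move=> aA bA; rewrite leqNgt; apply/negP => ext.
pose tau := window_type lo.
have vlo := enc_valid E.
have iso : #|cell_shape R I tau| + h ^ d <= #|inner_boundary I enclosed_cutoff| + R.*2.+1 ^ d.-1.
  apply: (isoperimetry I_anti d_ge2 I_bound I_cube hH HR _ _ aA bA ext).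
  - move=> c i /andP[_ /regionP/(_ i)]; rewrite /tau ffunE.
    case: (eqVneq (coordinate lo i) 0) => [//|l0] cr _; have [al _] := enc_low E l0.
    by move: cr al; clear; lia.
  - move=> c i /andP[_ /regionP/(_ i)]; rewrite /tau ffunE.
    have bnd : coordinate lo i + D != K.+1 -> coordinate c i < beta i -> coordinate c i + R <= K.
      move=> nK; have [+ _] := enc_high E nK; have := window_bound i vlo; move: nK; clear; lia.
    case: (eqVneq (coordinate lo i) 0) => [l0 /andP[_ cb] _|l0].
      by apply: bnd cb; rewrite l0 add0n ltn_eqF.
    by case: (eqVneq (coordinate lo i + D) K.+1) => [//|nK] /andP[_ cb] _; exact: bnd.
have nb : #|inner_boundary I enclosed_cutoff| <= #|cell_shape R O tau| + 1.
  apply: leq_trans (few_nonfull vlo).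
  by apply: subset_leq_card; apply/subsetP; exact: enclosed_boundary.
have := outer_le_inner R I_anti O_I tau.
have : (5 * d + 1) * R.*2.+1 ^ d.-1 = d * (5 * R.*2.+1 ^ d.-1) + R.*2.+1 ^ d.-1.
  by rewrite mulnDl mul1n mulnA (mulnC d).
move: iso nb h_large; move: (#|cell_shape R I tau|) (#|cell_shape R O tau|) (h ^ d) => x y z.
move: ((5 * d + 1) * _) => w; move: (d * (5 * _)) => v.
by move: (#|inner_boundary _ _|) (_ ^ _) => u t; clear; lia.
Qed.

End Enclosure.

Definition near_cell (m : nat) (q : cell) : pred cell :=
  [pred x | [forall i, absdiff (coordinate x i) (coordinate q i) <= m]].

Lemma near_region m q lo alpha beta x : enclosure q lo alpha beta -> m <= D0 ->
  x \in near_cell m q -> x \in region alpha beta.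
Proof.
move=> E mD /forallP xn; apply/regionP => i; apply: (enc_near E).
exact: leq_trans (xn i) mD.
Qed.

(** The gap between the scales [H] and [D0] will make proximity of cut-off cells an equivalence
    relation, whose classes give the clusters. *)
Lemma cutoff_extent q x j : q \in cutoff -> x \in cutoff -> x \in near_cell D0 q ->
  absdiff (coordinate x j) (coordinate q j) <= H.
Proof.
move=> qc xc xn; have [lo [alpha [beta E]]] := exists_enclosure q.
have xr := near_region E (leqnn _) xn.
have qr : q \in region alpha beta.
  by apply: (near_region E (leqnn _)); apply/forallP => i; rewrite /absdiff subnn.
have qA : q \in enclosed_cutoff alpha beta by apply/andP.
have xA : x \in enclosed_cutoff alpha beta by apply/andP.
have := enclosed_extent E j qA xA; have := enclosed_extent E j xA qA.
by rewrite /absdiff; clear; lia.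
Qed.

Lemma sea_route q S1 S2 : S1 \in sea -> S2 \in sea ->
  S1 \in near_cell D0 q -> S2 \in near_cell D0 q ->
  connect (cells_adjacent [predI full & near_cell D q]) S1 S2.
Proof.
move=> s1 s2 n1 n2; have [lo [alpha [beta E]]] := exists_enclosure q.
have := region_route E s1 s2 (near_region E (leqnn _) n1) (near_region E (leqnn _) n2).
apply: connect_mono => a b /and3P[/andP[af aw] /andP[bf bw] Iab].
by apply/and3P; split=> //; apply/andP; split=> //; apply/forallP => i; apply: (enc_dist E).
Qed.

(** Of [T0 + 1] cells on a line from [q], at distances just above [H], one is full; by
    [cutoff_extent] it is too far from [q] to be cut off. *)
Lemma sea_near_cutoff q : q \in cutoff -> exists2 S, S \in sea & S \in near_cell (H + T0 + 1) q.
Proof.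
move=> qc; have [lo [alpha [beta E]]] := exists_enclosure q.
pose i0 : 'I_d := Ordinal (ltnW d_ge2).
have DD : (H + T0 + 1) + (H + T0 + 1) <= K.
  by apply: leq_trans DK; rewrite /window_side; move: D0_large; clear; lia.
pose up := coordinate q i0 + (H + T0 + 1) <= K.
pose z (t : 'I_T0.+1) : cell := lattice_point K (fun k => if k == i0 then
  (if up then coordinate q i0 + (H + 1 + t) else coordinate q i0 - (H + 1 + t)) else coordinate q k).
have zE t k : coordinate (z t) k = if k == i0 then
  (if up then coordinate q i0 + (H + 1 + t) else coordinate q i0 - (H + 1 + t)) else coordinate q k.
  apply: coordinate_lattice_point; have := coordinate_lt q i0; have := coordinate_lt q k; have := ltn_ord t.
  by rewrite /up; clear; case: (k == i0); case: (leqP (coordinate q i0 + (H + T0 + 1)) K); lia.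
have zdist t : absdiff (coordinate (z t) i0) (coordinate q i0) = H + 1 + t.
  rewrite zE eqxx /absdiff; have := ltn_ord t; have := coordinate_lt q i0; move: DD.
  by rewrite /up; clear; case: (leqP (coordinate q i0 + (H + T0 + 1)) K); lia.
have znear t : z t \in near_cell (H + T0 + 1) q.
  apply/forallP => k; case: (eqVneq k i0) => [->|ki].
    by rewrite zdist; have := ltn_ord t; clear; lia.
  by rewrite zE (negbTE ki) /absdiff subnn.
have D0' : H + T0 + 1 <= D0 by [].
have zw t : in_window lo (z t) := region_window E (near_region E D0' (znear t)).
have [/existsP[t zf]|/existsPn none] := boolP [exists t, z t \in full].
  exists (z t) => //; apply: full_not_cutoff => //; apply/negP => zc.
  have zn : z t \in near_cell D0 q.
    by apply/forallP => k; have /forallP/(_ k)/leq_trans := znear t; apply.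
  by have := cutoff_extent i0 qc zc zn; rewrite zdist; clear; lia.
exfalso; have vlo := enc_valid E.
have : T0.+1 <= #|[pred x | in_window lo x && (x \notin full)]|.
  rewrite -[X in X <= _](card_ord T0.+1).
  apply: (@leq_card_inj _ _ z) => [t t' _ _ tt'|t _]; last by rewrite inE zw none.
  by apply: val_inj; have := zdist t; rewrite tt' zdist /=; clear; lia.
rewrite ltnNge => /negP; apply; apply: leq_trans (few_nonfull vlo) _.
exact: outer_T0.
Qed.

End Sea.

(** * Hamilton cycles through the sea *)

Lemma clique_path (V : eqType) (e : rel V) x s : uniq (x :: s) ->
  {in x :: s &, forall a b, a != b -> e a b} -> path e x s.
Proof.
elim: s x => //= y s IH x /andP[]; rewrite inE negb_or => /andP[xy xs] us ce.
rewrite ce ?inE ?eqxx ?orbT //= IH // => a b ain bin; apply: ce.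
  by rewrite inE ain orbT.
by rewrite inE bin orbT.
Qed.

Lemma enum_between (V : finType) (U : {pred V}) u v : u \in U -> v \in U ->
  ((u == v) ==> [forall x in U, x == u]) ->
  exists t, [/\ uniq (u :: t), u :: t =i U & last u t = v].
Proof.
move=> uU vU uv; case: (eqVneq u v) uv => [<- /= /forall_inP only|ne _].
  exists [::]; split=> // x; rewrite inE; apply/eqP/idP => [->//|/only/eqP//].
exists (rcons [seq x <- enum U | (x != u) && (x != v)] v); split.
- rewrite /= mem_rcons inE negb_or ne mem_filter eqxx /= rcons_uniq mem_filter eqxx andbF /=.
  by rewrite filter_uniq ?enum_uniq.
- move=> x; rewrite inE mem_rcons inE mem_filter mem_enum.
  case: (eqVneq x u) => [->|_]; first by rewrite uU.
  by case: (eqVneq x v) => [->|_].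
- by rewrite last_rcons.
Qed.

Lemma size_filter_enum (V : finType) (A : pred V) : size [seq x <- enum V | A x] = #|A|.
Proof.
have /card_uniqP <- : uniq [seq x <- enum V | A x] by rewrite filter_uniq ?enum_uniq.
by apply: eq_card => x; rewrite mem_filter mem_enum andbT.
Qed.

(** The rank is the distance to [r], which drops along a shortest path. *)
Lemma connected_rank (V : finType) (f : rel V) (A : {pred V}) (r : V) :
  (forall x, x \in A -> connect f x r) ->
  exists rk : V -> nat, forall x, x \in A -> x != r -> exists2 y, f x y & rk y < rk x.
Proof.
move=> conn.
pose reach x n := [exists p : n.-tuple V, path f x p && (last x p == r)].
have reachP x : connect f x r -> exists n, reach x n.
  case/connectP => p fp lp; exists (size p); apply/existsP; exists (in_tuple p).
  by rewrite fp -lp eqxx.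
have has_rank x : exists n, forall y : unit, connect f x r ->
    reach x n /\ forall m, reach x m -> n <= m.
  case: (boolP (connect f x r)) => [/reachP ex|_]; last by exists 0.
  by case: (ex_minnP ex) => n nP nmin; exists n => _ _.
have [rk rkP] := fin_all_exists has_rank.
exists rk => x /conn xr nxr.
have [/existsP[p /andP[fp /eqP lp]] _] := rkP x tt xr.
case: p fp lp => -[|y s] sz /=; first by move=> _ xE; rewrite xE eqxx in nxr.
move=> /andP[fxy fs] ls.
exists y => //.
have yr : connect f y r by apply/connectP; exists s.
have [_ ymin] := rkP y tt yr.
rewrite -(eqP sz) ltnS; apply: ymin; apply/existsP; exists (in_tuple s).
by rewrite fs ls eqxx.
Qed.

Lemma card_near_cell d K m (q : {ffun 'I_d -> 'I_K.+1}) : #|near_cell m q| <= m.*2.+1 ^ d.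
Proof.
have -> : m.*2.+1 ^ d = #|{: {ffun 'I_d -> 'I_m.*2.+1}}| by rewrite card_ffun !card_ord.
pose f (x : {ffun 'I_d -> 'I_K.+1}) : {ffun 'I_d -> 'I_m.*2.+1} :=
  lattice_point m.*2 (fun i => coordinate x i + m - coordinate q i).
have fE x i : x \in near_cell m q -> coordinate (f x) i = coordinate x i + m - coordinate q i.
  move=> /forallP/(_ i) xn; apply: coordinate_lattice_point; move: xn; rewrite /absdiff.
  by clear; lia.
apply: (@leq_card_inj _ _ f) => // x y xn yn fxy; apply: coordinate_inj => i.
have := congr1 (fun g => coordinate g i) fxy; rewrite !fE //.
move/forallP: xn => /(_ i); move/forallP: yn => /(_ i); rewrite /absdiff; clear; lia.
Qed.

Lemma near_cellC d K m (q x : {ffun 'I_d -> 'I_K.+1}) : (x \in near_cell m q) = (q \in near_cell m x).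
Proof. by apply: eq_forallb => i; rewrite absdiffC. Qed.

Lemma near_cell_trans d K m n (x y z : {ffun 'I_d -> 'I_K.+1}) :
  y \in near_cell m x -> z \in near_cell n y -> z \in near_cell (m + n) x.
Proof.
move=> /forallP yx /forallP zy; apply/forallP => i.
by move: (yx i) (zy i); rewrite /absdiff; clear; lia.
Qed.

Lemma near_cell_leq d K m n (q x : {ffun 'I_d -> 'I_K.+1}) : m <= n ->
  x \in near_cell m q -> x \in near_cell n q.
Proof. by move=> mn /forallP xq; apply/forallP => i; exact: leq_trans (xq i) mn. Qed.

Lemma near_cell_refl d K m (q : {ffun 'I_d -> 'I_K.+1}) : q \in near_cell m q.
Proof. by apply/forallP => i; rewrite /absdiff subnn. Qed.

(** * Loops through the clusters and the tree of cells *)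

Section Assembly.
Variables (d R K H T0 D0 D1 D M : nat) (I : ('I_d -> nat) -> bool).
Local Notation cell := {ffun 'I_d -> 'I_K.+1}.
Variables (full sea cutoff : {pred cell}).
Hypothesis I_anti : forall a b, (forall i, a i <= b i) -> I b -> I a.
Hypothesis I_bound : forall a i, I a -> a i <= R.
Hypothesis I_cube : forall a, (forall i, a i <= H) -> I a.
Hypothesis sea_full : {subset sea <= full}.
Hypothesis sea_conn : forall x y, x \in sea -> y \in sea -> connect (cells_adjacent I full) x y.
Hypothesis sea_adj : forall x y, x \in full -> y \in sea -> I (cell_dist x y) -> x \in sea.
Hypothesis cutoffPn' : forall x, x \notin cutoff -> exists2 y, y \in sea & I (cell_dist x y).
Hypothesis cutoff_sea : forall x, x \in cutoff -> x \notin sea.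
Hypothesis extent : forall q x j, q \in cutoff -> x \in cutoff -> x \in near_cell D0 q ->
  absdiff (coordinate x j) (coordinate q j) <= H.
Hypothesis route : forall q S1 S2, S1 \in sea -> S2 \in sea ->
  S1 \in near_cell D0 q -> S2 \in near_cell D0 q ->
  connect (cells_adjacent I [predI full & near_cell D q]) S1 S2.
Hypothesis sea_near : forall q, q \in cutoff -> exists2 S, S \in sea & S \in near_cell (H + T0 + 1) q.
Variable root : cell.
Hypothesis root_sea : root \in sea.
Hypothesis D1_large : H + T0 + 1 <= D1.
Hypothesis D0_large : (D1 + H).*2 + R <= D0.
Hypothesis D_large : D0 <= D.

Variables (V : finType) (e : rel V) (b : V -> cell).
Hypothesis e_sym : symmetric e.
Hypothesis inner_e : forall x y, x != y -> I (cell_dist (b x) (b y)) -> e x y.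
Hypothesis e_conn : forall S : {set V}, #|S| < 2 ->
  forall x y, x \notin S -> y \notin S ->
  connect [rel u v | [&& u \notin S, v \notin S & e u v]] x y.
Hypothesis short_or_long : (forall x y, e x y -> b y \in near_cell D1 (b x)) \/
  (forall x y, x != y -> b y \in near_cell (H.*2 + T0 + 1) (b x) -> e x y).
Hypothesis fullP : forall c, c \in full -> M <= #|[pred x | b x == c]|.
Hypothesis M_large : 4 * D.*2.+1 ^ d < M.

Let N := D.*2.+1 ^ d.

Lemma N_gt0 : 0 < N. Proof. by rewrite expn_gt0. Qed.

Lemma same_cell_adjacent x y : x != y -> b x = b y -> e x y.
Proof.
move=> xy bxy; apply: inner_e => //; apply: I_cube => i.
by rewrite bxy /cell_dist /absdiff subnn.
Qed.

Definition cluster (q : cell) : {pred V} := [pred x | (b x \in cutoff) && (b x \in near_cell D0 q)].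

Lemma clusterP q x : x \in cluster q -> b x \in cutoff /\ b x \in near_cell D0 q.
Proof. by move=> /andP[]. Qed.

Lemma cluster_extent q x : q \in cutoff -> x \in cluster q -> b x \in near_cell H q.
Proof. by move=> qc /andP[xc xq]; apply/forallP => i; exact: extent. Qed.

Lemma cutoff_near q x : q \in cutoff -> x \in cutoff -> x \in near_cell D0 q -> x \in near_cell H q.
Proof. by move=> qc xc xq; apply/forallP => i; exact: extent. Qed.

Lemma cluster_clique q x y : q \in cutoff -> x \in cluster q -> y \in cluster q -> x != y -> e x y.
Proof.
move=> qc xU yU xy; apply: inner_e => //; apply: I_cube => i; rewrite /cell_dist.
have [xc _] := clusterP xU; have [yc _] := clusterP yU.
apply: extent => //; rewrite near_cellC.
have h1 := cluster_extent qc xU; have h2 := cluster_extent qc yU.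
rewrite near_cellC in h1; apply: near_cell_leq (near_cell_trans h1 h2).
by move: D0_large; clear; lia.
Qed.

Lemma exists_two_in (A : {pred V}) : 1 < #|A| -> exists x y, [/\ x \in A, y \in A & x != y].
Proof. by case/card_gt1P => x [y [xA yA xy]]; exists x, y. Qed.

Lemma sea_points c : c \in sea -> exists x y, [/\ b x = c, b y = c & x != y].
Proof.
move=> cs; have [|x [y [/eqP bx /eqP y_ xy]]] := @exists_two_in [pred x | b x == c].
  by apply: leq_trans (fullP (sea_full cs)); move: M_large; have := N_gt0; rewrite /N; clear; lia.
by exists x, y.
Qed.

(** If edges are short, 2-connectivity gives the exits; their outer ends are near but outside the
    cluster, hence not cut off. Two points of the root cell ensure that the cluster is not
    everything. If the radius is large, two points of a nearby sea cell are joined to the whole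
    cluster. *)
Lemma cluster_exits q x0 : q \in cutoff -> x0 \in cluster q -> exists u t w1 w2,
  [/\ uniq (u :: t), u :: t =i cluster q, e w1 u /\ e (last u t) w2, w1 != w2 &
      [&& b w1 \notin cutoff, b w2 \notin cutoff, b w1 \in near_cell (D1 + H) q &
          b w2 \in near_cell (D1 + H) q]].
Proof.
move=> qc x0U.
suff [u1 [u2 [w1 [w2 [/andP[u1U u2U] e1 e2 w12 /andP[uu ww]]]]]] : exists u1 u2 w1 w2,
    [/\ (u1 \in cluster q) && (u2 \in cluster q), e u1 w1, e u2 w2, w1 != w2 &
    ((u1 == u2) ==> [forall u in cluster q, u == u1]) &&
     [&& b w1 \notin cutoff, b w2 \notin cutoff, b w1 \in near_cell (D1 + H) q &
          b w2 \in near_cell (D1 + H) q]].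
  have [t [ut tU lt]] := enum_between u1U u2U uu.
  by exists u1, t, w1, w2; split=> //; rewrite e_sym lt.
case: short_or_long => [short|long].
  have [x [y [bx by_ xy]]] := sea_points root_sea.
  have notU z : b z = root -> z \notin cluster q.
    by move=> bz; apply/negP => /clusterP[]; rewrite bz => /cutoff_sea; rewrite root_sea.
  have [u1 [u2 [w1 [w2 [/and4P[u1U u2U w1U w2U] e1 e2 w12 uu]]]]] :=
    two_disjoint_exits e_conn x0U (notU _ bx) (notU _ by_) xy.
  have wP u w : u \in cluster q -> w \notin cluster q -> e u w ->
      (b w \notin cutoff) && (b w \in near_cell (D1 + H) q).
    move=> uU wU /short ewu.
    have nw : b w \in near_cell (D1 + H) q.
      by rewrite addnC; apply: near_cell_trans ewu; exact: cluster_extent.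
    rewrite nw andbT; apply: contraNN wU => wc; apply/andP; split=> //.
    by apply: near_cell_leq nw; move: D0_large; clear; lia.
  exists u1, u2, w1, w2; split=> //; first by rewrite u1U u2U.
  have /andP[-> ->] := wP _ _ u1U w1U e1.
  by have /andP[-> ->] := wP _ _ u2U w2U e2; rewrite uu.
have [S Ss Sq] := sea_near qc.
have [w1 [w2 [bw1 bw2 w12]]] := sea_points Ss.
have Sc : S \notin cutoff by apply/negP => /cutoff_sea; rewrite Ss.
have S1 : S \in near_cell (D1 + H) q.
  by apply: near_cell_leq Sq; apply: leq_trans D1_large _; exact: leq_addr.
have edge u w : u \in cluster q -> b w = S -> e u w.
  move=> uU bw; apply: long.
    by apply: contraTneq uU => ->; apply/negP => /clusterP[]; rewrite bw (negbTE Sc).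
  rewrite bw; have h1 := cluster_extent qc uU; rewrite near_cellC in h1.
  by apply: near_cell_leq (near_cell_trans h1 Sq); rewrite -addnn; clear; lia.
have [u2 [u2U uu]] : exists u2, u2 \in cluster q /\
    ((x0 == u2) ==> [forall u in cluster q, u == x0]).
  case: (boolP [forall u in cluster q, u == x0]) => [only|/forall_inPn[u uU ux]].
    by exists x0; split=> //; apply/implyP.
  by exists u; rewrite eq_sym (negbTE ux).
exists x0, u2, w1, w2; split=> //; try exact: edge; first by rewrite x0U u2U.
by rewrite uu bw1 bw2 Sc S1.
Qed.

(* The vertices of a cluster are threaded on a path from [x_first] to [x_last],
   which is brought back to the sea cell [host] next to [x_first] by a route
   through the sea starting at [track_head]. *)
Record cluster_data := ClusterData {
  x_first : V; x_cluster : seq V; x_last : V;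
  host : cell; track_head : cell; track : seq cell }.

Record good_data (q : cell) (Z : cluster_data) : Prop := GoodData {
  gd_uniq : uniq (x_cluster Z);
  gd_mem : x_cluster Z =i cluster q;
  gd_links : exists u t, [/\ x_cluster Z = u :: t, e (x_first Z) u & e (last u t) (x_last Z)];
  gd_neq : x_first Z != x_last Z;
  gd_first_cut : b (x_first Z) \notin cutoff;
  gd_last_cut : b (x_last Z) \notin cutoff;
  gd_first_near : b (x_first Z) \in near_cell (D1 + H) q;
  gd_last_near : b (x_last Z) \in near_cell (D1 + H) q;
  gd_host_sea : host Z \in sea;
  gd_host_near : host Z \in near_cell D0 q;
  gd_host_adj : I (cell_dist (b (x_first Z)) (host Z));
  gd_track_adj : I (cell_dist (b (x_last Z)) (track_head Z));
  gd_track_path : path [rel x y | I (cell_dist x y)] (track_head Z) (track Z);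
  gd_track_last : last (track_head Z) (track Z) = host Z;
  gd_track_uniq : uniq (track_head Z :: track Z);
  gd_track_in : {in track_head Z :: track Z, forall x, (x \in full) && (x \in near_cell D q)}
}.

Lemma exists_cluster_data q x0 : q \in cutoff -> x0 \in cluster q -> exists Z, good_data q Z.
Proof.
move=> qc x0U.
have [u [t [w1 [w2 [ut tU [e1 e2] w12 /and4P[c1 c2 n1 n2]]]]]] := cluster_exits qc x0U.
have [S1 s1 a1] := cutoffPn' c1; have [S2 s2 a2] := cutoffPn' c2.
have near_S w S : b w \in near_cell (D1 + H) q -> I (cell_dist (b w) S) -> S \in near_cell D0 q.
  move=> nw aw; have wS : S \in near_cell R (b w).
    by apply/forallP => i; rewrite absdiffC; exact: I_bound i aw.
  by apply: near_cell_leq (near_cell_trans nw wS); move: D0_large; clear; lia.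
have nS1 := near_S _ _ n1 a1; have nS2 := near_S _ _ n2 a2.
have /connectP[p0 pp0 lp0] := route s2 s1 nS2 nS1.
case/shortenP: pp0 lp0 => p pp up _ lp.
exists (ClusterData w1 (u :: t) w2 S1 S2 p); split=> //=.
- by exists u, t.
- by apply: sub_path pp => x y /and3P[].
- have nearD S : S \in near_cell D0 q -> S \in near_cell D q by exact: near_cell_leq.
  move=> x; rewrite inE => /orP[/eqP->|]; first by rewrite sea_full //= nearD.
  elim: p S2 pp {up lp a2 nS2 s2} => //= y p IH S2 /andP[/and3P[_ /andP[yf yn] _] yp].
  by rewrite inE => /orP[/eqP->|]; [rewrite yf | exact: IH yp].
Qed.

(** The default is never taken for a cut-off [q], which satisfies the predicate itself. Nearby
    cut-off cells satisfy the same predicate and so pick the same representative. *)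
Definition rep (q : cell) : cell :=
  odflt q [pick x | (x \in cutoff) && (x \in near_cell D0 q)].

Lemma repP q : q \in cutoff -> rep q \in cutoff /\ rep q \in near_cell D0 q.
Proof.
by move=> qc; rewrite /rep; case: pickP => [x /andP[]//|_]; rewrite qc near_cell_refl.
Qed.

Lemma cutoff_near_eq q q' x : q \in cutoff -> q' \in cutoff -> q' \in near_cell D0 q ->
  x \in cutoff -> x \in near_cell D0 q -> x \in near_cell D0 q'.
Proof.
move=> qc qc' qq' xc xq.
have h1 := cutoff_near qc qc' qq'; have h2 := cutoff_near qc xc xq.
rewrite near_cellC in h1; apply: near_cell_leq (near_cell_trans h1 h2).
by move: D0_large; clear; lia.
Qed.

Lemma rep_eq q q' : q \in cutoff -> q' \in cutoff -> q' \in near_cell D0 q -> rep q = rep q'.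
Proof.
move=> qc qc' qq'; rewrite /rep.
have E : (fun x => (x \in cutoff) && (x \in near_cell D0 q)) =1
         (fun x => (x \in cutoff) && (x \in near_cell D0 q')).
  move=> x; case: (boolP (x \in cutoff)) => //= xc; apply/idP/idP.
    exact: cutoff_near_eq.
  by apply: cutoff_near_eq => //; rewrite near_cellC.
rewrite (eq_pick E); case: pickP => // /(_ q').
by rewrite qc' near_cell_refl.
Qed.

Definition active (q : cell) := [&& q \in cutoff, rep q == q & [exists x, x \in cluster q]].

Lemma active_cutoff q : active q -> q \in cutoff. Proof. by case/and3P. Qed.

Lemma active_near_eq q q' : active q -> active q' -> q' \in near_cell D0 q -> q = q'.
Proof.
move=> /and3P[qc /eqP r _] /and3P[qc' /eqP r' _] qq'.
by have := rep_eq qc qc' qq'; rewrite r r'.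
Qed.

Section ClusterData.
Variables (x00 : V) (data : cell -> cluster_data).
Hypothesis dataP : forall q, active q -> good_data q (data q).

Definition used_exit : pred V :=
  [pred x | [exists q, active q && ((x == x_first (data q)) || (x == x_last (data q)))]].

Definition available (c : cell) := [seq x <- enum V | (b x == c) && (x \notin used_exit)].

(* Indexing by [q] makes different clusters use different vertices of a sea cell. *)
Definition point_of (q c : cell) : V := nth x00 (available c) (index q (enum (near_cell D c))).

Definition loop (q : cell) : seq V := if active q then
  x_first (data q) :: x_cluster (data q) ++ x_last (data q) ::
    map (point_of q) (track_head (data q) :: track (data q)) else [::].

Lemma exit_near q : active q ->
  b (x_first (data q)) \in near_cell D q /\ b (x_last (data q)) \in near_cell D q.
Proof.
move=> /dataP Z; have DD : D1 + H <= D by move: D0_large D_large; clear; lia.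
by split; apply: near_cell_leq DD _; [exact: gd_first_near|exact: gd_last_near].
Qed.

Lemma card_near (c : cell) : #|near_cell D c| <= N.
Proof. exact: card_near_cell. Qed.

(** An exit in the cell [c] belongs to one of the at most [N] clusters near [c], so at most [2 N] of
    more than [4 N] points are withheld. *)
Lemma size_available c : c \in full -> N <= size (available c).
Proof.
move=> cf; pose A := enum (near_cell D c).
have szA : size A <= N by rewrite -cardE card_near.
have -> : size (available c) = #|[pred x | (b x == c) && (x \notin used_exit)]|.
  exact: size_filter_enum.
have h := fullP cf; rewrite -(cardID used_exit) in h.
have : #|[predI [pred x | b x == c] & used_exit]| <=
    size (map (fun q => x_first (data q)) A ++ map (fun q => x_last (data q)) A).
  apply: leq_trans (card_size _); apply: subset_leq_card; apply/subsetP => x.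
  rewrite !inE => /andP[/eqP bx /existsP[q /andP[qa]]].
  have [n1 n2] := exit_near qa; rewrite near_cellC in n1; rewrite near_cellC in n2.
  rewrite mem_cat; case/orP => /eqP xE; apply/orP; [left|right]; apply/mapP; exists q => //.
    by rewrite mem_enum -bx xE.
  by rewrite mem_enum -bx xE.
rewrite size_cat !size_map.
have E : #|[predD [pred x | b x == c] & used_exit]| =
          #|[pred x | (b x == c) && (x \notin used_exit)]|.
  by apply: eq_card => x; rewrite !inE andbC.
rewrite E in h.
move: h szA M_large; rewrite -/N.
by move: #|[predI _ & _]| #|[pred x | _ && _]| (size A) => u v w; clear; lia.
Qed.

Lemma index_near (q c : cell) : q \in near_cell D c ->
  index q (enum (near_cell D c)) < N.
Proof.
by move=> qc; apply: leq_trans (card_near c); rewrite cardE index_mem mem_enum.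
Qed.

Lemma point_ofP q c : c \in full -> q \in near_cell D c ->
  b (point_of q c) = c /\ point_of q c \notin used_exit.
Proof.
move=> cf qc; have : point_of q c \in available c.
  by apply: mem_nth; apply: leq_trans (index_near qc) (size_available cf).
by rewrite mem_filter => /andP[/andP[/eqP]].
Qed.

Lemma point_of_inj q q' c : c \in full -> q \in near_cell D c -> q' \in near_cell D c ->
  point_of q c = point_of q' c -> q = q'.
Proof.
move=> cf qc qc' /eqP; rewrite /point_of nth_uniq.
- have qA : q \in enum (near_cell D c) by rewrite mem_enum.
  have qA' : q' \in enum (near_cell D c) by rewrite mem_enum.
  by move=> /eqP ii; rewrite -(nth_index q qA) ii nth_index.
- exact: leq_trans (index_near qc) (size_available cf).
- exact: leq_trans (index_near qc') (size_available cf).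
- by rewrite filter_uniq ?enum_uniq.
Qed.

Lemma track_near q c : active q -> c \in track_head (data q) :: track (data q) ->
  (c \in full) && (q \in near_cell D c).
Proof.
by move=> /dataP Z /(gd_track_in Z)/andP[-> nc]; rewrite near_cellC.
Qed.

Inductive loop_spec (q : cell) (x : V) : Prop :=
| LoopExit of x \in used_exit & b x \notin cutoff & b x \in near_cell (D1 + H) q
    & (x = x_first (data q) \/ x = x_last (data q))
| LoopCluster of x \in cluster q
| LoopTrack c of c \in full & q \in near_cell D c & x = point_of q c & x \notin used_exit
    & b x = c & b x \notin cutoff.

Lemma sea_track x s : last x s \in sea -> path [rel y z | I (cell_dist y z)] x s ->
  {subset x :: s <= full} -> {subset x :: s <= sea}.
Proof.
elim: s x => [|y s IH] x /= ls; first by move=> _ _ z; rewrite inE => /eqP ->.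
move=> /andP[Ixy ps] xsf.
have yss : {subset y :: s <= sea}.
  by apply: IH => // z zs; apply: xsf; rewrite inE zs orbT.
move=> z; rewrite inE => /orP[/eqP->|]; last exact: yss.
by apply: sea_adj (yss _ (mem_head _ _)) Ixy; apply: xsf; exact: mem_head.
Qed.

Lemma track_not_cutoff q c : active q -> c \in track_head (data q) :: track (data q) -> c \notin cutoff.
Proof.
move=> /dataP Z ct; apply/negP => /cutoff_sea /negP; apply; move: c ct.
apply: sea_track (gd_track_path Z) _; first by rewrite (gd_track_last Z) (gd_host_sea Z).
by move=> c /(gd_track_in Z)/andP[].
Qed.

Lemma loopP q x : x \in loop q -> active q /\ loop_spec q x.
Proof.
rewrite /loop; case: (boolP (active q)) => // qa xl; split=> //.
have Z := dataP qa.
have ex1 : x_first (data q) \in used_exit by apply/existsP; exists q; rewrite qa eqxx.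
have ex2 : x_last (data q) \in used_exit by apply/existsP; exists q; rewrite qa eqxx orbT.
move: xl; rewrite inE mem_cat inE => /or4P[/eqP->|xc|/eqP->|/mapP[c ct ->]].
- exact: LoopExit ex1 (gd_first_cut Z) (gd_first_near Z) (or_introl erefl).
- by apply: LoopCluster; rewrite -(gd_mem Z).
- exact: LoopExit ex2 (gd_last_cut Z) (gd_last_near Z) (or_intror erefl).
- have /andP[cf qc] := track_near qa ct; have [bp pu] := point_ofP cf qc.
  by apply: (LoopTrack cf qc) => //; rewrite bp; exact: track_not_cutoff qa ct.
Qed.

(** Exits, cluster points and route vertices are told apart by [used_exit] and [cutoff]. A common
    exit or cluster point puts the two representatives within [D0] of each other, so they agree; a
    common route vertex has one index in its cell. *)
Lemma loop_disjoint q q' x : x \in loop q -> x \in loop q' -> q = q'.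
Proof.
move=> /loopP[qa s] /loopP[qa' s'].
have DD : D1 + H + (D1 + H) <= D0 by move: D0_large; clear; lia.
case: s => [xu xc xn _|xU|c cf qc xp xu bx xc]; case: s' => [xu' xc' xn' _|xU'|c' cf' qc' xp' xu' bx' xc'].
- apply: active_near_eq => //; apply: near_cell_leq DD _.
  by rewrite near_cellC in xn'; exact: near_cell_trans xn xn'.
- by have [] := clusterP xU'; rewrite (negbTE xc).
- by rewrite xu in xu'.
- by have [] := clusterP xU; rewrite (negbTE xc').
- apply: active_near_eq => //.
  have h1 := cluster_extent (active_cutoff qa) xU.
  have h2 := cluster_extent (active_cutoff qa') xU'.
  rewrite near_cellC in h2; apply: near_cell_leq (near_cell_trans h1 h2).
  by move: DD; clear; lia.
- by have [] := clusterP xU; rewrite (negbTE xc').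
- by rewrite xu' in xu.
- by have [] := clusterP xU'; rewrite (negbTE xc).
- have cc : c = c' by rewrite -bx bx'.
  by rewrite cc in qc xp; apply: point_of_inj cf' qc qc' _; rewrite -xp.
Qed.

Lemma loop_uniq q : uniq (loop q).
Proof.
rewrite /loop; case: (boolP (active q)) => // qa; have Z := dataP qa.
have ex1 : x_first (data q) \in used_exit by apply/existsP; exists q; rewrite qa eqxx.
have ex2 : x_last (data q) \in used_exit by apply/existsP; exists q; rewrite qa eqxx orbT.
set tr := map _ _.
have trP x : x \in tr -> x \notin used_exit /\ b x \notin cutoff.
  case/mapP => c ct ->; have /andP[cf qc] := track_near qa ct.
  by have [bp pu] := point_ofP cf qc; rewrite bp pu; split=> //; exact: track_not_cutoff qa ct.
have clP x : x \in x_cluster (data q) -> b x \in cutoff.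
  by rewrite (gd_mem Z) => /clusterP[].
have trU : uniq tr.
  rewrite map_inj_in_uniq ?(gd_track_uniq Z) // => c c' ct ct' pp.
  have /andP[cf qc] := track_near qa ct; have /andP[cf' qc'] := track_near qa ct'.
  by rewrite -(proj1 (point_ofP cf qc)) pp (proj1 (point_ofP cf' qc')).
clearbody tr.
rewrite /= mem_cat inE cat_uniq /= !negb_or (gd_neq Z) (gd_uniq Z) trU /=.
have -> : x_first (data q) \notin x_cluster (data q).
  by apply/negP => /clP; rewrite (negbTE (gd_first_cut Z)).
have -> : x_first (data q) \notin tr by apply/negP => /trP[]; rewrite ex1.
have -> : x_last (data q) \notin x_cluster (data q).
  by apply/negP => /clP; rewrite (negbTE (gd_last_cut Z)).
have -> : x_last (data q) \notin tr by apply/negP => /trP[]; rewrite ex2.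
have -> : has (mem (x_cluster (data q))) tr = false.
  by apply/hasP => -[x /trP[_ xc] /clP]; rewrite (negbTE xc).
by [].
Qed.

Lemma loop_sorted q : sorted e (loop q).
Proof.
rewrite /loop; case: (boolP (active q)) => // qa; have Z := dataP qa.
have [u [t [clE e1 e2]]] := gd_links Z; rewrite clE /=.
rewrite e1 cat_path /= e2 /=.
have -> : path e u t.
  apply: clique_path; rewrite -clE ?(gd_uniq Z) // => x y; rewrite !(gd_mem Z).
  exact: cluster_clique (active_cutoff qa).
have pointP c : c \in track_head (data q) :: track (data q) -> b (point_of q c) = c.
  by move=> ct; have /andP[cf qc] := track_near qa ct; have [] := point_ofP cf qc.
have us := gd_track_uniq Z.
rewrite /=; apply/andP; split.
  apply: inner_e; last by rewrite (pointP _ (mem_head _ _)); exact: (gd_track_adj Z).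
  apply/eqP => xE; have ct := mem_head (track_head (data q)) (track (data q)).
  have /andP[cf qc] := track_near qa ct; have [_ /negP] := point_ofP cf qc; apply.
  by rewrite -xE; apply/existsP; exists q; rewrite qa eqxx orbT.
move: pointP us (gd_track_path Z).
elim: (track _) (track_head _) => //= y s IH x pointP /andP[xy us] /andP[Ixy ps].
apply/andP; split.
  apply: inner_e; last by rewrite !pointP ?mem_head // inE mem_head orbT.
  apply: contraNneq xy => pp.
  by rewrite -(pointP x) ?mem_head // pp pointP ?mem_head // inE mem_head orbT.
by apply: IH => // c cs; apply: pointP; rewrite inE cs orbT.
Qed.

(** The nodes of the tree are all the cells. Cut-off cells that are not active carry the empty path,
    which the threading of the tree tolerates. *)
Definition items (c : cell) : seq V := if c \in cutoff then loop c
  else [seq x <- enum V | (b x == c) && ~~ [exists q, x \in loop q]].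

Lemma mem_items c x : c \notin cutoff -> x \in items c -> b x = c /\ forall q, x \notin loop q.
Proof.
move=> cc; rewrite /items (negbTE cc) mem_filter => /andP[/andP[/eqP-> /existsPn xl] _].
by split.
Qed.

Lemma sea_not_cutoff c : c \in sea -> c \notin cutoff.
Proof. by apply: contraTN; exact: cutoff_sea. Qed.

Lemma items_uniq c : uniq (items c).
Proof.
by rewrite /items; case: ifP => _; [exact: loop_uniq | rewrite filter_uniq ?enum_uniq].
Qed.

Lemma items_sorted c : sorted e (items c).
Proof.
case: (boolP (c \in cutoff)) => cc; first by rewrite /items cc; exact: loop_sorted.
have := items_uniq c; have := @mem_items c; case: (items c) => //= y s inP us.
apply: clique_path => // u v uin vin uv; apply: same_cell_adjacent => //.
by have [-> _] := inP _ cc uin; have [-> _] := inP _ cc vin.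
Qed.

Lemma items_disjoint c c' x : x \in items c -> x \in items c' -> c = c'.
Proof.
case: (boolP (c \in cutoff)) => cc; case: (boolP (c' \in cutoff)) => cc'.
- by rewrite /items cc cc'; exact: loop_disjoint.
- by rewrite {1}/items cc => xl /(mem_items cc')[_ /(_ c)]; rewrite xl.
- by move=> /(mem_items cc)[_ /(_ c')] xl; rewrite /items cc' => xl'; rewrite xl' in xl.
- by move=> /(mem_items cc)[<- _] /(mem_items cc')[<- _].
Qed.

Lemma items_cover x : exists c, x \in items c.
Proof.
case: (boolP [exists q, x \in loop q]) => [/existsP[q xq]|xl].
  exists q; rewrite /items; have [qa _] := loopP xq.
  by rewrite (active_cutoff qa).
case: (boolP (b x \in cutoff)) => xc; last first.
  by exists (b x); rewrite /items (negbTE xc) mem_filter eqxx xl mem_enum.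
have [rc rn] := repP xc.
have xU : x \in cluster (rep (b x)) by apply/andP; split=> //; rewrite near_cellC.
have qa : active (rep (b x)).
  apply/and3P; split=> //; last by apply/existsP; exists x.
  by apply/eqP/esym; apply: rep_eq.
move/existsPn: xl => /(_ (rep (b x))); rewrite /loop qa inE mem_cat.
by rewrite (gd_mem (dataP qa)) xU orbT.
Qed.

(** Each of the at most [N] clusters nearby takes at most three points of the cell: two exits and
    one route vertex. The factor 4 in [M_large] leaves more than [N] points, to serve at most [N]
    children. *)
Lemma size_items c : c \in sea -> N < size (items c).
Proof.
move=> cs; have cc := sea_not_cutoff cs; pose A := enum (near_cell D c).
have szA : size A <= N by rewrite -cardE card_near.
pose used := [pred x | [exists q, x \in loop q]].
have -> : size (items c) = #|[pred x | (b x == c) && (x \notin used)]|.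
  by rewrite /items (negbTE cc); exact: size_filter_enum.
have hM := fullP (sea_full cs); rewrite -(cardID used) in hM.
have hu : #|[predI [pred x | b x == c] & used]| <=
    size (map (fun q => x_first (data q)) A ++ map (fun q => x_last (data q)) A ++
          map (point_of^~ c) A).
  apply: leq_trans (card_size _); apply: subset_leq_card; apply/subsetP => x.
  rewrite !inE => /andP[/eqP bx /existsP[q /loopP[qa xq]]].
  have [n1 n2] := exit_near qa; rewrite near_cellC in n1; rewrite near_cellC in n2.
  rewrite !mem_cat; case: xq => [_ _ _ [] xE|xU|c' _ qc' xE _ bx' _].
  - by apply/or3P/Or31/mapP; exists q => //; rewrite mem_enum -bx xE.
  - by apply/or3P/Or32/mapP; exists q => //; rewrite mem_enum -bx xE.
  - by have [] := clusterP xU; rewrite bx (negbTE cc).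
  - have cc' : c' = c by rewrite -bx' bx.
    by apply/or3P/Or33/mapP; exists q; rewrite -?cc' // mem_enum -cc'.
rewrite !size_cat !size_map in hu.
have E : #|[predD [pred x | b x == c] & used]| = #|[pred x | (b x == c) && (x \notin used)]|.
  by apply: eq_card => x; rewrite !inE andbC.
rewrite E in hM; move: hM hu szA M_large; rewrite -/N.
by move: #|[predI _ & _]| #|[pred x | _ && _]| (size A) => u v w; clear; lia.
Qed.

(** All parents lie in the sea: the next cell towards [root], an inner adjacent sea cell, or the
    host of an active cluster. Inactive cut-off cells take any nearby sea cell, their item being
    empty. *)
Lemma exists_parent : exists (par : cell -> cell) (rk : cell -> nat), forall c, c != root ->
  [/\ par c \in sea, c \in near_cell D (par c), rk (par c) < rk c,
      c \notin cutoff -> I (cell_dist c (par c)) & active c -> par c = host (data c)].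
Proof.
have [rk0 rk0P] := @connected_rank _ (cells_adjacent I full) sea root
  (fun x xs => sea_conn xs root_sea).
(* Every cell off the sea ranks above the whole sea, so only sea cells need the distance to
   [root]. *)
pose rk c := if c \in sea then rk0 c else (\max_(x : cell) rk0 x).+1.
have rk_lt c c' : c \notin sea -> c' \in sea -> rk c' < rk c.
  by move=> cs cs'; rewrite /rk cs' (negbTE cs) ltnS; exact: leq_bigmax.
have nearD c c' : c \in near_cell D0 c' -> c' \in near_cell D c.
  by move=> cc; rewrite near_cellC; exact: near_cell_leq cc.
have nearI c p : I (cell_dist c p) -> c \in near_cell D p.
  move=> Icp; apply/forallP => i; apply: leq_trans (I_bound i Icp) _.
  by move: D0_large D_large; clear; lia.
have ex c : exists p, c != root -> [/\ p \in sea, c \in near_cell D p, rk p < rk c,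
    c \notin cutoff -> I (cell_dist c p) & active c -> p = host (data c)].
  case: (boolP (c \in sea)) => cs.
    case: (eqVneq c root) => [_|cr]; first by exists c.
    have [p /and3P[_ pf Icp] rkp] := rk0P c cs cr.
    have ps : p \in sea by apply: sea_adj cs _ => //; exact: inner_sym Icp.
    exists p => _; split=> //; first exact: nearI.
    - by rewrite /rk ps cs.
    - by move=> /active_cutoff; rewrite (negbTE (sea_not_cutoff cs)).
  case: (boolP (c \in cutoff)) => cc; last first.
    have [p ps Icp] := cutoffPn' cc; exists p => _; split=> //.
    - exact: nearI.
    - exact: rk_lt.
    - by move=> /active_cutoff; rewrite (negbTE cc).
  case: (boolP (active c)) => ca.
    have Z := dataP ca; exists (host (data c)) => _; split=> //.
    - exact: (gd_host_sea Z).
    - exact/nearD/(gd_host_near Z).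
    - exact: rk_lt (gd_host_sea Z).
  have [p ps pc] := sea_near cc; exists p => _; split=> //; last exact: rk_lt.
  apply/nearD/(near_cell_leq _ pc).
  by move: D1_large D0_large; clear; lia.
have [par parP] := fin_all_exists ex.
by exists par, rk => c cr; exact: parP.
Qed.

Lemma items_ends (par : cell -> cell) c x y s : par c \in sea -> par c != c ->
  (c \notin cutoff -> I (cell_dist c (par c))) -> (active c -> par c = host (data c)) ->
  x \in items (par c) -> items c = y :: s -> e x y && e (last y s) x.
Proof.
move=> ps pc Icp hostE /(mem_items (sea_not_cutoff ps))[bx xl] cE.
case: (boolP (c \in cutoff)) => cc; last first.
  have edge z : z \in y :: s -> e z x.
    rewrite -cE => /(mem_items cc)[bz _]; apply: inner_e.
      by apply: contraNneq pc => zx; rewrite -bx -zx bz.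
    by rewrite bx bz; exact: Icp.
  by rewrite e_sym !edge ?mem_head ?mem_last.
have ca : active c by move: cE; rewrite /items cc /loop; case: ifP.
have Z := dataP ca; have hE := hostE ca.
have xl' z : z \in y :: s -> z != x.
  by rewrite -cE /items cc => zl; apply: contraNneq (xl c) => <-.
have yE : y = x_first (data c) by move: cE; rewrite /items cc /loop ca => -[<-].
have lE : last y s = point_of c (host (data c)).
  move: cE; rewrite /items cc /loop ca => -[_ <-]; rewrite last_cat /= last_map.
  by rewrite (gd_track_last Z).
have hT : host (data c) \in track_head (data c) :: track (data c).
  by rewrite -(gd_track_last Z); exact: mem_last.
have /andP[hf hn] := track_near ca hT; have [bp _] := point_ofP hf hn.
have lx := xl' _ (mem_last y s); have yx := xl' _ (mem_head y s).
apply/andP; split.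
  rewrite e_sym; apply: inner_e => //.
  by rewrite bx hE yE; exact: (gd_host_adj Z).
by apply: same_cell_adjacent => //; rewrite lE bp bx hE.
Qed.

(** Both ends of the spanning path lie in the root cell and are thus joined. They differ because the
    root item has more than [N] points, with [N] positive. *)
Lemma assembled_cycle : exists c, [/\ ucycle e c, 2 < size c & forall x, x \in c].
Proof.
have [par [rk parP]] := exists_parent.
have N0 := N_gt0; have szr := size_items root_sea.
case rE : (items root) szr => [|y t] // szr.
have neq c : c != root -> par c != c.
  by move=> cr; have [_ _ h _ _] := parP c cr; apply: contraTneq h => ->; rewrite ltnn.
have [|||||||c [uc pc cover lc]] := @path_tree_spanning V e _ root par rk items _ _ _ _ _ _ _ y t rE.
- by move=> c cr; have [] := parP c cr.
- exact: items_sorted.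
- exact: items_uniq.
- exact: items_disjoint.
- exact: items_cover.
- by move=> c x z s cr; have [ps _ _ Ic hc] := parP c cr; apply: items_ends => //; exact: neq.
- move=> c cr; have [ps cn _ _ _] := parP c cr.
  apply: leq_ltn_trans (size_items ps); apply: leq_trans (card_near (par c)).
  apply: subset_leq_card; apply/subsetP => i; rewrite inE => /andP[ir /eqP <-].
  by have [] := parP i ir.
exists (y :: c); split=> //.
- rewrite /ucycle uc andbT /= rcons_path pc lc.
  have yt : y \in items root by rewrite rE mem_head.
  have lt : last y t \in items root by rewrite rE mem_last.
  have [by_ _] := mem_items (sea_not_cutoff root_sea) yt.
  have [bl _] := mem_items (sea_not_cutoff root_sea) lt.
  apply: same_cell_adjacent; last by rewrite by_ bl.
  have := items_uniq root; rewrite rE /=; case: t szr {rE lt bl lc} => [|z t] /=; first by rewrite /N; clear -N0; lia.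
  move=> _ /andP[yzt _]; apply: contraNneq yzt => <-; exact: mem_last.
- have : #|[pred x | b x == root]| <= size (y :: c).
    by apply: leq_trans (card_size _); apply: subset_leq_card; apply/subsetP => x _.
  apply: leq_trans; apply: leq_trans (fullP (sea_full root_sea)).
  by move: M_large N0; rewrite /N; clear; lia.
Qed.

End ClusterData.

Theorem sea_hamilton : exists c, [/\ ucycle e c, 2 < size c & forall x, x \in c].
Proof.
have [x00 _] := sea_points root_sea.
have ex q : exists Z, active q -> good_data q Z.
  case: (boolP (active q)) => [|_]; last by exists (ClusterData x00 [::] x00 q q [::]).
  move=> /and3P[qc _ /existsP[x xq]].
  by have [Z ZP] := exists_cluster_data qc xq; exists Z.
have [data dataP] := fin_all_exists ex.
exact: assembled_cycle x00 _ dataP.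
Qed.

End Assembly.

(** * The deterministic statement on a grid *)

Section Grid.
Variables (d R : nat) (I O : ('I_d -> nat) -> bool) (H h T0 D1 D0 M K : nat).
Local Notation cell := {ffun 'I_d -> 'I_K.+1}.
Local Notation D := (window_side R T0 D0).
Hypothesis d_ge2 : 2 <= d.
Hypothesis I_anti : forall a b, (forall i, a i <= b i) -> I b -> I a.
Hypothesis I_bound : forall a i, I a -> a i <= R.
Hypothesis O_I : forall a, O a -> (forall i, 2 <= a i) -> I (fun i => a i - 2).
Hypothesis I_cube : forall a, (forall i, a i <= H) -> I a.
Hypothesis hH : h.*2 <= H.
Hypothesis HR : H <= R.
Hypothesis H_gt0 : 0 < H.
Hypothesis h_large : (5 * d + 1) * R.*2.+1 ^ d.-1 + 1 < h ^ d.
Hypothesis D1_large : H + T0 + 1 <= D1.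
Hypothesis D0_large : (D1 + H).*2 + R <= D0.
Hypothesis M_large : 4 * D.*2.+1 ^ d < M.
Hypothesis outer_T0 : forall tau, #|cell_shape R O tau| + 1 <= T0.
Hypothesis DK : D <= K.

Variables (V : finType) (e : rel V) (b : V -> cell).
Let full : {pred cell} := [pred c | M <= #|[pred x | b x == c]|].
Hypothesis few_nonfull : forall lo, valid_window R T0 D0 lo ->
  #|[pred x | in_window R T0 D0 lo x && (x \notin full)]| <=
  #|cell_shape R O (window_type R T0 D0 lo)| + 1.

Lemma exists_sea : exists root, root \in sea R I T0 D0 full.
Proof.
have D0' : H + T0 + 1 <= D0 by move: D1_large D0_large; clear; lia.
pose q : cell := [ffun=> ord0].
have [lo [alpha [beta E]]] := exists_enclosure d_ge2 hH HR H_gt0 h_large D0' DK outer_T0 few_nonfull q.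
have [p [i [pw _ sp]]] := exists_outer_slice d_ge2 hH HR H_gt0 h_large D0' DK E.
exists p; apply: skeleton_sea; apply/existsP; exists lo; rewrite (enc_valid E) pw.
by apply/existsP; exists i.
Qed.

Theorem grid_hamilton : symmetric e ->
  (forall x y, x != y -> I (cell_dist (b x) (b y)) -> e x y) ->
  (forall S : {set V}, #|S| < 2 -> forall x y, x \notin S -> y \notin S ->
    connect [rel u v | [&& u \notin S, v \notin S & e u v]] x y) ->
  (forall x y, e x y -> b y \in near_cell D1 (b x)) \/
  (forall x y, x != y -> b y \in near_cell (H.*2 + T0 + 1) (b x) -> e x y) ->
  exists c, [/\ ucycle e c, 2 < size c & forall x, x \in c].
Proof.
move=> e_sym inner_e e_conn short_or_long.
have D0' : H + T0 + 1 <= D0 by move: D1_large D0_large; clear; lia.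
have DD : D0 <= D by rewrite /window_side; clear; lia.
have [root root_sea] := exists_sea.
apply: (sea_hamilton (full := full) (sea := sea R I T0 D0 full)
  (cutoff := cutoff R I T0 D0 full) I_anti I_bound I_cube _ _ _ _ _ _ _ _
  root_sea D1_large D0_large DD e_sym inner_e e_conn short_or_long _ M_large).
- by move=> x; rewrite inE => /andP[].
- move=> x y; exact: (sea_connect d_ge2 I_anti I_cube hH HR H_gt0 h_large D0' DK outer_T0 few_nonfull).
- by move=> x y; exact: sea_adjacent.
- by move=> x; exact: cutoffPn.
- by move=> x; exact: (cutoff_not_sea I_cube).
- move=> q x j; exact: (cutoff_extent d_ge2 I_anti I_bound O_I I_cube hH HR H_gt0 h_large D0' DK outer_T0 few_nonfull).
- move=> q S1 S2; exact: (sea_route d_ge2 I_anti I_bound I_cube hH HR H_gt0 h_large D0' DK outer_T0 few_nonfull).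
- move=> q; exact: (sea_near_cutoff d_ge2 I_anti I_bound O_I I_cube hH HR H_gt0 h_large D0' DK outer_T0 few_nonfull).
- by move=> c; rewrite inE.
Qed.

(** If [Q] held all points, a line of [T0 + 1] cells avoiding [Q] would be empty, too many nonfull
    cells for one window. *)
Lemma exists_elsewhere (Q : cell) : exists x, b x != Q.
Proof.
apply/existsP; rewrite -[[exists _, _]]negbK; apply/negP => /existsPn allQ.
pose i0 : 'I_d := Ordinal (ltnW d_ge2); pose i1 : 'I_d := Ordinal d_ge2.
pose lo : cell := lattice_point K (fun=> 0).
have loE i : coordinate lo i = 0 by exact: coordinate_lattice_point.
have vlo : valid_window R T0 D0 lo by apply/forallP => i; rewrite loE; move: DK; clear; lia.
have D_T0 : T0 + 2 <= D.
  by rewrite /window_side; move: D1_large D0_large; clear; lia.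
(* The coordinate along [i0] is 1 if that of [Q] is 0, and 0 otherwise, so no cell of the line is
   [Q]. *)
pose f (t : 'I_T0.+1) : cell := lattice_point K (fun i =>
  if i == i1 then nat_of_ord t else if i == i0 then nat_of_bool (coordinate Q i0 == 0) else 0).
have fE t i : coordinate (f t) i =
    if i == i1 then nat_of_ord t else if i == i0 then nat_of_bool (coordinate Q i0 == 0) else 0.
  apply: coordinate_lattice_point; have := ltn_ord t; have := leq_b1 (coordinate Q i0 == 0).
  by move: DK D_T0; clear; case: (i == i1); case: (i == i0); lia.
have : T0.+1 <= #|[pred x | in_window R T0 D0 lo x && (x \notin full)]|.
  rewrite -[X in X <= _](card_ord T0.+1); apply: (@leq_card_inj _ _ f) => [t t' _ _ tt'|t _].
    by apply: val_inj; have := congr1 (fun g => coordinate g i1) tt'; rewrite !fE eqxx.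
  rewrite !inE; apply/andP; split.
    apply/forallP => i; rewrite loE fE; have := ltn_ord t; have := leq_b1 (coordinate Q i0 == 0).
    by move: D_T0; clear; case: (i == i1); case: (i == i0); lia.
  rewrite -ltnNge (_ : #|_| = 0); first by apply: leq_ltn_trans M_large.
  apply: eq_card0 => x; rewrite !inE; apply/negbTE; move: (allQ x); rewrite negbK => /eqP ->.
  apply/eqP => Qf; have := fE t i0; rewrite -Qf eqxx /=.
  by case: (coordinate Q i0).
rewrite ltnNge => /negP; apply; apply: leq_trans (few_nonfull vlo) _.
exact: outer_T0.
Qed.

End Grid.

(** A cycle stays connected when at most one vertex is deleted: what remains is the cycle or a
    path. *)
Lemma hamilton_two_connected (V : finType) (e : rel V) (c : seq V) :
  symmetric e -> ucycle e c -> (forall x, x \in c) ->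
  forall S : {set V}, #|S| < 2 -> forall x y, x \notin S -> y \notin S ->
    connect [rel u v | [&& u \notin S, v \notin S & e u v]] x y.
Proof.
move=> e_sym ec cover S S2 x y xS yS.
set f := [rel u v | _].
have f_sym : connect_sym f.
  by apply: sym_connect_sym => u v; rewrite /f /= e_sym andbCA.
have along s : sorted e s -> {in s, forall z, z \notin S} -> x \in s -> y \in s -> connect f x y.
  case: s => // u s us sS xs ys.
  have fs : path f u s.
    elim: s u us sS {xs ys} => //= v s IH u /andP[euv vs] sS.
    rewrite euv (sS u) ?mem_head // (sS v) ?inE ?eqxx ?orbT //=.
    by apply: IH => // z zs; apply: sS; rewrite inE zs orbT.
  have fromu z : z \in u :: s -> connect f u z by move=> zs; exact: path_connect fs _ zs.
  by apply: connect_trans (fromu _ ys); rewrite f_sym fromu.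
have /andP[ce uc] := ec.
case: (set_0Vmem S) => [S0|[z zS]].
  case: c ce cover {ec uc} => [|u s] /= ce cover; first by have := cover x.
  apply: (along (u :: s)) => //; last by move=> z _; rewrite S0 inE.
  by move: ce; rewrite rcons_path => /andP[].
have Sz : S = [set z].
  by apply/esym/eqP; rewrite eqEcard sub1set zS cards1 -ltnS.
have [i s cE] := rot_to (cover z).
have us : uniq (z :: s) by rewrite -cE rot_uniq.
have ins u : u \notin S -> u \in s.
  rewrite Sz inE => uz; have : u \in z :: s by rewrite -cE mem_rot.
  by rewrite inE (negbTE uz).
apply: (along s) => //; [|move=> u ins'|exact: ins|exact: ins].
  have : cycle e (z :: s) by rewrite -cE rot_cycle.
  by rewrite /= rcons_path => /andP[/path_sorted].
by rewrite Sz inE; apply: contraTneq ins' => ->; have /andP[] := us.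
Qed.

Lemma isolated_cell_disconnects d K (O : ('I_d -> nat) -> bool) (V : finType) (e : rel V)
    (b : V -> {ffun 'I_d -> 'I_K.+1}) x y :
  (forall u v, e u v -> O (cell_dist (b u) (b v))) ->
  (forall v, b v != b x -> ~~ O (cell_dist (b x) (b v))) -> b y != b x ->
  ~~ connect e x y.
Proof.
move=> eO iso byx; apply/negP => c.
have [] := @connect_crossing _ e [pred v | b v == b x] x y c; rewrite ?inE ?eqxx //.
move=> u [v [/eqP ux vx /eO]]; rewrite ux; apply/negP.
exact: iso.
Qed.

From mathcomp Require Import all_boot all_order all_algebra finmap.
From mathcomp Require Import all_classical all_reals all_analysis.
From mathcomp Require Import measurable_realfun ring lra.

Import Order.TTheory GRing.Theory Num.Theory.
Import numFieldNormedType.Exports.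

Local Open Scope classical_set_scope.
Local Open Scope ring_scope.

(** * The p-norm *)

Section PNorm.
Variables (R : realType) (p : \bar R).
Hypothesis hp : (1 <= p)%E.
Variable d : nat.
Implicit Types v w : 'I_d -> R.

Lemma sum_powR_ge0 m (A : pred 'I_m) (v : 'I_m -> R) q : 0 <= \sum_(i < m | A i) `|v i| `^ q.
Proof. by apply: sumr_ge0 => i _; exact: powR_ge0. Qed.

Lemma pnorm_ge0 v : 0 <= pnorm p v.
Proof.
by case: p hp => [q _|_|//] /=; [exact: powR_ge0 | exact: bigmax_ge_id].
Qed.

Lemma pnorm_mono v w : (forall i, `|v i| <= `|w i|) -> pnorm p v <= pnorm p w.
Proof.
move=> vw; case: p hp => [q|_|//] /=.
  rewrite lee_fin => q1; have q0 : 0 <= q by lra.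
  apply: ge0_ler_powR; rewrite ?invr_ge0 ?nnegrE ?sum_powR_ge0 //.
  by apply: ler_sum => i _; apply: ge0_ler_powR; rewrite ?nnegrE.
by apply: bigmax_le => [|i _]; [exact: bigmax_ge_id | apply: le_trans (vw i) _; exact: le_bigmax].
Qed.

Lemma pnorm_coord v i : `|v i| <= pnorm p v.
Proof.
case: p hp => [q|_|//] /=; last exact: le_bigmax.
rewrite lee_fin => q1; have q0 : 0 <= q by lra.
have qn0 : q != 0 by apply/eqP; lra.
rewrite -{1}(@powRr1 _ `|v i|) // -(divff qn0) powRrM.
apply: ge0_ler_powR; rewrite ?invr_ge0 ?nnegrE ?powR_ge0 ?sum_powR_ge0 //.
by rewrite (bigD1 i) //= lerDl sum_powR_ge0.
Qed.

(** The crude factor [d] serves all exponents at once, since [d ^ (1 / q) <= d]. *)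
Lemma pnorm_le v c : 0 <= c -> (forall i, `|v i| <= c) -> pnorm p v <= d%:R * c.
Proof.
move=> c0 vc; case: d v vc => [|d'] v vc.
  rewrite mul0r; case: p hp => [q|_|//] /=; rewrite big_ord0 //.
  by rewrite lee_fin => q1; rewrite powR0 ?invr_eq0 //; apply/eqP; lra.
have d1 : 1 <= d'.+1%:R :> R by rewrite ler1n.
case: p hp => [q|_|//] /=; last first.
  apply: bigmax_le => [|i _]; first by rewrite mulr_ge0.
  by apply: le_trans (vc i) _; rewrite ler_peMl.
rewrite lee_fin => q1; have q0 : 0 <= q by lra.
have qn0 : q != 0 by apply/eqP; lra.
apply: (@le_trans _ _ ((d'.+1%:R * c `^ q) `^ q^-1)).
  apply: ge0_ler_powR; rewrite ?invr_ge0 ?nnegrE ?mulr_ge0 ?powR_ge0 ?sum_powR_ge0 //.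
  rewrite mulr_natl -[X in _ *+ X]card_ord -sumr_const; apply: ler_sum => i _.
  by apply: ge0_ler_powR; rewrite ?nnegrE.
rewrite powRM ?powR_ge0 // -powRrM divff // powRr1 // ler_wpM2r //.
by apply: ler1_powR => //; rewrite invf_le1 //; lra.
Qed.

Lemma pnorm_scale c v : 0 <= c -> pnorm p (fun i => c * v i) = c * pnorm p v.
Proof.
move=> c0; case: p hp => [q|_|//] /=.
  rewrite lee_fin => q1; have qn0 : q != 0 by apply/eqP; lra.
  under eq_bigr do rewrite normrM (ger0_norm c0) powRM //.
  rewrite -mulr_sumr powRM ?powR_ge0 ?sum_powR_ge0 //.
  by rewrite -powRrM divff // powRr1.
have [->|cpos] := eqVneq c 0.
  rewrite mul0r; apply/le_anti; rewrite bigmax_ge_id andbT.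
  by apply: bigmax_le => // i _; rewrite mul0r normr0.
have {}cpos : 0 < c by rewrite lt_def cpos.
apply/le_anti/andP; split.
  apply: bigmax_le => [|i _]; first by rewrite mulr_ge0 // bigmax_ge_id.
  by rewrite normrM (ger0_norm c0) ler_wpM2l // le_bigmax.
rewrite mulrC -ler_pdivlMr //; apply: bigmax_le => [|i _].
  by rewrite divr_ge0 // bigmax_ge_id.
rewrite ler_pdivlMr // mulrC -[X in X * _](ger0_norm c0) -normrM.
exact: (@le_bigmax _ _ _ _ (fun i => `|c * v i|)).
Qed.

End PNorm.

(** In units of the cell side, points in cells with offsets [a] differ along axis [i] by at most
    [a i + 1] and by at least [a i - 1], truncated at 0. The first bound gives [inner_adjacent], the
    second [outer_adjacent]. *)
Definition inner_adjacent (R : realType) (p : \bar R) d (rho : nat) (a : 'I_d -> nat) : bool :=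
  pnorm p (fun i => (a i).+1%:R) <= rho%:R.

Definition outer_adjacent (R : realType) (p : \bar R) d (rho : nat) (a : 'I_d -> nat) : bool :=
  pnorm p (fun i => (a i).-1%:R) <= rho%:R.

Section Adjacency.
Variables (R : realType) (p : \bar R) (d rho : nat).
Hypothesis hp : (1 <= p)%E.
Local Notation I := (@inner_adjacent R p d rho).
Local Notation O := (@outer_adjacent R p d rho).

Lemma inner_anti a b : (forall i, a i <= b i)%N -> I b -> I a.
Proof.
move=> ab; apply: le_trans; apply: pnorm_mono => // i.
by rewrite !ger0_norm // ler_nat ltnS.
Qed.

Lemma outer_anti a b : (forall i, a i <= b i)%N -> O b -> O a.
Proof.
move=> ab; apply: le_trans; apply: pnorm_mono => // i.
by rewrite !ger0_norm // ler_nat; have := ab i; lia.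
Qed.

Lemma inner_bound a i : I a -> (a i <= rho.+1)%N.
Proof.
move=> /(le_trans (pnorm_coord hp _ i)); rewrite ger0_norm // ler_nat; lia.
Qed.

Lemma outer_bound a i : O a -> (a i <= rho.+1)%N.
Proof.
move=> /(le_trans (pnorm_coord hp _ i)); rewrite ger0_norm // ler_nat; lia.
Qed.

Lemma outer_inner a : O a -> (forall i, 2 <= a i)%N -> I (fun i => a i - 2)%N.
Proof.
move=> Oa a2; rewrite /I /inner_adjacent (_ : (fun i => _) = (fun i => (a i).-1%:R)) //.
by apply/funext => i; congr _%:R; have := a2 i; lia.
Qed.

Lemma inner_cube H a : (d * H.+1 <= rho)%N -> (forall i, a i <= H)%N -> I a.
Proof.
move=> dH aH; apply: (@le_trans _ _ (d%:R * H.+1%:R)); last by rewrite -natrM ler_nat.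
by apply: pnorm_le => // i; rewrite ger0_norm // ler_nat ltnS.
Qed.

End Adjacency.

(** * From points to cells *)

Section Cells.
Variables (R : realType) (p : \bar R) (d K : nat) (s : R).
Hypothesis hp : (1 <= p)%E.
Hypothesis s_gt0 : 0 < s.

(** The minimum with [K] puts the points of an upper facet into the last cells. *)
Definition cell_of (x : real_space R d) : {ffun 'I_d -> 'I_K.+1} :=
  lattice_point K (fun i => minn (Num.truncn ((tnth x i : R) / s)) K).

Lemma coordinate_cell_of x i : coordinate (cell_of x) i = minn (Num.truncn ((tnth x i : R) / s)) K.
Proof. by apply: coordinate_lattice_point; exact: geq_minr. Qed.

Lemma cell_of_bounds x i : 0 <= (tnth x i : R) <= K.+1%:R * s ->
  (coordinate (cell_of x) i)%:R * s <= tnth x i <= (coordinate (cell_of x) i).+1%:R * s.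
Proof.
move=> /andP[x0 xK]; rewrite coordinate_cell_of.
have y0 : 0 <= (tnth x i : R) / s by rewrite divr_ge0 // ltW.
have yK : (tnth x i : R) / s <= K.+1%:R by rewrite ler_pdivrMr.
suff /andP[h1 h2] : (minn (Num.truncn ((tnth x i : R) / s)) K)%:R <= (tnth x i : R) / s <=
    (minn (Num.truncn ((tnth x i : R) / s)) K).+1%:R.
  by rewrite -ler_pdivlMr // h1 -ler_pdivrMr.
move: y0 yK; move: (_ / s) => y y0 yK.
set t := Num.truncn y.
have /andP[t1 t2] : t%:R <= y < t.+1%:R := truncn_itv y0.
case: (leqP t K) => tK; first by rewrite t1 ltW.
by rewrite yK andbT; apply: le_trans t1; rewrite ler_nat ltnW.
Qed.

Lemma cell_dist_natr (x y : {ffun 'I_d -> 'I_K.+1}) i :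
  (cell_dist x y i)%:R = `|(coordinate x i)%:R - (coordinate y i)%:R| :> R.
Proof.
rewrite /cell_dist /absdiff; case: (leqP (coordinate x i) (coordinate y i)) => xy.
  rewrite (eqP (_ : (coordinate x i - coordinate y i)%N == 0)); last by rewrite subn_eq0.
  by rewrite add0n natrB // distrC ger0_norm // subr_ge0 ler_nat.
rewrite (eqP (_ : (coordinate y i - coordinate x i)%N == 0)); last by rewrite subn_eq0 ltnW.
by rewrite addn0 natrB 1?ltnW // ger0_norm // subr_ge0 ler_nat ltnW.
Qed.

Section TwoPoints.
Variables x y : real_space R d.
Hypothesis xP : forall i, 0 <= (tnth x i : R) <= K.+1%:R * s.
Hypothesis yP : forall i, 0 <= (tnth y i : R) <= K.+1%:R * s.
Local Notation dist := (cell_dist (cell_of x) (cell_of y)).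

Lemma coord_dist_le i : `|(tnth x i : R) - tnth y i| <= s * (dist i).+1%:R.
Proof.
have /andP[x1 x2] := cell_of_bounds (xP i); have /andP[y1 y2] := cell_of_bounds (yP i).
rewrite -natr1 cell_dist_natr; move: x1 x2 y1 y2; rewrite -!natr1.
move: (coordinate (cell_of x) i)%:R (coordinate (cell_of y) i)%:R (tnth x i) (tnth y i) => a b u v x1 x2 y1 y2.
have h1 : b - a <= `|a - b| by rewrite distrC ler_norm.
have h2 : a - b <= `|a - b| by rewrite ler_norm.
have := ler_wpM2l (ltW s_gt0) h1; have := ler_wpM2l (ltW s_gt0) h2.
move: (`|a - b|) => n k1 k2.
by rewrite ler_norml; apply/andP; split; lra.
Qed.

Lemma coord_dist_ge i : s * (dist i).-1%:R <= `|(tnth x i : R) - tnth y i|.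
Proof.
have /andP[x1 x2] := cell_of_bounds (xP i); have /andP[y1 y2] := cell_of_bounds (yP i).
have [->|d0] := posnP (dist i); first by rewrite mulr0.
have : (dist i).-1%:R = (dist i)%:R - 1 :> R by rewrite -subn1 natrB.
move=> ->; rewrite cell_dist_natr; move: x1 x2 y1 y2; rewrite -!natr1.
move: (coordinate (cell_of x) i)%:R (coordinate (cell_of y) i)%:R (tnth x i) (tnth y i) => a b u v x1 x2 y1 y2.
have h1 : u - v <= `|u - v| by rewrite ler_norm.
have h2 : v - u <= `|u - v| by rewrite distrC ler_norm.
by move: h1 h2; move: (`|u - v|) => n h1 h2; case: (ger0P (a - b)) => _; lra.
Qed.

Lemma pdist_inner rho : inner_adjacent p rho dist -> pdist p x y <= s * rho%:R.
Proof.
move=> Ixy; apply: (@le_trans _ _ (s * pnorm p (fun i => (dist i).+1%:R))); last first.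
  by rewrite ler_wpM2l // ltW.
rewrite -(pnorm_scale hp _ (ltW s_gt0)) /pdist; apply: pnorm_mono => // i.
by apply: le_trans (coord_dist_le i) _; rewrite ler_norm.
Qed.

Lemma pdist_outer rho : pdist p x y <= s * rho%:R -> outer_adjacent p rho dist.
Proof.
move=> xy; rewrite /outer_adjacent -(ler_pM2l s_gt0); apply: le_trans xy.
rewrite -(pnorm_scale hp _ (ltW s_gt0)) /pdist; apply: pnorm_mono => // i.
by rewrite ger0_norm ?coord_dist_ge // mulr_ge0 // ltW.
Qed.

Lemma pdist_near m : pdist p x y <= s * m%:R -> cell_of y \in near_cell m.+1 (cell_of x).
Proof.
move=> xy; apply/forallP => i; rewrite absdiffC -[X in (X <= _)%N]/(dist i).
have : s * (dist i).-1%:R <= s * m%:R.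
  by apply: le_trans (coord_dist_ge i) _; apply: le_trans xy; exact: pnorm_coord.
by rewrite ler_pM2l // ler_nat; case: (dist i).
Qed.

Lemma near_pdist m : cell_of y \in near_cell m (cell_of x) -> pdist p x y <= s * (d * m.+1)%:R.
Proof.
move=> /forallP xy; apply: (@le_trans _ _ (d%:R * (s * m.+1%:R))); last first.
  by rewrite natrM mulrCA.
apply: pnorm_le => // [|i]; first by rewrite mulr_ge0 // ltW.
apply: le_trans (coord_dist_le i) _; rewrite ler_pM2l // ler_nat ltnS.
by have := xy i; rewrite absdiffC.
Qed.

End TwoPoints.
End Cells.

Lemma eq_hitting_radius (R : realType) (p : \bar R) d (Q Q' : graph_property)
    (X : {fset real_space R d}) :
  (forall r : R, 0 <= r ->
    Q X (geometric_graph p (X := X) r) <-> Q' X (geometric_graph p (X := X) r)) ->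
  hitting_radius p Q X = hitting_radius p Q' X.
Proof.
move=> QQ'; rewrite /hitting_radius; congr xget; congr image.
apply/seteqP; split=> r /= [r0 Qr mn]; split=> //; try exact/QQ'.
  by move=> s s0 /(QQ' s s0)/mn; apply.
by move=> s s0 /(QQ' s s0)/mn; apply.
Qed.

Lemma pdistC (R : realType) (p : \bar R) d (x y : real_space R d) : (1 <= p)%E ->
  pdist p x y = pdist p y x.
Proof.
by move=> hp; apply/le_anti; rewrite /pdist !pnorm_mono // => i; rewrite distrC.
Qed.

Lemma geometric_graph_sym (R : realType) (p : \bar R) d (X : {fset real_space R d}) r :
  (1 <= p)%E -> symmetric (geometric_graph p (X := X) r).
Proof. by move=> hp x y; rewrite /geometric_graph eq_sym pdistC. Qed.

Lemma hamilton_k_connected (T : finType) (e : rel T) : symmetric e ->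
  has_hamilton_cycle e -> k_connected 2 e.
Proof.
move=> es [c [ec c2 cov]]; split.
  by apply: leq_trans c2 _; rewrite -(card_uniqP _) ?max_card //; case/andP: ec.
exact: hamilton_two_connected es ec cov.
Qed.

(** Volume beats surface: the left side has order [h ^ (d - 1)]. The witness comes from bounding the
    base of the power by [9 * d * h]. *)
Lemma exists_fine_scale (d : nat) : (2 <= d)%N -> exists2 h : nat, (0 < h)%N &
  ((5 * d + 1) * (d * h.*2.+1).+1.*2.+1 ^ d.-1 + 1 < h ^ d)%N.
Proof.
move=> d2; pose c := ((9 * d) ^ d.-1)%N; pose h := ((5 * d + 3) * c)%N.
have c0 : (0 < c)%N by rewrite expn_gt0 muln_gt0 /=; lia.
have h0 : (0 < h)%N by rewrite muln_gt0 c0 andbT; lia.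
exists h => //.
have b : ((d * h.*2.+1).+1.*2.+1 <= 9 * d * h)%N by clear -h0 d2; nia.
have b' : ((d * h.*2.+1).+1.*2.+1 ^ d.-1 <= c * h ^ d.-1)%N.
  by rewrite -expnMn leq_exp2r //; lia.
have hd : (h ^ d = (5 * d + 3) * (c * h ^ d.-1))%N.
  by rewrite mulnA -/h -expnS prednK //; lia.
have p0 : (0 < c * h ^ d.-1)%N by rewrite muln_gt0 c0 expn_gt0 h0.
rewrite hd; move: b' p0; move: (c * _)%N (_ ^ _)%N => u v; clear; nia.
Qed.

(** * Fixing the constants; the equivalence for a good configuration *)

Section Configuration.
Variables (R : realType) (p : \bar R) (d h K : nat) (s : R).
Hypothesis hp : (1 <= p)%E.
Hypothesis d_ge2 : (2 <= d)%N.
Hypothesis s_gt0 : 0 < s.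

(** The threshold in cell sides, just large enough for [inner_cube] to cover all offsets up to
    [2 h]. *)
Definition grid_radius := (d * h.*2.+1)%N.
Definition grid_range := grid_radius.+1.
(** The number of cells in the model box bounds every neighbourhood; one more is allowed in a
    window. *)
Definition window_excess := (grid_range.*2.+1 ^ d + 1)%N.
(** At this radius [near_pdist] joins points whose cells are at distance at most
    [4 h + window_excess + 1]: the extent of a cluster plus the distance to a sea cell. *)
Definition far_radius := (d * (h.*2.*2 + window_excess + 2))%N.
Definition separation := ((far_radius.+1 + h.*2).*2 + grid_range)%N.
Definition window := window_side grid_range window_excess separation.
Definition fullness := (4 * window.*2.+1 ^ d + 1)%N.

Hypothesis h_gt0 : (0 < h)%N.
Hypothesis h_large : ((5 * d + 1) * (d * h.*2.+1).+1.*2.+1 ^ d.-1 + 1 < h ^ d)%N.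
Hypothesis window_K : (window <= K)%N.

Local Notation O := (@outer_adjacent R p d grid_radius).
Local Notation cell := {ffun 'I_d -> 'I_K.+1}.

Definition outer_count (tau : position_type d) : nat := #|cell_shape grid_range O tau|.

(* [cnt c] is the number of points in the cell [c]. *)
Definition few_sparse_cells (cnt : cell -> nat) := forall lo : cell,
  valid_window grid_range window_excess separation lo ->
  (#|[pred c | in_window grid_range window_excess separation lo c && (cnt c < fullness)%N]|
    <= outer_count (window_type grid_range window_excess separation lo) + 1)%N.

Definition has_isolated_cell (cnt : cell -> nat) := exists Q : cell, (0 < cnt Q)%N /\
  forall c, c != Q -> O (cell_dist Q c) -> cnt c = 0%N.

Variable X : {fset real_space R d}.
Hypothesis X_cube : forall x, x \in X -> forall i, 0 <= (tnth x i : R) <= K.+1%:R * s.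

Definition fiber_count (c : cell) : nat := #|[pred x : X | cell_of K s (val x) == c]|.

(** Below [s * grid_radius] the isolated cell refutes even connectivity. From there on points of
    inner adjacent cells are joined and [grid_hamilton] applies, [far_radius] deciding between short
    and long edges. *)
Lemma two_connected_iff_hamilton r : few_sparse_cells fiber_count ->
  has_isolated_cell fiber_count -> 0 <= r ->
  k_connected 2 (geometric_graph p (X := X) r) <->
  has_hamilton_cycle (geometric_graph p (X := X) r).
Proof.
move=> few [Q [Q0 Qiso]] r0; split; last first.
  exact/hamilton_k_connected/geometric_graph_sym.
move=> [_ conn].
pose b (x : X) : cell := cell_of K s (val x).
have XP (x : X) i : 0 <= (tnth (val x) i : R) <= K.+1%:R * s by apply: X_cube; exact: valP.
have I_anti := @inner_anti R p d grid_radius hp.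
have I_bound := @inner_bound R p d grid_radius hp.
have I_cube a := @inner_cube R p d grid_radius hp h.*2 a (leqnn _).
have O_I := @outer_inner R p d grid_radius hp.
have H_gt0 : (0 < h.*2)%N by rewrite double_gt0.
have HR : (h.*2 <= grid_range)%N by rewrite /grid_range /grid_radius; clear -d_ge2; nia.
have D1_large : (h.*2 + window_excess + 1 <= far_radius.+1)%N.
  by rewrite /far_radius; clear -d_ge2; nia.
have M_large : (4 * window.*2.+1 ^ d < fullness)%N by rewrite /fullness addn1.
have outer_T0 tau : (#|cell_shape grid_range O tau| + 1 <= window_excess)%N.
  rewrite /window_excess leq_add2r; apply: leq_trans (max_card _) _.
  by rewrite card_ffun !card_ord.
have few' lo : valid_window grid_range window_excess separation lo ->
    (#|[pred x | in_window grid_range window_excess separation lo x &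
      x \notin [pred c | fullness <= #|[pred x | b x == c]|]]| <=
    #|cell_shape grid_range O (window_type grid_range window_excess separation lo)| + 1)%N.
  move=> vlo; apply: leq_trans (few lo vlo); apply: subset_leq_card.
  by apply/fintype.subsetP => c; rewrite !inE -ltnNge.
have [x [y [xQ yQ]]] : exists x y, b x = Q /\ b y != Q.
  have /card_gt0P[x /eqP xQ] := Q0.
  have [y yQ] := exists_elsewhere d_ge2 D1_large (leqnn _) M_large outer_T0 window_K few' Q.
  by exists x, y.
have [r_small|r_big] := ltP r (s * grid_radius%:R).
  have : connect (geometric_graph p (X := X) r) x y.
    have := conn finset.set0; rewrite cards0 => /(_ isT x y).
    rewrite !finset.in_set0 => /(_ isT isT); apply: connect_mono => u v /=.
    by rewrite !finset.in_set0.
  move=> cxy; exfalso; move: cxy; apply/negP.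
  apply: (isolated_cell_disconnects (O := O) (b := b)) => [u v /andP[_ uv]|v|]; last by rewrite xQ.
    by apply: (pdist_outer hp s_gt0 (XP u) (XP v)); apply: le_trans uv _; exact: ltW.
  rewrite xQ => vQ; apply/negP => /(Qiso _ vQ)/eqP; rewrite -leqn0 leqNgt => /negP; apply.
  by apply/card_gt0P; exists v; rewrite inE.
have := @grid_hamilton d grid_range (@inner_adjacent R p d grid_radius) O h.*2 h window_excess
  far_radius.+1 separation fullness K d_ge2 I_anti I_bound O_I I_cube (leqnn _) HR H_gt0
  h_large D1_large (leqnn _) M_large outer_T0 window_K X (geometric_graph p (X := X) r) b few'.
apply=> //.
- exact: geometric_graph_sym.
- move=> u v uv Iuv; rewrite /geometric_graph uv.
  by apply: le_trans r_big; exact: (pdist_inner hp s_gt0 (XP u) (XP v)).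
- have [r_far|r_near] := leP (s * far_radius%:R) r.
    right=> u v uv nuv; rewrite /geometric_graph uv; apply: le_trans r_far.
    apply: le_trans (near_pdist hp s_gt0 (XP u) (XP v) nuv) _.
    rewrite ler_pM2l // ler_nat /far_radius; clear; nia.
  left=> u v /andP[_ uv].
  by apply: (pdist_near hp s_gt0 (XP u) (XP v)); apply: le_trans uv _; exact: ltW.
Qed.

End Configuration.

(** * Probability *)

Section RealProbability.
Context (R : realType) (dT : measure_display) (T : measurableType dT).
Variable P : probability T R.
Implicit Types A B : set T.

Definition prob A : R := fine (P A).

Lemma probE A : measurable A -> P A = (prob A)%:E.
Proof. by move=> mA; rewrite /prob fineK // fin_num_measure. Qed.

Lemma prob_ge0 A : 0 <= prob A.
Proof. by rewrite /prob fine_ge0. Qed.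

Lemma prob_le1 A : measurable A -> prob A <= 1.
Proof. by move=> mA; rewrite -lee_fin -probE // probability_le1. Qed.

Lemma prob_setT : prob [set: T] = 1.
Proof. by rewrite /prob probability_setT. Qed.

Lemma prob_mono A B : measurable A -> measurable B -> A `<=` B -> prob A <= prob B.
Proof. by move=> mA mB AB; rewrite -lee_fin -!probE //; apply: le_measure => //; rewrite inE. Qed.

Lemma prob_split A B : measurable A -> measurable B ->
  prob A = prob (A `&` B) + prob (A `&` ~` B).
Proof.
move=> mA mB; have mC : measurable (~` B) by exact: measurableC.
apply: EFin_inj; rewrite EFinD -!probE //; [|exact: measurableI|exact: measurableI].
by rewrite addeC -setDE; exact: measureDI.
Qed.

Lemma prob_setC A : measurable A -> prob (~` A) = 1 - prob A.
Proof.
move=> mA; have := prob_split measurableT mA; rewrite !setTI prob_setT => ->; ring.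
Qed.

Lemma prob_setU A B : measurable A -> measurable B -> prob (A `|` B) <= prob A + prob B.
Proof.
move=> mA mB; have mU : measurable (A `|` B) by exact: measurableU.
rewrite (prob_split mU mA); apply: lerD.
  by apply: prob_mono => //; exact: measurableI.
apply: prob_mono => //; first by apply: measurableI => //; exact: measurableC.
by move=> w [[] //].
Qed.

Definition some_event (I : eqType) (s : seq I) (E : I -> set T) : set T :=
  [set w | exists2 i, i \in s & E i w].

Lemma some_event_cons (I : eqType) (i : I) s E :
  some_event (i :: s) E = E i `|` some_event s E.
Proof.
apply/seteqP; split=> [w [j]|w [Ew|[j js Ew]]].
- by rewrite inE => /orP[/eqP->|js] Ew; [left | right; exists j].
- by exists i; rewrite ?mem_head.
- by exists j; rewrite // inE js orbT.
Qed.

Lemma measurable_some_event (I : eqType) (s : seq I) E :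
  (forall i, measurable (E i)) -> measurable (some_event s E).
Proof.
move=> mE; elim: s => [|i s IH]; last by rewrite some_event_cons; exact: measurableU.
by rewrite (_ : some_event _ _ = set0) // -subset0 => w [].
Qed.

Lemma prob_some_event (I : eqType) (s : seq I) E :
  (forall i, measurable (E i)) -> prob (some_event s E) <= \sum_(i <- s) prob (E i).
Proof.
move=> mE; elim: s => [|i s IH].
  by rewrite big_nil (_ : some_event _ _ = set0) ?/prob ?measure0 // -subset0 => w [].
rewrite big_cons some_event_cons; apply: le_trans (lerD (lexx _) IH).
by apply: prob_setU => //; exact: measurable_some_event.
Qed.

End RealProbability.

(** * Independent trials on disjoint sets of cells *)

Section IndependentCounts.
Context (R : realType) (dT : measure_display) (T : measurableType dT).
Variables (P : probability T R) (C : finType) (N : C -> T -> nat).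
Local Notation pr := (prob P).

Definition joint_event (U : C -> set nat) : set T := [set w | forall c, U c (N c w)].

Hypothesis mN : forall c U, measurable [set w | U (N c w)].
Hypothesis indep : forall U : C -> set nat,
  pr (joint_event U) = \prod_c pr [set w | U c (N c w)].

Lemma measurable_joint_event U : measurable (joint_event U).
Proof.
rewrite (_ : joint_event U = \bigcap_(c in [set: C]) [set w | U c (N c w)]).
  by apply: fin_bigcap_measurable => //; exact: finite_finset.
by apply/seteqP; split=> w /= Uw c; [move=> _|]; apply: Uw.
Qed.

(** [setT] stands for no constraint, so at each cell at least one of the two factors is 1. *)
Lemma joint_disjoint U V : (forall c, U c = setT \/ V c = setT) ->
  pr (joint_event U `&` joint_event V) = pr (joint_event U) * pr (joint_event V).
Proof.
move=> UV; rewrite (_ : joint_event U `&` _ = joint_event (fun c => U c `&` V c)); last first.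
  apply/seteqP; split=> w /=; first by move=> [h1 h2] c; split.
  by move=> h; split=> c; have [] := h c.
rewrite !indep -big_split; apply: eq_bigr => c _ /=.
have ptT : pr [set w | [set: nat] (N c w)] = 1.
  by rewrite (_ : [set w | _] = setT) ?prob_setT //; apply/seteqP.
have [->|->] := UV c; rewrite ptT.
  by rewrite mul1r; congr (pr _); apply/seteqP; split=> w /=; [case|split].
by rewrite mulr1; congr (pr _); apply/seteqP; split=> w /=; [case|split].
Qed.

(* The event [W] on the remaining cells is carried along for the induction. *)
Lemma trials_fail (J : eqType) (s : seq J) (U : J -> C -> set nat) (W : C -> set nat) :
  uniq s ->
  (forall i j c, i \in s -> j \in s -> i != j -> U i c = setT \/ U j c = setT) ->
  (forall i c, i \in s -> U i c = setT \/ W c = setT) ->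
  pr ([set w | forall i, i \in s -> ~ joint_event (U i) w] `&` joint_event W) =
  (\prod_(i <- s) (1 - pr (joint_event (U i)))) * pr (joint_event W).
Proof.
elim: s W => [|i s IH] W.
  by move=> _ _ _; rewrite big_nil mul1r (_ : [set w | _] = setT) ?setTI //; apply/seteqP.
move=> /andP[is_ us] dU dW.
set F := [set w | forall j, j \in s -> ~ joint_event (U j) w].
have mF : measurable F.
  rewrite (_ : F = ~` some_event s (fun j => joint_event (U j))).
    by apply/measurableC/measurable_some_event => j; exact: measurable_joint_event.
  by apply/seteqP; split=> w /= h; [move=> [j js]; exact: h | move=> j js Uj; apply: h; exists j].
have mI := measurable_joint_event (U i); have mW := measurable_joint_event W.
have memI j : j \in s -> j \in i :: s by move=> js; rewrite inE js orbT.
have IHW : pr (F `&` joint_event W) = (\prod_(j <- s) (1 - pr (joint_event (U j)))) * pr (joint_event W).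
  by apply: IH => // [j k c js ks|j c js]; [apply: dU; exact: memI | apply: dW; exact: memI].
have IHI : pr (F `&` joint_event (fun c => U i c `&` W c)) =
    (\prod_(j <- s) (1 - pr (joint_event (U j)))) * (pr (joint_event (U i)) * pr (joint_event W)).
  rewrite IH //; last 2 first.
  - by move=> j k c js ks; apply: dU; exact: memI.
  - move=> j c js; have [h1|h1] := dW j c (memI _ js); first by left.
    have ji : j != i by apply: contraNneq is_ => <-.
    have [h2|h2] := dU j i c (memI _ js) (mem_head _ _) ji; first by left.
    by right; rewrite h1 h2 setIT.
  congr (_ * _); rewrite -joint_disjoint; last by move=> c; exact: dW (mem_head _ _).
  congr (pr _); apply/seteqP; split=> w /=; first by move=> h; split=> c; have [] := h c.
  by move=> [h1 h2] c; split.
rewrite big_cons.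
have -> : [set w | forall j, j \in i :: s -> ~ joint_event (U j) w] `&` joint_event W =
    (F `&` joint_event W) `&` ~` joint_event (U i).
  apply/seteqP; split=> w /= [].
    by move=> h Ww; split; [split=> // j js; apply: h; exact: memI | apply: h; exact: mem_head].
  move=> [h Ww] hi; split=> // j; rewrite inE => /orP[/eqP->//|]; exact: h.
have := prob_split P (measurableI _ _ mF mW) mI.
have -> : F `&` joint_event W `&` joint_event (U i) = F `&` joint_event (fun c => U i c `&` W c).
  apply/seteqP; split=> w /=.
    by move=> [[h1 h2] h3]; split=> // c; split.
  by move=> [h1 h2]; split; [split=> // c; have [] := h2 c|move=> c; have [] := h2 c].
by rewrite IHW IHI addrC => /eqP; rewrite -subr_eq => /eqP <-; ring.
Qed.

End IndependentCounts.

Lemma card_window d R T0 D0 K (lo : {ffun 'I_d -> 'I_K.+1}) :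
  (0 < d)%N -> (#|[pred x | in_window R T0 D0 lo x]| <= window_side R T0 D0 ^ d)%N.
Proof.
move=> d0; set D := window_side R T0 D0.
have D_gt0 : (0 < D)%N by rewrite /D /window_side; lia.
have -> : (D ^ d)%N = #|{: {ffun 'I_d -> 'I_D.-1.+1}}| by rewrite card_ffun !card_ord prednK.
pose f (x : {ffun 'I_d -> 'I_K.+1}) : {ffun 'I_d -> 'I_D.-1.+1} :=
  lattice_point D.-1 (fun i => coordinate x i - coordinate lo i)%N.
have fE x i : in_window R T0 D0 lo x -> coordinate (f x) i = (coordinate x i - coordinate lo i)%N.
  by move=> /forallP/(_ i) xw; apply: coordinate_lattice_point; move: xw; rewrite -/D; clear; lia.
apply: (@leq_card_inj _ _ f) => // x y xw yw fxy; apply: coordinate_inj => i.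
have := congr1 (fun g => coordinate g i) fxy; rewrite !fE //.
by move/forallP: xw => /(_ i); move/forallP: yw => /(_ i); clear; lia.
Qed.

(** Along an axis that is not free, the facet determines the position of the window. *)
Lemma card_window_type d R T0 D0 K (tau : position_type d) :
  (#|[pred lo : {ffun 'I_d -> 'I_K.+1} | window_type R T0 D0 lo == tau]| <= K.+1 ^ free_axes tau)%N.
Proof.
pose F (i : 'I_d) : {pred 'I_K.+1} := match tau i with
  | None => predT | Some false => pred1 ord0
  | Some true => [pred k : 'I_K.+1 | (k + window_side R T0 D0)%N == K.+1] end.
apply: (@leq_trans #|(family F : {pred {ffun 'I_d -> 'I_K.+1}})|).
  apply: subset_leq_card; apply/fintype.subsetP => lo; rewrite inE => /eqP lt.
  apply/familyP => i; have : tau i = window_type R T0 D0 lo i by rewrite lt.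
  rewrite ffunE /F /coordinate => ->; case: eqP => [l0|_]; first by apply/eqP/val_inj.
  by case: eqP => // l1; rewrite inE l1.
rewrite card_family foldrE big_image /= /free_axes -prod_nat_const [X in (_ <= X)%N]big_mkcond /=.
apply: leq_prod => i _; rewrite inE /F; case: (tau i) => [[]|] /=.
- rewrite -[X in (_ <= X)%N](subSnn (K.+1 - window_side R T0 D0)); apply: card_ordinal_le => k.
  by rewrite inE => /eqP; lia.
- by rewrite card1.
- by rewrite card_ord.
Qed.

(** [C] is finite, so there are only countably many families of counts, and the event is a countable
    union of joint events whatever [E] is. *)
Lemma measurable_of_counts (dT : measure_display) (T : measurableType dT)
    (C : finType) (N : C -> T -> nat) (E : (C -> nat) -> Prop) :
  (forall c U, measurable [set w | U (N c w)]) -> measurable [set w | E (fun c => N c w)].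
Proof.
move=> mN; pose F (n : nat) : set T := if (choice.unpickle n : option {ffun C -> nat}) is Some f then
  (if pselect (E f) then joint_event N (fun c => [set f c]) else set0) else set0.
rewrite (_ : [set w | _] = \bigcup_n F n).
  apply: bigcupT_measurable => n; rewrite /F; case: choice.unpickle => // f.
  by case: (pselect (E f)) => [Ef|nEf] /=; [exact: measurable_joint_event|].
apply/seteqP; split=> w /=.
  move=> Ew; exists (choice.pickle [ffun c => N c w]) => //; rewrite /F choice.pickleK.
  have fE : [ffun c => N c w] = (fun c => N c w) :> (C -> nat) by apply/funext => c; rewrite ffunE.
  by case: (pselect _) => [Ef|nEf] /=; [move=> c; rewrite /= ffunE|apply: nEf; rewrite fE].
case=> n _; rewrite /F; case: choice.unpickle => // f; case: (pselect (E f)) => [Ef|nEf] //= jw.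
by rewrite (_ : (fun c => N c w) = f) //; apply/funext => c; exact: jw.
Qed.

Section CellProbabilities.
Context (R : realType) (dT : measure_display) (T : measurableType dT).
Variables (P : probability T R) (p : \bar R) (d h K : nat).
Local Notation cell := {ffun 'I_d -> 'I_K.+1}.
Variable N : cell -> T -> nat.
Local Notation pr := (prob P).
Hypothesis d_ge2 : (2 <= d)%N.
Hypothesis hp : (1 <= p)%E.
Hypothesis mN : forall c U, measurable [set w | U (N c w)].
Hypothesis indep : forall U : cell -> set nat,
  pr (joint_event N U) = \prod_c pr [set w | U c (N c w)].
Local Notation D := (window d h).
Local Notation win := (in_window (grid_range d h) (window_excess d h) (separation d h)).
Local Notation wtype := (window_type (grid_range d h) (window_excess d h) (separation d h)).
Local Notation valid := (valid_window (grid_range d h) (window_excess d h) (separation d h)).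
Local Notation outc := (@outer_count R p d h).

Variable q : R.
Hypothesis q_le1 : q <= 1.
Hypothesis q_bound : forall c, pr [set w | (N c w < fullness d h)%N] <= q.

Lemma prob_all_sparse (S : {set cell}) :
  pr (joint_event N (fun c => [set n | (c \in S) ==> (n < fullness d h)%N])) <= q ^+ #|S|.
Proof.
rewrite indep (bigID (fun c => c \in S)) /= [X in _ * X]big1 ?mulr1; last first.
  move=> c /negbTE cS; rewrite (_ : [set w | _] = setT) ?prob_setT //.
  by apply/seteqP; split=> // w _ /=; rewrite cS.
rewrite -prodr_const; apply: ler_prod => c cS; rewrite prob_ge0 /=.
rewrite (_ : [set w | _] = [set w | (N c w < fullness d h)%N]) //.
by apply/seteqP; split=> w /=; rewrite cS.
Qed.

(** A union bound over a window and a set of at least [outc tau + 2] of its cells, all sparse; a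
    window has at most [2 ^ (D ^ d)] such sets. *)
Lemma prob_many_sparse :
  pr [set w | ~ few_sparse_cells p h (fun c => N c w)] <=
  \sum_(tau : position_type d) K.+1%:R ^+ free_axes tau * (2 ^ (D ^ d))%:R * q ^+ (outc tau + 2).
Proof.
have q0 : 0 <= q by apply: le_trans (q_bound [ffun=> ord0]); exact: prob_ge0.
pose bad (x : cell * {set cell}) := [&& valid x.1, x.2 \subset [pred c | win x.1 c] &
  (outc (wtype x.1) + 2 <= #|x.2|)%N].
pose s := [seq x <- enum {: cell * {set cell}} | bad x].
pose E (x : cell * {set cell}) := joint_event N (fun c => [set n | (c \in x.2) ==> (n < fullness d h)%N]).
have mE x : measurable (E x) by exact: measurable_joint_event.
apply: (@le_trans _ _ (pr (some_event s E))).
  apply: prob_mono.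
  - exact: (@measurable_of_counts _ _ _ N (fun f => ~ few_sparse_cells p h f)).
  - exact: measurable_some_event.
  move=> w /= nfew; apply: contrapT => nE; apply: nfew => lo vlo.
  rewrite leqNgt; apply/negP => many; apply: nE.
  pose B := [set c in [pred c | win lo c && (N c w < fullness d h)%N]]%SET.
  exists (lo, B).
    rewrite mem_filter mem_enum andbT /bad /= vlo cardsE addnS many andbT /=.
    by apply/fintype.subsetP => c; rewrite !inE => /andP[].
  move=> c /=; apply/implyP; rewrite !inE => /andP[_] //.
apply: le_trans (prob_some_event _ _ mE) _.
have E_le x : x \in s -> pr (E x) <= q ^+ (outc (wtype x.1) + 2).
  rewrite mem_filter => /andP[/and3P[_ _ c2] _].
  by apply: le_trans (prob_all_sparse _) _; exact: ler_wiXn2l.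
apply: (@le_trans _ _ (\sum_(x <- s) q ^+ (outc (wtype x.1) + 2))).
  by rewrite big_seq [X in _ <= X]big_seq; exact: ler_sum.
rewrite big_filter big_enum_cond /=.
have -> : \sum_(x | bad x) q ^+ (outc (wtype x.1) + 2) =
    \sum_(lo : cell) \sum_(S : {set cell} | bad (lo, S)) q ^+ (outc (wtype lo) + 2).
  by rewrite pair_big_dep /=; apply: eq_bigl => -[].
apply: (@le_trans _ _ (\sum_(lo : cell) (2 ^ (D ^ d))%:R * q ^+ (outc (wtype lo) + 2))).
  apply: ler_sum => lo _; rewrite sumr_const -[X in X <= _]mulr_natl ler_wpM2r ?exprn_ge0 // ler_nat.
  apply: (@leq_trans #|powerset [set c | win lo c]%SET|).
    apply: subset_leq_card; apply/fintype.subsetP => S /and3P[_ Sw _].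
    by rewrite powersetE; apply/fintype.subsetP => c /(fintype.subsetP Sw); rewrite !inE.
  rewrite card_powerset leq_exp2l // cardsE.
  by apply: card_window; exact: ltnW.
rewrite (partition_big (fun lo : cell => wtype lo) xpredT) //=.
apply: ler_sum => tau _.
rewrite (eq_bigr (fun=> (2 ^ (D ^ d))%:R * q ^+ (outc tau + 2))); last by move=> lo /eqP ->.
rewrite sumr_const -[X in X <= _]mulr_natl -[X in _ <= X]mulrA ler_wpM2r ?mulr_ge0 ?exprn_ge0 //.
by rewrite -natrX ler_nat; exact: card_window_type.
Qed.

End CellProbabilities.

(** * Many independent chances for an isolated cell near one face *)

Section IsolatedCell.
Context (R : realType) (dT : measure_display) (T : measurableType dT).
Variables (P : probability T R) (p : \bar R) (d h K : nat).
Local Notation cell := {ffun 'I_d -> 'I_K.+1}.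
Variable N : cell -> T -> nat.
Local Notation pr := (prob P).
Hypothesis hp : (1 <= p)%E.
Hypothesis mN : forall c U, measurable [set w | U (N c w)].
Hypothesis indep : forall U : cell -> set nat,
  pr (joint_event N U) = \prod_c pr [set w | U c (N c w)].
Local Notation outc := (@outer_count R p d h).
Variable p0 : R.
Hypothesis p0_empty : forall c, pr [set w | N c w = 0%N] = p0.
Variables (tau : position_type d) (m : nat).
Local Notation G := (grid_range d h).
Local Notation O := (@outer_adjacent R p d (grid_radius d h)).
Hypothesis mK : (m.+1 * G.*2.+1 <= K.+1)%N.
Local Notation J := {ffun 'I_d -> 'I_m.+1}.

(** Spacing [2 G + 1] along the free axes keeps the outer neighbourhoods of different trials
    disjoint. *)
Definition trial_cell (t : J) : cell := lattice_point K (fun i => match tau i with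
  | None => G + coordinate t i * G.*2.+1 | Some false => 0 | Some true => K end)%N.

Lemma trial_cellE t i : coordinate (trial_cell t) i = match tau i with
  | None => G + coordinate t i * G.*2.+1 | Some false => 0 | Some true => K end%N.
Proof.
apply: coordinate_lattice_point; case: (tau i) => [[]|] //.
have ti := coordinate_lt t i; have : (coordinate t i * G.*2.+1 + G.*2.+1 <= m.+1 * G.*2.+1)%N.
  by rewrite -mulSnr leq_mul2r ti orbT.
by move: mK; clear; lia.
Qed.

(** Indices are frozen at 0 along the other axes, where [trial_cell] does not depend on them. *)
Definition trials : {pred J} := family (fun i => if tau i == None then predT else pred1 ord0).

Lemma card_trials : #|trials| = (m.+1 ^ free_axes tau)%N.
Proof.
rewrite /trials card_family foldrE big_image /= /free_axes -prod_nat_const [RHS]big_mkcond /=.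
apply: eq_bigr => i _; rewrite inE; case: (tau i == None); last by rewrite card1.
by rewrite card_ord.
Qed.

Lemma card_outer_neighbors t : (#|[pred c | O (cell_dist (trial_cell t) c)]| <= outc tau)%N.
Proof.
have Ob := @outer_bound R p d (grid_radius d h) hp.
pose f (c : cell) : {ffun 'I_d -> 'I_G.*2.+1} := lattice_point G.*2
  (fun i => cell_shape_center G tau i + coordinate c i - coordinate (trial_cell t) i)%N.
have fE c i : c \in [pred c | O (cell_dist (trial_cell t) c)] ->
    coordinate (f c) i = (cell_shape_center G tau i + coordinate c i - coordinate (trial_cell t) i)%N /\
    (coordinate (trial_cell t) i <= cell_shape_center G tau i + coordinate c i)%N.
  move=> Oc; have := Ob _ i (Oc : O _); rewrite -/G /cell_dist /absdiff => b0.
  have ck := coordinate_lt c i; split; [apply: coordinate_lattice_point|];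
  move: b0 ck; rewrite trial_cellE /cell_shape_center; case: (tau i) => [[]|]; clear; lia.
apply: (@leq_card_inj _ _ f) => [c c' cO c'O fcc'|c cO].
  apply: coordinate_inj => i; have := congr1 (fun g => coordinate g i) fcc'.
  by have [-> h1] := fE c i cO; have [-> h2] := fE c' i c'O; move: h1 h2; clear; lia.
rewrite inE; apply: (outer_anti hp) (cO : O _) => i; have [-> h1] := fE c i cO.
by rewrite /cell_dist /absdiff; move: h1; clear; lia.
Qed.

Definition trial_set (t : J) (c : cell) : set nat :=
  if c == trial_cell t then [set n | (0 < n)%N]
  else if O (cell_dist (trial_cell t) c) then [set 0%N] else setT.

Lemma trial_support t c : trial_set t c = setT \/
  forall i, (absdiff (coordinate (trial_cell t) i) (coordinate c i) <= G)%N.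
Proof.
rewrite /trial_set; case: eqP => [->|_]; first by right=> i; rewrite /absdiff; lia.
case: ifP => [Oc|_]; [right=> i|by left].
exact: (@outer_bound R p d (grid_radius d h) hp) Oc.
Qed.

Lemma trials_disjoint t t' c : t \in trials -> t' \in trials -> t != t' ->
  trial_set t c = setT \/ trial_set t' c = setT.
Proof.
move=> /familyP tT /familyP tT' tt'.
have [|s1] := trial_support t c; first by left.
have [|s2] := trial_support t' c; first by right.
exfalso; move/negP: tt'; apply; apply/eqP; apply: coordinate_inj => i.
have := tT i; have := tT' i; have := s1 i; have := s2 i.
rewrite !trial_cellE; case: (eqVneq (tau i) None) => [->|_] b1 b2.
  move=> _ _; move: b1 b2; rewrite /absdiff.
  move: (coordinate t i) (coordinate t' i) (coordinate c i) G => a b u g; clear => h1 h2.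
  case: (ltngtP a b) => // ab; exfalso.
    have : (a * g.*2.+1 + g.*2.+1 <= b * g.*2.+1)%N by rewrite -mulSnr leq_mul2r ab orbT.
    by move: h1 h2; move: (a * _)%N (b * _)%N => x y; lia.
  have : (b * g.*2.+1 + g.*2.+1 <= a * g.*2.+1)%N by rewrite -mulSnr leq_mul2r ab orbT.
  by move: h1 h2; move: (a * _)%N (b * _)%N => x y; lia.
by rewrite !inE /coordinate => /eqP -> /eqP ->.
Qed.

Hypothesis p0_bound : 0 <= p0 <= 1.

(** The exponent also counts the trial cell itself, which only lowers the bound since [p0 <= 1]. *)
Lemma prob_trial t : (1 - p0) * p0 ^+ outc tau <= pr (joint_event N (trial_set t)).
Proof.
have /andP[p00 p01] := p0_bound.
rewrite indep (bigD1 (trial_cell t)) //= {1}/trial_set eqxx.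
have -> : pr [set w | [set n | (0 < n)%N] (N (trial_cell t) w)] = 1 - p0.
  rewrite -(p0_empty (trial_cell t)) -prob_setC //; first last.
    exact: (mN (trial_cell t) [set 0%N]).
  congr (pr _); apply/seteqP; split=> w /=; first by move=> + w0; rewrite w0.
  by move=> w0; rewrite lt0n; apply/eqP.
rewrite ler_wpM2l ?subr_ge0 //.
rewrite (bigID (fun c => O (cell_dist (trial_cell t) c))) /= [X in _ <= _ * X]big1; last first.
  move=> c /andP[/negbTE ct /negbTE cO]; rewrite /trial_set ct cO.
  by rewrite (_ : [set w | _] = setT) ?prob_setT //; apply/seteqP.
rewrite mulr1 (eq_bigr (fun=> p0)); last first.
  by move=> c /andP[/negbTE ct cO]; rewrite /trial_set ct cO -[RHS](p0_empty c).
rewrite prodr_const; apply: ler_wiXn2l => //.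
apply: leq_trans (card_outer_neighbors t); apply: subset_leq_card.
by apply/fintype.subsetP => c; rewrite !inE => /andP[].
Qed.

Lemma prob_no_isolated :
  pr [set w | ~ has_isolated_cell p h (fun c => N c w)] <=
  expR (- (m.+1%:R ^+ free_axes tau * ((1 - p0) * p0 ^+ outc tau))).
Proof.
set x := (1 - p0) * p0 ^+ outc tau.
pose U := trial_set; pose s := enum trials.
have sP t : (t \in s) = (t \in trials) by rewrite mem_enum.
have T0 : joint_event N (fun=> setT) = setT by apply/seteqP.
have := @trials_fail _ _ _ P cell N mN indep J s U (fun=> setT) (enum_uniq _).
rewrite T0 setIT prob_setT mulr1 => /(_ _ _)/= E.
apply: (@le_trans _ _ (\prod_(t <- s) (1 - pr (joint_event N (U t))))).
  rewrite -E; last 2 first.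
  - by move=> t t' c; rewrite !sP => tT tT'; exact: trials_disjoint.
  - by move=> *; right.
  apply: prob_mono.
  - exact: (@measurable_of_counts _ _ _ N (fun f => ~ has_isolated_cell p h f)).
  - rewrite (_ : [set w | _] = ~` some_event s (fun t => joint_event N (U t))).
      by apply/measurableC/measurable_some_event => t; exact: measurable_joint_event.
    by apply/seteqP; split=> w /= hw; [move=> [t ts]; exact: hw | move=> t ts Ut; apply: hw; exists t].
  move=> w /= nis t ts Ut; apply: nis; exists (trial_cell t); split.
    by have := Ut (trial_cell t); rewrite /U /trial_set eqxx.
  by move=> c ct Oc; have := Ut c; rewrite /U /trial_set (negbTE ct) Oc.
apply: (@le_trans _ _ (\prod_(t <- s) expR (- x))).
  apply: ler_prod => t _; rewrite subr_ge0 prob_le1 /=; last exact: measurable_joint_event.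
  apply: le_trans (expR_ge1Dx _); rewrite lerD2l lerN2; exact: prob_trial.
rewrite big_const_seq count_predT iter_mulr mulr1 -cardE card_trials -expRM_natl mulrN natrX.
by rewrite lexx.
Qed.

End IsolatedCell.

(** * Asymptotics *)

Section Asymptotics.
Variable R : realType.
Implicit Types t lam mu eps : R.

Lemma expR_dominates (A : R) (B : nat) : 0 <= A ->
  exists2 t0 : R, 1 <= t0 & forall t, t0 <= t -> A * t ^+ B <= expR t.
Proof.
move=> A0; exists (1 + A * (B.+1)`!%:R); first by rewrite lerDl mulr_ge0.
move=> t t0; have f0 : 0 < (B.+1)`!%:R :> R by rewrite ltr0n fact_gt0.
have tpos : 0 <= t by apply: le_trans t0; rewrite addr_ge0 // mulr_ge0.
apply: le_trans (_ : t ^+ B.+1 / (B.+1)`!%:R <= _); last first.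
  by apply: le_trans (expR_ge1Dxn B tpos); rewrite lerDr.
rewrite ler_pdivlMr // exprS mulrAC ler_wpM2r ?exprn_ge0 //.
by apply: le_trans t0; rewrite lerDr.
Qed.

(** As [f i * mu <= o i + 1], the factor [C ^ f i] is at most [exp ((o i + 1) lam)]. Against
    [o i + 2] factors [exp (- lam)] this leaves [exp (- lam)] times a power of [lam]. *)
Lemma window_sum_small (I : finType) (f o : I -> nat) (mu A : R) (M Tmax : nat) eps :
  0 <= A -> (0 < M)%N -> (forall i, (o i <= Tmax)%N) ->
  (forall i, (f i)%:R * mu <= (o i).+1%:R) -> 0 < eps ->
  exists2 lam0 : R, 1 <= lam0 & forall lam C, lam0 <= lam -> 0 <= C -> C <= expR (mu * lam) ->
    \sum_(i : I) C ^+ f i * A * (M%:R * lam ^+ M * expR (- lam)) ^+ (o i + 2) <= eps.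
Proof.
move=> A0 M0 oT fo eps0.
pose A' := #|I|%:R * (A * M%:R ^+ (Tmax + 2)) / eps.
have A'0 : 0 <= A' by rewrite !mulr_ge0 ?exprn_ge0 ?invr_ge0 // ltW.
have [lam0 lam01 domin] := expR_dominates (M * (Tmax + 2)) A'0.
exists lam0 => // lam C lam0l C0 Ce; have lam1 : 1 <= lam by exact: le_trans lam01 lam0l.
have lampos : 0 <= lam by exact: le_trans lam1.
pose X := M%:R * lam ^+ M.
have X1 : 1 <= X by rewrite mulr_ege1 ?exprn_ege1 // ler1n.
have term i : C ^+ f i * A * (X * expR (- lam)) ^+ (o i + 2) <=
    A * X ^+ (Tmax + 2) * expR (- lam).
  have c1 : C ^+ f i <= expR ((o i).+1%:R * lam).
    apply: (@le_trans _ _ (expR (mu * lam) ^+ f i)); first by rewrite lerXn2r ?nnegrE ?expR_ge0.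
    rewrite -expRM_natl ler_expR mulrA; exact: ler_wpM2r.
  rewrite exprMn -expRM_natl -mulrA mulrCA -[X in _ <= X]mulrA.
  apply: ler_wpM2l => //.
  rewrite mulrCA; apply: (@le_trans _ _ (X ^+ (o i + 2) * (expR ((o i).+1%:R * lam) * expR ((o i + 2)%:R * - lam)))).
    rewrite ler_wpM2l ?exprn_ge0 //; first exact: le_trans X1.
    by rewrite ler_wpM2r ?expR_ge0.
  rewrite -expRD (_ : _ + _ = - lam); last by rewrite natrD -natr1; ring.
  by rewrite ler_wpM2r ?expR_ge0 // ler_weXn2l // leq_add2r.
apply: (@le_trans _ _ (\sum_(i : I) A * X ^+ (Tmax + 2) * expR (- lam))).
  by apply: ler_sum => i _; exact: term.
rewrite sumr_const -[X in X <= _]mulr_natl.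
have := domin lam lam0l; rewrite /A' -(ler_pM2r (expR_gt0 (- lam))) -expRD subrr expR0.
move=> h; rewrite -[X in _ <= X]mulr1 -(ler_pdivrMl _ _ eps0); apply: le_trans h.
rewrite /X exprMn -exprM le_eqVlt; apply/orP; left; apply/eqP; ring.
Qed.

(** As [f * mu = o + 1], the expected number of successes is at least [exp lam] up to constants and
    the power [lam ^ f], so it exceeds [1 / eps]. *)
Lemma isolated_term_small (f o : nat) (mu W : R) eps :
  f%:R * mu = o.+1%:R -> 0 < W -> 0 < eps ->
  exists2 lam0 : R, 1 <= lam0 & forall lam C m, lam0 <= lam -> 0 <= C ->
    expR (mu * (lam - 1)) <= lam * C -> C <= W * m ->
    expR (- (m ^+ f * ((1 - expR (- lam)) * expR (- lam) ^+ o))) <= eps.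
Proof.
move=> fmu W0 eps0.
pose Y := expR (o.+1%:R) * W ^+ f * (eps^-1 * 2).
have Y0 : 0 <= Y by rewrite !mulr_ge0 ?expR_ge0 ?exprn_ge0 ?invr_ge0 // ltW.
have [lam0 lam01 domin] := expR_dominates f Y0.
exists lam0 => // lam C m lam0l C0 eC CW; have lam1 : 1 <= lam by exact: le_trans lam01 lam0l.
have lampos : 0 < lam by exact: lt_le_trans lam1.
have m0 : 0 <= m by rewrite -(pmulr_rge0 _ W0); exact: le_trans CW.
have half : 2^-1 <= 1 - expR (- lam).
  have := expR_ge1Dx lam; have e0 := expR_gt0 lam => h2.
  have : 2 <= expR lam by lra.
  rewrite expRN => h3; have : (expR lam)^-1 <= 2^-1 by rewrite lef_pV2 ?posrE.
  by lra.
have key : eps^-1 <= m ^+ f * ((1 - expR (- lam)) * expR (- lam) ^+ o).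
  have h1 : expR (mu * (lam - 1)) ^+ f <= (lam * (W * m)) ^+ f.
    have e1 : expR (mu * (lam - 1)) <= lam * (W * m) by apply: le_trans eC _; rewrite ler_pM2l.
    apply: lerXn2r e1; rewrite nnegrE ?expR_ge0 //.
    by rewrite mulr_ge0 ?mulr_ge0 ?(ltW lampos) ?(ltW W0).
  rewrite -expRM_natl mulrA fmu !exprMn in h1.
  have h2 := domin lam lam0l.
  have lf : 0 < lam ^+ f by rewrite exprn_gt0.
  have wf : 0 < W ^+ f by rewrite exprn_gt0.
  have eo : 0 < expR (- lam) ^+ o by rewrite exprn_gt0 // expR_gt0.
  apply: (@le_trans _ _ (m ^+ f * (2^-1 * expR (- lam) ^+ o))); last first.
    by rewrite ler_wpM2l ?exprn_ge0 // ler_wpM2r // ltW.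
  have h3 : expR (- o.+1%:R) * expR (o.+1%:R * lam) <= lam ^+ f * (W ^+ f * m ^+ f).
    by apply: le_trans h1; rewrite -expRD ler_expR; lra.
  have h4 : expR (- o.+1%:R) * expR lam <= lam ^+ f * (W ^+ f * m ^+ f) * expR (- lam) ^+ o.
    rewrite -expRM_natl; have := ler_wpM2r (expR_ge0 (o%:R * - lam)) h3.
    apply: le_trans; rewrite le_eqVlt; apply/orP; left; apply/eqP.
    by rewrite -mulrA -[X in _ = _ * X]expRD; congr (_ * expR _); rewrite -natr1; ring.
  have h5 : expR (- o.+1%:R) * (Y * lam ^+ f) <= lam ^+ f * (W ^+ f * m ^+ f) * expR (- lam) ^+ o.
    by apply: le_trans h4; rewrite ler_wpM2l ?expR_ge0.
  have h6 : expR (- o.+1%:R) * (Y * lam ^+ f) = (lam ^+ f * W ^+ f) * (eps^-1 * 2).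
    rewrite /Y; rewrite (_ : expR (- o.+1%:R) * _ =
      (expR (- o.+1%:R) * expR o.+1%:R) * ((lam ^+ f * W ^+ f) * (eps^-1 * 2))); last by ring.
    by rewrite -expRD addNr expR0 mul1r.
  rewrite h6 (_ : lam ^+ f * (W ^+ f * m ^+ f) * expR (- lam) ^+ o =
    (lam ^+ f * W ^+ f) * (m ^+ f * expR (- lam) ^+ o)) in h5; last by ring.
  rewrite ler_pM2l ?mulr_gt0 // in h5.
  by rewrite mulrCA mulrC ler_pdivlMr.
(* It remains to use [exp (- x) <= 1 / x] at [x = 1 / eps]. *)
apply: le_trans (_ : expR (- eps^-1) <= _); first by rewrite ler_expR lerN2.
rewrite expRN -[X in _ <= X]invrK lef_pV2 ?posrE ?expR_gt0 ?invr_gt0 //.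
by apply: le_trans (expR_ge1Dx _); rewrite lerDr.
Qed.

Lemma expD1_le (x : R) n : 0 <= x <= 1 -> (1 + x) ^+ n <= 1 + 3 ^+ n * x.
Proof.
move=> /andP[x0 x1]; elim: n => [|n IH]; first by rewrite !expr0 mul1r lerDl.
rewrite exprSr; apply: le_trans (_ : (1 + 3 ^+ n * x) * (1 + x) <= _).
  by rewrite ler_wpM2r // addr_ge0.
have e1 : 1 <= 3 ^+ n :> R by rewrite exprn_ege1 // ler1n.
rewrite exprS; move: (3 ^+ n) e1 => y y1.
have : y * x * x <= y * x by rewrite ler_piMr // mulr_ge0 //; lra.
have : x <= y * x by rewrite ler_peMl.
lra.
Qed.

(* The mesh for which [lam := n / C ^ d] is about [ln n / (d * mu)], that is,
   [expR (mu * lam)] is about [C]. *)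
Definition mesh_count (d : nat) (mu : R) (n : nat) : nat :=
  Num.truncn ((n%:R / (ln n%:R / (d%:R * mu))) `^ d%:R^-1).

(** For [L := ln n / (d mu)] one has [exp (d mu L) = n], and rounding down to [C] raises [lam] from
    [L] to at most [L + 1]. Both exponential bounds are then compared in [d]-th powers through
    [n = lam * C ^ d]. *)
Lemma mesh_count_spec (d : nat) (mu : R) (lam0 : R) (B : nat) : (0 < d)%N -> 0 < mu ->
  exists n0 : nat, forall n, (n0 <= n)%N ->
    let C := mesh_count d mu n in let lam := n%:R / C%:R ^+ d in
    [/\ (B <= C)%N, lam0 <= lam, C%:R <= expR (mu * lam) & expR (mu * (lam - 1)) <= lam * C%:R].
Proof.
move=> d0 mu0; have dR : 0 < d%:R :> R by rewrite ltr0n.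
have dmu : 0 < d%:R * mu by rewrite mulr_gt0.
pose c1 := (d%:R * mu)^-1; have c10 : 0 < c1 by rewrite invr_gt0.
pose A := c1 * (3 ^+ d * c1 + B%:R + 2) ^+ d.
have A0 : 0 <= A by rewrite mulr_ge0 ?exprn_ge0 ?addr_ge0 ?mulr_ge0 ?exprn_ge0 // ltW.
have [t0 t01 domin] := expR_dominates d.+1 A0.
pose t1 := t0 + d%:R * mu * (`|lam0| + 1).
exists (Num.truncn (expR t1)).+1 => n nn0 C lam.
have n_ge : expR t1 <= n%:R by apply: ltW; apply: lt_le_trans (truncnS_gt _) _; rewrite ler_nat.
have npos : 0 < n%:R :> R by apply: lt_le_trans n_ge; exact: expR_gt0.
pose t := ln (n%:R : R); have en : expR t = n%:R by rewrite /t lnK.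
have t1t : t1 <= t by rewrite -ler_expR en.
have t0t : t0 <= t by apply: le_trans t1t; rewrite lerDl mulr_ge0 ?ltW //; rewrite ltr_wpDl.
have t_ge1 : 1 <= t by exact: le_trans t0t.
have tpos : 0 < t by exact: lt_le_trans t_ge1.
pose L := t * c1; have Lpos : 0 < L by rewrite mulr_gt0.
have L_ge : `|lam0| + 1 <= L.
  rewrite /L /c1 ler_pdivlMr // mulrC; apply: le_trans t1t; rewrite lerDr; lra.
have L1 : 1 <= L by apply: le_trans L_ge; rewrite lerDr.
have y0 : 0 <= (n%:R / L) `^ d%:R^-1 by exact: powR_ge0.
have yd : ((n%:R / L) `^ d%:R^-1) ^+ d = n%:R / L.
  rewrite -powR_mulrn // -powRrM mulVf ?gt_eqF // powRr1 //.
  by rewrite divr_ge0 // ltW.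
have /andP[Cy yC] : C%:R <= (n%:R / L) `^ d%:R^-1 < C.+1%:R := truncn_itv y0.
have C_up : C%:R ^+ d <= n%:R / L by rewrite -yd ler_pXn2r ?nnegrE.
have C_lo : n%:R / L < C.+1%:R ^+ d by rewrite -yd ltr_pXn2r ?nnegrE.
have l30 : 0 <= 3 ^+ d * L by rewrite pmulr_rge0 ?exprn_gt0 // ltW.
have c30 : 0 <= 3 ^+ d * c1 by rewrite pmulr_rge0 ?exprn_gt0 // ltW.
have B0 : 0 <= B%:R :> R by [].
(* The cost of rounding is [L (1 + 1 / C) ^ d - L], at most [3 ^ d L / C], so [C] has to dominate
   [3 ^ d L]. *)
have C_big : 3 ^+ d * L + B%:R + 1 <= C%:R.
  rewrite leNgt; apply/negP => Cs; move: C_lo; apply/negP; rewrite -leNgt.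
  apply: (@le_trans _ _ ((3 ^+ d * L + B%:R + 2) ^+ d)).
    have s1 : C.+1%:R = C%:R + 1 :> R by rewrite natr1.
    by rewrite ler_pXn2r ?nnegrE // ?s1; lra.
  rewrite ler_pdivlMr // -en; apply: le_trans (domin t t0t).
  rewrite /A /L exprS [X in X <= _]mulrC.
  rewrite (_ : c1 * _ * (t * t ^+ d) = (t * c1) * ((3 ^+ d * c1 + B%:R + 2) * t) ^+ d); last first.
    by rewrite exprMn; ring.
  rewrite ler_pM2l //.
  have tB : B%:R <= B%:R * t by rewrite ler_peMr.
  have base0 : 0 <= (3 ^+ d * c1 + B%:R + 2) * t by rewrite mulr_ge0 ?(ltW tpos) //; lra.
  have l30' : 0 <= 3 ^+ d * (t * c1) := l30.
  rewrite ler_pXn2r ?nnegrE //; lra.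
have C1 : 1 <= C%:R :> R by lra.
have Cpos : 0 < C%:R :> R by lra.
have Cd : 0 < C%:R ^+ d :> R by rewrite exprn_gt0.
have lamC : lam * C%:R ^+ d = n%:R by rewrite /lam divfK // gt_eqF.
have L_lam : L <= lam by rewrite /lam ler_pdivlMr // mulrC -ler_pdivlMr.
have lam1 : 1 <= lam by exact: le_trans L_lam.
have enL : expR (d%:R * (mu * L)) = n%:R.
  rewrite -en; congr expR; rewrite /L /c1 mulrA mulrC -mulrA mulVf ?mulr1 //.
  by rewrite gt_eqF.
split.
- by rewrite -(ler_nat R); lra.
- by apply: le_trans L_lam; apply: le_trans L_ge; have := ler_norm lam0; lra.
- rewrite -(@ler_pXn2r _ d) ?nnegrE ?expR_ge0 // -expRM_natl.
  apply: (@le_trans _ _ n%:R).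
    by rewrite -lamC ler_peMl // ltW.
  by rewrite -enL ler_expR !ler_pM2l.
- have lamL : lam <= L + 1.
    have x1 : 0 <= (C%:R^-1 : R) <= 1 by rewrite invr_ge0 ltW //= invf_le1.
    have h1 := expD1_le d x1.
    have h2 : lam <= L * (1 + C%:R^-1) ^+ d.
      rewrite /lam ler_pdivrMr // -mulrA -exprMn mulrDl mul1r mulVf ?gt_eqF //.
      by rewrite natr1 mulrC -ler_pdivrMr // ltW.
    apply: le_trans h2 _; apply: le_trans (ler_wpM2l (ltW Lpos) h1) _.
    rewrite mulrDr mulr1 lerD2l mulrA ler_pdivrMr // mul1r mulrC; lra.
  have lampos : 0 <= lam by exact: le_trans lam1.
  rewrite -(@ler_pXn2r _ d) ?nnegrE ?expR_ge0 ?mulr_ge0 // -expRM_natl.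
  apply: (@le_trans _ _ n%:R).
    by rewrite -enL ler_expR !ler_pM2l //; lra.
  rewrite -lamC exprMn ler_wpM2r ?exprn_ge0 //.
  by apply: ler_eXnr.
Qed.

End Asymptotics.

(** * Measurability of graph events *)

Definition iso_invariant (Q : graph_property) := forall (T T' : finType) (e : rel T) (e' : rel T')
  (f : T -> T'), bijective f -> (forall x y, e' (f x) (f y) = e x y) -> Q T e -> Q T' e'.

Definition monotone_property (Q : graph_property) := forall (T : finType) (e e' : rel T),
  (forall x y, e x y -> e' x y) -> Q T e -> Q T e'.

Lemma hamilton_monotone : monotone_property has_hamilton_cycle.
Proof.
move=> T e e' ee' [c [/andP[ce uc] c2 cov]]; exists c; split=> //.
apply/andP; split=> //; case: c ce {uc c2 cov} => //= x s.
exact: sub_path.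
Qed.

Lemma two_connected_monotone : monotone_property (k_connected 2).
Proof.
move=> T e e' ee' [T2 conn]; split=> // S S2 x y xS yS.
by apply: connect_mono (conn S S2 x y xS yS) => u v /= /and3P[-> -> /ee' ->].
Qed.

Lemma connect_map (T T' : finType) (e : rel T) (e' : rel T') (f : T -> T') x y :
  (forall u v, e u v -> e' (f u) (f v)) -> connect e x y -> connect e' (f x) (f y).
Proof.
move=> ee' /connectP[p]; elim: p x => [|z p IH] x /=; first by move=> _ ->; exact: connect0.
move=> /andP[exz pz] yl; apply: connect_trans (IH z pz yl).
exact/connect1/ee'.
Qed.

Lemma hamilton_iso : iso_invariant has_hamilton_cycle.
Proof.
move=> T T' e e' f fb ee' [c [/andP[ce uc] c2 cov]]; exists (map f c); split.
- rewrite /ucycle (map_inj_uniq (bij_inj fb)) uc andbT.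
  rewrite cycle_map; case: c ce {uc c2 cov} => //= x s.
  by apply: sub_path => u v /=; rewrite ee'.
- by rewrite size_map.
- by move=> y; case: fb => g fg gf; rewrite -(gf y) map_f.
Qed.

Lemma two_connected_iso : iso_invariant (k_connected 2).
Proof.
move=> T T' e e' f fb ee' [T2 conn]; split; first by rewrite -(bij_eq_card fb).
move=> S S2 x y; have [g fg gf] := fb; rewrite -(gf x) -(gf y) => xS yS.
pose S0 := [set g z | z in S]%SET.
have memS0 u : (u \in S0) = (f u \in S).
  apply/imsetP/idP => [[z zS ->]|fu]; first by rewrite gf.
  by exists (f u).
have S02 : (#|S0| < 2)%N by apply: leq_ltn_trans (leq_imset_card _ _) S2.
apply: (connect_map (f := f)) (conn S0 S02 (g x) (g y) _ _); rewrite ?memS0 // => u v /=.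
by rewrite !memS0 ee'.
Qed.

(** * Recovering the graph from the occupied cells of a fine mesh *)

Section CellGraph.
Variables (R : realType) (p : \bar R) (d : nat).
Hypothesis hp : (1 <= p)%E.

(** Distances are replaced by lower bounds between cells, which makes the graph a function of the
    set of occupied cells. *)
Definition cell_graph K (s r : R) (O : {set {ffun 'I_d -> 'I_K.+1}}) : rel {c | c \in O} :=
  fun c c' => (c != c') &&
    (pnorm p (fun i => s * (cell_dist (val c) (val c') i).-1%:R) <= r).

Variable a : R.
Hypothesis a_gt0 : 0 < a.
Local Notation mesh K := (a / K.+1%:R).

Lemma mesh_gt0 K : 0 < mesh K. Proof. by rewrite divr_gt0. Qed.

Lemma mesh_small (eps : R) : 0 < eps -> exists K0, forall K, (K0 <= K)%N -> mesh K < eps.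
Proof.
move=> e0; exists (Num.truncn (a / eps)) => K KK.
rewrite ltr_pdivrMr // mulrC -ltr_pdivrMr //.
by apply: lt_le_trans (truncnS_gt _) _; rewrite ler_nat ltnS.
Qed.

Definition in_cube (x : real_space R d) := forall i, 0 <= (tnth x i : R) <= a.

Lemma in_cube_mesh K x : in_cube x -> forall i, 0 <= (tnth x i : R) <= K.+1%:R * mesh K.
Proof. by move=> xc i; rewrite mulrC divfK ?pnatr_eq0. Qed.

Lemma cells_separate (x y : real_space R d) : in_cube x -> in_cube y -> x != y ->
  exists K0, forall K, (K0 <= K)%N -> cell_of K (mesh K) x != cell_of K (mesh K) y.
Proof.
move=> xc yc xy.
have [i xyi] : exists i, (tnth x i : R) != tnth y i.
  apply/existsP; apply: contraNT xy => /existsPn xy; apply/eqP/eq_from_tnth => i.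
  by apply/eqP; rewrite -[_ == _]negbK.
have v0 : 0 < `|(tnth x i : R) - tnth y i| by rewrite normr_gt0 subr_eq0.
have [K0 K0P] := mesh_small v0; exists K0 => K /K0P mK.
apply: contraTneq mK => cc; rewrite -leNgt.
have := coord_dist_le (mesh_gt0 K) (in_cube_mesh K xc) (in_cube_mesh K yc) i.
by rewrite cc /cell_dist /absdiff subnn mulr1.
Qed.

(** The cell distance never exceeds the true one, which settles [pdist p x y <= r] on every mesh.
    Otherwise a fine mesh recovers each coordinate difference up to a factor [1 - eta], and
    monotonicity and homogeneity carry this over to the norm. *)
Lemma cells_detect_distance (x y : real_space R d) (r : R) : in_cube x -> in_cube y -> 0 <= r ->
  exists K0, forall K, (K0 <= K)%N ->
    (pnorm p (fun i => mesh K * (cell_dist (cell_of K (mesh K) x) (cell_of K (mesh K) y) i).-1%:R) <= r)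
    = (pdist p x y <= r).
Proof.
move=> xc yc r0.
have below K : pnorm p (fun i => mesh K *
    (cell_dist (cell_of K (mesh K) x) (cell_of K (mesh K) y) i).-1%:R) <= pdist p x y.
  apply: pnorm_mono => // i; rewrite ger0_norm; last by rewrite pmulr_rge0 ?mesh_gt0.
  exact: (coord_dist_ge (mesh_gt0 K) (in_cube_mesh K xc) (in_cube_mesh K yc)).
case: (boolP (pdist p x y <= r)) => [xyr|]; last rewrite -ltNge => xyr.
  by exists 0%N => K _; exact: (le_trans (below K) xyr).
have dpos : 0 < pdist p x y by exact: le_lt_trans xyr.
pose v i : R := `|(tnth x i : R) - tnth y i|.
(* Chosen so that [(1 - eta) * pdist p x y] is midway between [r] and the distance. *)
pose eta : R := (pdist p x y - r) / (2 * pdist p x y).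
have eta0 : 0 < eta by rewrite divr_gt0 ?subr_gt0 ?mulr_gt0.
have eta1 : eta <= 1 by rewrite /eta ler_pdivrMr ?mulr_gt0 //; lra.
have each i : exists K0, forall K, (K0 <= K)%N ->
    (1 - eta) * v i <= mesh K * (cell_dist (cell_of K (mesh K) x) (cell_of K (mesh K) y) i).-1%:R.
  have [vi0|vi0] := eqVneq (v i) 0.
    by exists 0%N => K _; rewrite vi0 mulr0 pmulr_rge0 ?mesh_gt0.
  have vpos : 0 < v i by rewrite lt_def vi0 normr_ge0.
  have ev0 : 0 < eta * v i / 2 by rewrite divr_gt0 // mulr_gt0.
  have [K0 K0P] := mesh_small ev0.
  exists K0 => K /K0P mK.
  have h := coord_dist_le (mesh_gt0 K) (in_cube_mesh K xc) (in_cube_mesh K yc) i.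
  have n1 (n : nat) : n.+1%:R <= n.-1%:R + 2 :> R.
    by rewrite -natrD ler_nat; lia.
  have h2 := ler_wpM2l (ltW (mesh_gt0 K)) (n1 (cell_dist (cell_of K (mesh K) x) (cell_of K (mesh K) y) i)).
  have := le_trans h h2; rewrite -/(v i) mulrDr; move: mK.
  by move: ((cell_dist _ _ i).-1%:R) => D1; move: (mesh K) => m; lra.
have [k kP] := fin_all_exists each.
exists (\max_i k i)%N => K KK; apply/negbTE; rewrite -ltNge.
apply: (@lt_le_trans _ _ ((1 - eta) * pdist p x y)).
  have -> : (1 - eta) * pdist p x y = pdist p x y - (pdist p x y - r) / 2.
    by rewrite /eta; field; rewrite gt_eqF.
  lra.
have e1 : 0 <= 1 - eta by lra.
rewrite /pdist -(pnorm_scale hp _ e1); apply: pnorm_mono => // i.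
rewrite normrM (ger0_norm e1) [X in _ <= X]ger0_norm; last first.
  by rewrite pmulr_rge0 ?mesh_gt0.
by apply: kP; apply: leq_trans KK; exact: leq_bigmax.
Qed.

Variable X : {fset real_space R d}.
Hypothesis X_cube : forall x, x \in X -> in_cube x.

Definition occupied K : {set {ffun 'I_d -> 'I_K.+1}} :=
  [set c | (0 < @fiber_count R d K (mesh K) X c)%N]%SET.

Lemma cell_occupied K (x : X) : cell_of K (mesh K) (val x) \in occupied K.
Proof. by rewrite inE; apply/card_gt0P; exists x; rewrite inE. Qed.

Lemma cell_graph_iso (r : R) : 0 <= r -> exists K0, forall K, (K0 <= K)%N ->
  exists2 f : X -> {c | c \in occupied K}, bijective f &
    forall x y, cell_graph (mesh K) r (f x) (f y) = geometric_graph p r x y.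
Proof.
move=> r0.
have each (xy : X * X) : exists K0, forall K, (K0 <= K)%N ->
    (xy.1 != xy.2 -> cell_of K (mesh K) (val xy.1) != cell_of K (mesh K) (val xy.2)) /\
    (pnorm p (fun i => mesh K * (cell_dist (cell_of K (mesh K) (val xy.1))
        (cell_of K (mesh K) (val xy.2)) i).-1%:R) <= r) = (pdist p (val xy.1) (val xy.2) <= r).
  case: xy => x y /=.
  have xc := X_cube (valP x); have yc := X_cube (valP y).
  have [K1 K1P] := cells_detect_distance xc yc r0.
  have [xy|xy] := eqVneq x y.
    by exists K1 => K KK; split; [rewrite xy ?eqxx | exact: K1P].
  have [K2 K2P] := cells_separate xc yc xy.
  exists (maxn K1 K2) => K; rewrite geq_max => /andP[KK1 KK2].
  by split=> [_|]; [exact: K2P | exact: K1P].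
have [k kP] := fin_all_exists each.
exists (\max_xy k xy)%N => K KK.
have good (x y : X) : _ := kP (x, y) K (leq_trans (leq_bigmax (x, y)) KK).
pose f (x : X) : {c | c \in occupied K} := exist (fun c => is_true (c \in occupied K)) _ (cell_occupied K x).
have f_inj : injective f.
  move=> x y /(congr1 val)/= fxy; apply/eqP/negPn/negP => xy.
  by have [/(_ xy)/eqP + _] := good x y; apply.
exists f.
  have f_surj c : exists x, f x = c.
    case: c => c cO; have := cO; rewrite inE => /card_gt0P[x /eqP xc].
    by exists x; apply/val_inj.
  have [g gP] := fin_all_exists f_surj; exists g => // x; apply: f_inj; exact: gP.
move=> x y; rewrite /cell_graph /geometric_graph (inj_eq f_inj).
by have [_ /= ->] := good x y.
Qed.

End CellGraph.

Section MeasurableProperty.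
Context (R : realType) (dT : measure_display) (T : measurableType dT).
Variables (p : \bar R) (d : nat) (a : R) (X : T -> {fset real_space R d}).
Hypothesis hp : (1 <= p)%E.
Hypothesis a_gt0 : 0 < a.
Hypothesis X_cube : forall w x, x \in X w -> in_cube a x.
Hypothesis mX : forall K (c : {ffun 'I_d -> 'I_K.+1}) (U : set nat),
  measurable [set w | U (fiber_count (a / K.+1%:R) (X w) c)].

(** The cell graph is eventually isomorphic to the geometric graph, so the event is a lower limit,
    over the meshes, of events decided by cell counts. *)
Lemma measurable_property (Q : graph_property) (r : R) : iso_invariant Q -> 0 <= r ->
  measurable [set w | Q (X w) (geometric_graph p (X := X w) r)].
Proof.
move=> Qiso r0.
pose E K := [set w | Q _ (cell_graph p (a / K.+1%:R) r (O := occupied a (X w) K))].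
have mE K : measurable (E K).
  pose F (f : {ffun 'I_d -> 'I_K.+1} -> nat) :=
    Q _ (cell_graph p (a / K.+1%:R) r (O := [set c | (0 < f c)%N]%SET)).
  exact: (@measurable_of_counts _ _ _ (fun c w => fiber_count (a / K.+1%:R) (X w) c) F).
rewrite (_ : [set w | _] = \bigcup_K0 \bigcap_(K in [set K | (K0 <= K)%N]) E K).
  by apply: bigcupT_measurable => K0; apply: bigcap_measurableType => K _.
apply/seteqP; split=> w /=.
  move=> Qw; have [K0 K0P] := cell_graph_iso hp a_gt0 (@X_cube w) r0.
  exists K0 => // K /= /K0P[f fb fe]; exact: Qiso fb fe Qw.
case=> K1 _ K1P; have [K0 K0P] := cell_graph_iso hp a_gt0 (@X_cube w) r0.
have [f fb fe] := K0P _ (leq_maxl K0 K1).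
have QK : E (maxn K0 K1) w by apply: K1P; exact: leq_maxr.
have [g fg gf] := fb; apply: (Qiso _ _ _ _ g _ _ QK); first by exists f.
by move=> x y; rewrite -fe !gf.
Qed.

End MeasurableProperty.

(** * Hitting radii and rational radii *)

Section HittingRadius.
Variables (R : realType) (p : \bar R) (d : nat).
Hypothesis hp : (1 <= p)%E.
Variable X : {fset real_space R d}.
Local Notation G r := (geometric_graph p (X := X) r).

(** The graph at radius [t] has the edges of the graph at the largest candidate up to [t], a
    candidate being 0, coded by [None], or a distance between two points. The minimum is thus over a
    finite set. *)
Lemma hitting_radius_attained (Q : graph_property) (s : R) : monotone_property Q ->
  0 <= s -> Q X (G s) ->
  exists r, [/\ 0 <= r, Q X (G r), r <= s & forall s', 0 <= s' -> Q X (G s') -> r <= s'].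
Proof.
move=> Qm s0 Qs.
pose val_ (o : option (X * X)) : R := if o is Some xy then pdist p (val xy.1) (val xy.2) else 0.
have val0 o : 0 <= val_ o by case: o => //= xy; exact: pnorm_ge0.
have cand t : 0 <= t -> Q X (G t) -> exists2 o, val_ o <= t & Q X (G (val_ o)).
  move=> t0 Qt; have P0 : val_ None <= t by [].
  case: (@Order.TotalTheory.arg_maxP _ _ _ None (fun o => val_ o <= t) val_ P0) => o ot omax.
  exists o => //; apply: Qm Qt => x y /andP[xy xyt]; rewrite /geometric_graph xy.
  exact: (omax (Some (x, y))).
have [c1 _ Q1] := cand s s0 Qs.
have P1 : `[< Q X (G (val_ c1)) >] by apply/asboolP.
case: (@Order.TotalTheory.arg_minP _ _ _ c1 (fun o => `[< Q X (G (val_ o)) >]) val_ P1) => o /asboolP Qo omin.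
have min_ t : 0 <= t -> Q X (G t) -> val_ o <= t.
  by move=> t0 Qt; have [c2 c2t Qc2] := cand t t0 Qt; apply: le_trans c2t; apply: omin; apply/asboolP.
by exists (val_ o); split=> //; exact: min_.
Qed.

Lemma hitting_radius_fin (Q : graph_property) (s : R) : monotone_property Q -> 0 <= s -> Q X (G s) ->
  exists r, [/\ hitting_radius p Q X = r%:E, Q X (G r), 0 <= r & r <= s].
Proof.
move=> Qm s0 Qs; have [r [r0 Qr rs rmin]] := hitting_radius_attained Qm s0 Qs.
rewrite /hitting_radius; case: xgetP => [y _ [r' [r'0 Qr' r'min] <-]|none].
  by exists r'; split=> //; exact: r'min.
by exfalso; apply: (none r%:E); exists r.
Qed.

Lemma hitting_radius_of_fin (Q : graph_property) (r : R) :
  hitting_radius p Q X = r%:E -> 0 <= r /\ Q X (G r).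
Proof. by rewrite /hitting_radius; case: xgetP => // y _ [r' [r'0 Qr' _] <-] [<-]. Qed.

(** Edges are given by a non-strict inequality, so the graph is constant on some interval to the
    right of [r]. *)
Lemma geometric_graph_rational (r : R) : 0 <= r ->
  exists2 q : rat, 0 <= ratr q :> R & forall x y, G (ratr q) x y = G r x y.
Proof.
move=> r0.
have each (xy : X * X) : exists e : R, 0 < e /\ forall t, r <= t < r + e ->
    (pdist p (val xy.1) (val xy.2) <= t) = (pdist p (val xy.1) (val xy.2) <= r).
  move: (pdist p _ _) => D; case: (boolP (D <= r)) => [Dr|].
    by exists 1; split=> // t /andP[rt _]; exact: (le_trans Dr rt).
  rewrite -ltNge => rD; exists (D - r); split; first by rewrite subr_gt0.
  move=> t /andP[rt tD]; apply/negbTE; rewrite -ltNge; move: tD; lra.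
have [e eP] := fin_all_exists each.
pose eps : R := \big[Num.min/1]_xy e xy.
have eps0 : 0 < eps by apply/bigmin_gtP; split=> // xy _; have [] := eP xy.
have re : r < r + eps by rewrite ltrDl.
have [q] := rat_in_itvoo re; rewrite in_itv /= => /andP[rq qe].
exists q; first by rewrite (le_trans r0) // ltW.
move=> x y; rewrite /geometric_graph; congr (_ && _).
have [_ h] := eP (x, y); apply: h; rewrite (ltW rq) /=; apply: lt_le_trans qe _.
by rewrite lerD2l; exact: bigmin_le.
Qed.

(** A monotone property holds from its hitting radius on. The reduction to rational radii leaves
    countably many conditions, as measurability requires. *)
Lemma hitting_radius_eqP (Q Q' : graph_property) : monotone_property Q -> monotone_property Q' ->
  hitting_radius p Q X = hitting_radius p Q' X <->
  forall q : rat, 0 <= ratr q :> R -> Q X (G (ratr q)) <-> Q' X (G (ratr q)).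
Proof.
move=> Qm Qm'; split=> [QQ'|QQ']; last first.
  apply: eq_hitting_radius => r r0; have [q q0 qE] := geometric_graph_rational r0.
  split=> h.
    by apply: (Qm' X (G (ratr q))) => [x y|]; [rewrite qE | apply/QQ' => //; apply: Qm h => x y; rewrite qE].
  by apply: (Qm X (G (ratr q))) => [x y|]; [rewrite qE | apply/QQ' => //; apply: Qm' h => x y; rewrite qE].
have step (Q1 Q2 : graph_property) (q : rat) : monotone_property Q1 -> monotone_property Q2 ->
    hitting_radius p Q1 X = hitting_radius p Q2 X -> 0 <= ratr q :> R ->
    Q1 X (G (ratr q)) -> Q2 X (G (ratr q)).
  move=> m1 m2 QE q0 h; have [r [rE _ _ rq]] := hitting_radius_fin m1 q0 h.
  rewrite QE in rE; have [_ Q2r] := hitting_radius_of_fin rE.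
  apply: m2 Q2r => x y; rewrite /geometric_graph => /andP[-> xyr].
  exact: le_trans xyr rq.
by move=> q q0; split; apply: step.
Qed.

End HittingRadius.

(** * Counts in the cells *)

Lemma volume_set0 (R : realType) d : volume (set0 : set (real_space R d)) = 0%E.
Proof.
elim: d => [|d IH] /=; first by rewrite indic0.
by rewrite integral0_eq // => x _; rewrite (_ : [set t | _] = set0) // -subset0.
Qed.

Lemma volume_box (R : realType) d (A : 'I_d -> set R) (l : R) : 0 <= l ->
  (forall i, measurable (A i)) -> (forall i, lebesgue_measure (A i) = l%:E) ->
  volume ([set x | forall i, A i (tnth x i)] : set (real_space R d)) = (l ^+ d)%:E.
Proof.
move=> l0; elim: d A => [|d IH] A mA lA /=.
  by rewrite indicE mem_set ?expr0 // => -[].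
transitivity (\int[@lebesgue_measure R]_x ((l ^+ d)%:E * (\1_(A ord0) x)%:E))%E.
  apply: eq_integral => x _; rewrite indicE.
  have [xA|xA] := boolP (x \in A ord0).
    rewrite mule1 -(IH (fun i => A (lift ord0 i))) //; congr volume.
    apply/seteqP; split=> t /= h i; first by have := h (lift ord0 i); rewrite tnthS.
    case: (unliftP ord0 i) => [j ->|->]; first by rewrite tnthS; exact: h.
    by rewrite tnth0; exact: set_mem.
  rewrite mule0 -(volume_set0 R d); congr volume.
  rewrite -subset0 => t /= /(_ ord0); rewrite tnth0 => xA'.
  by move/negP: xA; apply; exact: mem_set.
rewrite ge0_integralZl_EFin //; last 2 first.
- by apply/measurable_EFinP; exact: (measurable_indic (mA ord0)).
- exact: exprn_ge0.
rewrite integral_indic; [|exact: measurableT|exact: mA].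
by rewrite exprSr EFinM -(lA ord0); congr (_ * lebesgue_measure _)%E; exact: setIT.
Qed.

Section Boxes.
Variables (R : realType) (K : nat) (s : R).
Hypothesis s_gt0 : 0 < s.

(** The last interval is closed, in accordance with the minimum with [K] in [cell_of]; the intervals
    for [k <= K] partition the closed side of the cube. *)
Definition mesh_interval (k : nat) : set R :=
  if (k < K)%N then `[k%:R * s, k.+1%:R * s[%classic else `[K%:R * s, K.+1%:R * s]%classic.

Lemma measurable_mesh_interval k : measurable (mesh_interval k).
Proof. by rewrite /mesh_interval; case: ifP => _; exact: measurable_itv. Qed.

Lemma lebesgue_mesh_interval k : lebesgue_measure (mesh_interval k) = s%:E.
Proof.
have lt_s (j : nat) : j%:R * s < j.+1%:R * s by rewrite ltr_pM2r // ltr_nat.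
have sE (j : nat) : j.+1%:R * s - j%:R * s = s by rewrite -mulrBl -natr1 addrAC subrr add0r mul1r.
rewrite /mesh_interval; case: ifP => _; rewrite lebesgue_measure_itv /= lte_fin lt_s.
  by rewrite -EFinB sE.
by rewrite -EFinB sE.
Qed.

Lemma mesh_intervalP (k : nat) (u : R) : (k <= K)%N ->
  mesh_interval k u <-> 0 <= u <= K.+1%:R * s /\ minn (Num.truncn (u / s)) K = k.
Proof.
move=> kK; rewrite /mesh_interval; split.
  case: ltnP => [kK'|Kk].
    rewrite /= in_itv /= => /andP[ku uk].
    have u0 : 0 <= u by apply: le_trans ku; rewrite mulr_ge0 // ltW.
    split.
      rewrite u0; apply: le_trans (ltW uk) _.
      by rewrite ler_pM2r // ler_nat; exact: leq_trans kK' _.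
    have -> : Num.truncn (u / s) = k.
      by apply: truncn_def; rewrite ler_pdivlMr // ltr_pdivrMr // ku uk.
    by apply/minn_idPl.
  rewrite /= in_itv /= => /andP[ku uk].
  have u0 : 0 <= u by apply: le_trans ku; rewrite mulr_ge0 // ltW.
  rewrite u0 uk; split=> //; have -> : k = K by apply/eqP; rewrite eqn_leq kK Kk.
  apply/minn_idPr; rewrite truncn_ge_nat ?divr_ge0 // ?ler_pdivlMr //; exact: ltW.
move=> [/andP[u0 uK]]; have y0 : 0 <= u / s by rewrite divr_ge0 // ltW.
have /andP[t1 t2] := truncn_itv y0; rewrite ler_pdivlMr // in t1; rewrite ltr_pdivrMr // in t2.
case: (ltnP k K) => [kK' mk|Kk mk]; rewrite /= in_itv /=.
  have tk : Num.truncn (u / s) = k by move: mk; rewrite /minn; case: ltnP => // _ Kk; rewrite Kk ltnn in kK'.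
  by rewrite -tk t1 t2.
rewrite uK andbT; apply: le_trans t1; rewrite ler_pM2r // ler_nat.
by apply: leq_trans Kk _; rewrite -mk geq_minl.
Qed.

End Boxes.

Section CellSet.
Variables (R : realType) (d K : nat) (s : R).
Hypothesis s_gt0 : 0 < s.
Local Notation cell := {ffun 'I_d -> 'I_K.+1}.

Definition cell_set (c : cell) : set (real_space R d) :=
  [set x | forall i, mesh_interval K s (coordinate c i) (tnth x i)].

Lemma measurable_cell_set c : measurable (cell_set c).
Proof.
rewrite (_ : cell_set c = \bigcap_(i in [set: 'I_d])
    ((fun x : real_space R d => tnth x i) @^-1` mesh_interval K s (coordinate c i))).
  apply: fin_bigcap_measurable => [|i _]; first exact: finite_finset.
  rewrite -[X in measurable X]setTI.
  by apply: (measurable_tnth i) => //; exact: measurable_mesh_interval.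
by apply/seteqP; split=> x /= xc i; [move=> _; exact: xc | exact: (xc i I)].
Qed.

Lemma volume_cell_set c : volume (cell_set c) = (s ^+ d)%:E.
Proof.
apply: (volume_box (A := fun i => mesh_interval K s (coordinate c i))) => [|i|i].
- exact: ltW.
- exact: measurable_mesh_interval.
- exact: lebesgue_mesh_interval.
Qed.

Lemma cell_setP c x : cell_set c x <->
  (forall i, 0 <= (tnth x i : R) <= K.+1%:R * s) /\ cell_of K s x = c.
Proof.
have le_K i : (coordinate c i <= K)%N by rewrite -ltnS coordinate_lt.
split=> [xc|[xb xc] i]; last first.
  by apply/mesh_intervalP => //; split=> //; rewrite -coordinate_cell_of xc.
split=> [i|]; first by have /mesh_intervalP[] := xc i.
apply: coordinate_inj => i; rewrite coordinate_cell_of.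
by have /mesh_intervalP[] := xc i.
Qed.

Lemma trivIset_cell_set : trivIset [set: cell] cell_set.
Proof. by move=> c c' _ _ [x [/cell_setP[_ <-] /cell_setP[_ <-]]]. Qed.

Lemma count_in_cell_set (X : {fset real_space R d}) c :
  (forall x, x \in X -> forall i, 0 <= (tnth x i : R) <= K.+1%:R * s) ->
  count_in X (cell_set c) = fiber_count s X c.
Proof.
move=> X_cube; rewrite /count_in /fiber_count -sum1_size -[RHS]sum1_card.
rewrite -big_fset_condE big_seq_fsetE; apply: eq_bigl => x; rewrite inE /=.
apply/idP/eqP => [/set_mem/cell_setP[//]|xc].
by apply/mem_set/cell_setP; split=> //; apply: X_cube; exact: valP.
Qed.

End CellSet.

(** * The law of the cell counts *)

Section PoissonCells.
Context (R : realType) (dT : measure_display) (T : measurableType dT).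
Variables (P : probability T R) (d n K : nat) (X : T -> {fset real_space R d}).
Hypothesis d_gt0 : (0 < d)%N.
Hypothesis n_gt0 : (0 < n)%N.
Hypothesis hX : poisson_process P (@cube R d n) X.
Local Notation cell := {ffun 'I_d -> 'I_K.+1}.
Local Notation a := (n%:R `^ d%:R^-1 : R).
Local Notation s := (a / K.+1%:R).
Local Notation lam := (n%:R / K.+1%:R ^+ d : R).

Lemma cube_side_gt0 : 0 < a.
Proof. by rewrite powR_gt0 // ltr0n. Qed.

Lemma poisson_in_cube w x : x \in X w -> in_cube a x.
Proof. by move=> xX; exact: (poisson_process_sub hX (w := w) xX). Qed.

Lemma mesh_pos : 0 < s.
Proof. by rewrite divr_gt0 // cube_side_gt0. Qed.

Lemma mesh_volume : s ^+ d = lam.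
Proof.
rewrite expr_div_n -(powR_mulrn d (ltW cube_side_gt0)) -powRrM mulVf ?powRr1 //.
by rewrite pnatr_eq0 -lt0n.
Qed.

Lemma intensity_gt0 : 0 < lam.
Proof. by rewrite -mesh_volume exprn_gt0 // mesh_pos. Qed.

Lemma count_in_cell w (c : cell) : count_in (X w) (cell_set s c) = fiber_count s (X w) c.
Proof.
apply: count_in_cell_set; first exact: mesh_pos.
by move=> x xX; apply: in_cube_mesh; exact: poisson_in_cube xX.
Qed.

Lemma cell_set_cube (c : cell) : cell_set s c `<=` cube n.
Proof.
move=> x /(cell_setP mesh_pos)[xc _] i.
by have := xc i; rewrite (mulrC K.+1%:R) divfK ?pnatr_eq0.
Qed.

Lemma measurable_cell_count (c : cell) (U : set nat) :
  measurable [set w | U (fiber_count s (X w) c)].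
Proof.
have := poisson_process_measurable hX (measurable_cell_set s c) (@cell_set_cube c).
move=> /(_ measurableT U)/(_ I); rewrite setTI.
by congr measurable; apply/seteqP; split=> w /=; rewrite count_in_cell.
Qed.

Lemma cell_count_law (c : cell) (U : set nat) :
  P [set w | U (fiber_count s (X w) c)] = poisson_prob lam 0 U.
Proof.
have := poisson_process_law hX (measurable_cell_set s c) (@cell_set_cube c) U.
rewrite volume_cell_set ?mesh_pos //= mesh_volume => <-.
by congr (P _); apply/seteqP; split=> w /=; rewrite count_in_cell.
Qed.

Lemma prob_cell_count (c : cell) k :
  prob P [set w | fiber_count s (X w) c = k] = lam ^+ k / k`!%:R * expR (- lam).
Proof.
rewrite /prob (cell_count_law c [set k]) /poisson_prob intensity_gt0.
by rewrite esum_set1 ?lee_fin ?poisson_pmf_ge0 // /poisson_pmf intensity_gt0.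
Qed.

Lemma prob_cell_empty (c : cell) :
  prob P [set w | fiber_count s (X w) c = 0%N] = expR (- lam).
Proof. by rewrite prob_cell_count expr0 fact0 divr1 mul1r. Qed.

(** Each of the [M] terms [lam ^ k / k!] is at most [lam ^ M], as [1 <= lam]. *)
Lemma prob_cell_sparse (c : cell) M : 1 <= lam ->
  prob P [set w | (fiber_count s (X w) c < M)%N] <= M%:R * lam ^+ M * expR (- lam).
Proof.
move=> lam1; pose E k := [set w | fiber_count s (X w) c = k].
have mE k : measurable (E k) by exact: (measurable_cell_count c [set k]).
rewrite (_ : [set w | _] = some_event (iota 0 M) E); last first.
  apply/seteqP; split=> w /=; first by move=> wM; exists (fiber_count s (X w) c); rewrite ?mem_iota.
  by case=> k; rewrite mem_iota /= add0n => kM ->.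
apply: le_trans (prob_some_event P (iota 0 M) mE) _.
apply: (@le_trans _ _ (\sum_(k <- iota 0 M) lam ^+ M * expR (- lam))); last first.
  by rewrite big_const_seq count_predT size_iota iter_addr_0 -[X in _ <= X]mulrA [X in _ <= X]mulr_natl.
rewrite big_seq [X in _ <= X]big_seq; apply: ler_sum => k; rewrite mem_iota /= add0n => kM.
rewrite prob_cell_count ler_wpM2r ?expR_ge0 //.
apply: (@le_trans _ _ (lam ^+ k)); last by rewrite ler_weXn2l // ltnW.
rewrite ler_pdivrMr ?ltr0n ?fact_gt0 // ler_peMr ?exprn_ge0 ?(ltW intensity_gt0) //.
by rewrite ler1n fact_gt0.
Qed.

Lemma cell_counts_independent (U : cell -> set nat) :
  prob P (joint_event (fun c w => fiber_count s (X w) c) U) =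
  \prod_c prob P [set w | U c (fiber_count s (X w) c)].
Proof.
pose B (i : 'I_#|cell|) := cell_set s (enum_val i).
have := @poisson_process_independent _ _ _ _ _ _ _ hX _ B.
move=> /(_ (fun i => measurable_cell_set s (enum_val i)))/(_ (fun i => @cell_set_cube (enum_val i))).
have tB : trivIset [set: 'I_#|cell|] B.
  move=> i j _ _ ij; apply: enum_val_inj; exact: (trivIset_cell_set mesh_pos).
move=> /(_ tB (fun i => U (enum_val i))) E.
apply: EFin_inj; rewrite -probE; last first.
  by apply: measurable_joint_event => c V; exact: measurable_cell_count.
rewrite -prodEFin (eq_bigr (fun c => P [set w | U c (fiber_count s (X w) c)])); last first.
  by move=> c _; rewrite probE //; exact: measurable_cell_count.
rewrite (_ : joint_event _ _ = \bigcap_(i in [set: 'I_#|cell|])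
    ((fun w => count_in (X w) (B i)) @^-1` U (enum_val i))); last first.
  apply/seteqP; split=> w /= h; first by move=> i _; rewrite /= count_in_cell.
  by move=> c; have := h (enum_rank c) I; rewrite /= count_in_cell enum_rankK.
rewrite E [RHS](reindex _ (onW_bij _ (enum_val_bij _))) /=; apply: eq_bigr => i _.
by congr (P _); apply/seteqP; split=> w /=; rewrite count_in_cell.
Qed.

End PoissonCells.

(** The minimum ranges over the types with a free axis; at corners the inequality is trivial. *)
Lemma critical_rate_exists (R : realType) d (o : position_type d -> nat) : (0 < d)%N ->
  exists mu : R, [/\ 0 < mu, forall tau, (free_axes tau)%:R * mu <= (o tau).+1%:R &
    exists tau, (free_axes tau)%:R * mu = (o tau).+1%:R].
Proof.
move=> d0; pose ratio tau : R := (o tau).+1%:R / (free_axes tau)%:R.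
pose tau0 : position_type d := [ffun=> None].
have free0 : (0 < free_axes tau0)%N.
  apply/card_gt0P; exists (Ordinal d0); by rewrite inE ffunE.
case: (@Order.TotalTheory.arg_minP _ _ _ tau0 (fun tau => 0 < free_axes tau)%N ratio free0) => tau taup taumin.
have taup' : 0 < (free_axes tau)%:R :> R by rewrite ltr0n.
exists (ratio tau); split; first by rewrite divr_gt0 // ltr0n.
  move=> tau'; have [->|tau'p] := posnP (free_axes tau'); first by rewrite mul0r.
  by rewrite mulrC -ler_pdivlMr ?ltr0n //; exact: taumin.
by exists tau; rewrite mulrC divfK // gt_eqF.
Qed.

(** * The event that the hitting radii agree, and its probability *)

Section HittingEvent.
Context (R : realType) (dT : measure_display) (T : measurableType dT).
Variables (P : probability T R) (p : \bar R) (d n : nat) (X : T -> {fset real_space R d}).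
Hypothesis d_ge2 : (2 <= d)%N.
Hypothesis hp : (1 <= p)%E.
Hypothesis n_gt0 : (0 < n)%N.
Hypothesis hX : poisson_process P (@cube R d n) X.
Local Notation a := (n%:R `^ d%:R^-1 : R).

Definition same_hitting_radius : set T :=
  [set w | hitting_radius p (k_connected 2) (X w) = hitting_radius p has_hamilton_cycle (X w)].

Lemma measurable_same_hitting_radius : measurable same_hitting_radius.
Proof.
pose E (Q : graph_property) (q : rat) : set T := [set w | Q (X w) (geometric_graph p (X := X w) (ratr q))].
have mE Q q : iso_invariant Q -> 0 <= ratr q :> R -> measurable (E Q q).
  move=> Qiso q0; apply: (measurable_property (a := a)) => // [|w x|K c U].
  - exact: cube_side_gt0.
  - exact: (poisson_in_cube hX).
  - exact: (measurable_cell_count n_gt0 hX).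
pose F q := if 0 <= ratr q :> R then
  (E (k_connected 2) q `&` E has_hamilton_cycle q) `|`
  (~` E (k_connected 2) q `&` ~` E has_hamilton_cycle q) else setT.
rewrite (_ : same_hitting_radius = ~` \bigcup_q ~` F q).
  apply/measurableC/bigcupT_measurable_rat => q; apply: measurableC; rewrite /F.
  case: ifP => // q0; have m1 := mE _ q two_connected_iso q0; have m2 := mE _ q hamilton_iso q0.
  by apply: measurableU; apply: measurableI => //; exact: measurableC.
rewrite setC_bigcup; apply/seteqP; split=> w.
  move=> /(hitting_radius_eqP hp _ two_connected_monotone hamilton_monotone) h q _.
  rewrite setCK /F; case: ifP => // /(h q) hh.
  case: (pselect (E (k_connected 2) q w)) => [e|ne]; first by left; split=> //; apply/hh.
  by right; split=> //; apply: contra_not ne => /hh.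
move=> h; apply/(hitting_radius_eqP hp _ two_connected_monotone hamilton_monotone) => q q0.
by have := h q I; rewrite setCK /F q0 => -[[]|[]].
Qed.

Lemma prob_same_hitting_radius h K : (0 < h)%N ->
  ((5 * d + 1) * (d * h.*2.+1).+1.*2.+1 ^ d.-1 + 1 < h ^ d)%N -> (window d h <= K)%N ->
  1 - (prob P [set w | ~ few_sparse_cells p h (fiber_count (K := K) (a / K.+1%:R) (X w))] +
       prob P [set w | ~ has_isolated_cell p h (fiber_count (K := K) (a / K.+1%:R) (X w))])
  <= prob P same_hitting_radius.
Proof.
move=> h0 hl wK.
pose N c w := fiber_count (K := K) (a / K.+1%:R) (X w) c.
set A := [set w | ~ few_sparse_cells _ _ _]; set B := [set w | ~ has_isolated_cell _ _ _].
have mN c U : measurable [set w | U (N c w)] by exact: (measurable_cell_count n_gt0 hX).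
have mA : measurable A by exact: (measurable_of_counts (fun f => ~ few_sparse_cells p h f) mN).
have mB : measurable B by exact: (measurable_of_counts (fun f => ~ has_isolated_cell p h f) mN).
have mAB : measurable (A `|` B) by exact: measurableU.
apply: (@le_trans _ _ (prob P (~` (A `|` B)))).
  by rewrite prob_setC // lerD2l lerN2; exact: prob_setU.
apply: prob_mono; [exact: measurableC|exact: measurable_same_hitting_radius|].
move=> w /not_orP[/contrapT few /contrapT isol]; apply: eq_hitting_radius => r r0.
apply: (two_connected_iff_hamilton hp d_ge2 _ h0 hl wK) few isol r0.
  exact: mesh_pos.
by move=> x xX; apply: in_cube_mesh; exact: (poisson_in_cube hX xX).
Qed.

End HittingEvent.

Lemma same_hitting_radius_likely (R : realType) d (p : \bar R) (eps : R) : (2 <= d)%N -> (1 <= p)%E ->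
  0 < eps -> exists2 n0 : nat, (0 < n0)%N & forall n, (n0 <= n)%N ->
  forall (dT : measure_display) (T : measurableType dT) (P : probability T R)
    (X : T -> {fset real_space R d}), poisson_process P (@cube R d n) X ->
  1 - eps <= prob P (same_hitting_radius p X).
Proof.
move=> d2 hp eps0; have d0 : (0 < d)%N by exact: ltnW.
have [h h0 hl] := exists_fine_scale d2.
pose o := @outer_count R p d h.
have [mu [mu0 fo [tau tauE]]] := critical_rate_exists R o d0.
pose A : R := (2 ^ (window d h ^ d))%:R.
have [lam1 lam11 sparse_small] := @window_sum_small R _ (@free_axes d) o mu A (fullness d h)
  (\max_tau o tau)%N (eps / 2) (ler0n _ _) ltac:(by rewrite /fullness addn1)
  (fun tau => leq_bigmax tau) fo ltac:(by rewrite divr_gt0).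
(* Of [K + 1] cells in a row, the integer part of [(K + 1) / g] serve as trials, at least
   [(K + 1) / (2 g)]; this is the constant [W]. *)
pose g := (grid_range d h).*2.+1; pose W : R := (2 * g)%:R.
have W0 : 0 < W by rewrite ltr0n.
have [lam2 lam21 isolated_small] := @isolated_term_small R (free_axes tau) (o tau) mu W (eps / 2)
  tauE W0 ltac:(by rewrite divr_gt0).
have [lam3 lam31 exp_large] := @expR_dominates R (fullness d h)%:R (fullness d h) (ler0n _ _).
(* Each of the three thresholds is at least 1, so their sum is above all of them. *)
have [n0 n0P] := mesh_count_spec (lam1 + lam2 + lam3) (window d h + g).+1 d0 mu0.
exists n0.+1 => // n nn0 dT T P X hX; have n_gt0 : (0 < n)%N by exact: leq_trans nn0.
have := n0P n (ltnW nn0); case: (mesh_count d mu n) => [|K] /=; first by case.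
pose lam : R := n%:R / K.+1%:R ^+ d; rewrite -/lam => -[BC lam0 Clam lamC].
have l1 : lam1 <= lam by lra.
have l2 : lam2 <= lam by lra.
have l3 : lam3 <= lam by lra.
have lam_ge1 : 1 <= lam by lra.
have wK : (window d h <= K)%N by move: BC; clear; lia.
apply: le_trans (prob_same_hitting_radius d2 hp n_gt0 hX h0 hl wK).
pose N c w := fiber_count (K := K) (n%:R `^ d%:R^-1 / K.+1%:R) (X w) c.
have mN c U : measurable [set w | U (N c w)] by exact: (measurable_cell_count n_gt0 hX).
have indep U : prob P (joint_event N U) = \prod_c prob P [set w | U c (N c w)].
  by have := cell_counts_independent n_gt0 hX U.
rewrite lerD2l lerN2 [leRHS](splitr eps); apply: lerD.
  apply: le_trans (sparse_small lam K.+1%:R l1 (ler0n _ _) Clam).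
  apply: (@prob_many_sparse _ _ _ _ p _ _ _ N) => // [|c].
  - rewrite expRN ler_pdivrMr ?expR_gt0 // mul1r; exact: exp_large.
  - by apply: (prob_cell_sparse d0 n_gt0 hX).
pose m := (K.+1 %/ g).-1.
have mE : m.+1 = (K.+1 %/ g)%N by rewrite prednK // divn_gt0 //; move: BC; clear; lia.
have Wm : K.+1%:R <= W * m.+1%:R.
  rewrite -natrM ler_nat mE; have := ltn_ceil K.+1 (isT : (0 < g)%N).
  have : (0 < K.+1 %/ g)%N by rewrite -mE.
  move: (_ %/ _)%N => u; clear; nia.
apply: le_trans (isolated_small lam K.+1%:R m.+1%:R l2 (ler0n _ _) lamC Wm).
apply: (@prob_no_isolated _ _ _ _ p _ _ _ N) => // [c||].
- by exact: (prob_cell_empty d0 n_gt0 hX).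
- by rewrite mE leq_trunc_div.
- by rewrite expR_ge0 -expR0 ler_expR oppr_le0 (le_trans ler01).
Qed.

Theorem theorem2 (R : realType) (d : nat) (hd : (2 <= d)%N)
    (p : \bar R) (hp : (1 <= p)%E)
    (disp : nat -> measure_display)
    (Omega : forall n : nat, measurableType (disp n))
    (Pr : forall n : nat, probability (Omega n) R)
    (X : forall n : nat, Omega n -> {fset real_space R d})
    (hX : forall n : nat, poisson_process (Pr n) (cube n) (X n)) :
  Pr n [set w | hitting_radius p (k_connected 2) (X n w) =
                hitting_radius p has_hamilton_cycle (X n w)] @[n --> \oo]
  --> 1%E.
Proof.
have mE n : (0 < n)%N -> measurable (same_hitting_radius p (X n)).
  move=> n0; exact: (measurable_same_hitting_radius hp n0 (hX n)).
have : (prob (Pr n) (same_hitting_radius p (X n)))%:E @[n --> \oo] --> 1%E.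
  apply: cvg_EFin; first by near=> n.
  apply/cvgrPdist_le => eps eps0.
  have [n0 n0_gt0 n0P] := same_hitting_radius_likely hd hp eps0.
  near=> n; have nn0 : (n0 <= n)%N by near: n; exact: nbhs_infty_ge.
  have := n0P n nn0 _ _ _ _ (hX n).
  have := prob_le1 (Pr n) (mE n (leq_trans n0_gt0 nn0)).
  by rewrite ler_norml /=; move: (prob _ _) => x; lra.
(* The event is known to be measurable for positive [n], where its probability is the real number
   [prob]; the limit ignores [n = 0]. *)
apply: cvg_trans; apply: near_eq_cvg; near=> n.
rewrite -probE //; apply: mE; near: n; exact: nbhs_infty_gt.
Unshelve. all: by end_near. Qed.
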